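(* Let $N\in\{2,3\}$ and let $\Omega=\{x\in\mathbb{R}^N: |x|<1\}$ be the unit ball. Let $\mathbf{n}=\mathbf{n}(r)\in C[0,1]$ and $\sigma=\sigma(r)\in C^2[0,1]$ be functions of the radial variable $r=|x|$ only, with $\sigma$ bounded below by a positive constant, and suppose there are positive constants $\mathbf{n}_1,\mathbf{n}_2,M_1,M_2$ such that for all $r\in[0,1]$: (A1) $1<\mathbf{n}_1<\mathbf{n}(r)<\mathbf{n}_2$; (A2) $1<M_1<M_2$; (A3) $\sigma'(r)\le 0$; (A4) $M_1\le \mathbf{n}(r)^2/\sigma(r)\le M_2$; (A5) $\sigma'(r)^2\ge 2\sigma''(r)\sigma(r)$. Then for any given $\tau\in(0,1)$ there exists a sequence of pairs of transmission eigenfunctions $\{(u_m,v_m)\}_{m\in\mathbb{N}}$ associated with transmission eigenvalues $k_m$ satisfying $k_m\to\infty$ as $m\to\infty$, such that $$\lim_{m\to\infty}\frac{\|v_m\|_{L^2(\Omega_\tau)}}{\|v_m\|_{L^2(\Omega)}}=0,$$ where $\Omega_\tau=\{x\in\mathbb{R}^N:|x|<\tau\}$.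
   Context: A number $k\in\mathbb{R}_+$ is a transmission eigenvalue, with associated pair of transmission eigenfunctions $(u,v)\in H^1(\Omega)\times H^1(\Omega)$, if $(u,v)$ is a nontrivial solution (not $u=v\equiv 0$) of $$\nabla\cdot(\sigma\nabla u)+k^2\mathbf{n}^2u=0\ \text{ in }\Omega,\qquad \Delta v+k^2v=0\ \text{ in }\Omega,\qquad u=v,\ \ \sigma\frac{\partial u}{\partial\nu}=\frac{\partial v}{\partial\nu}\ \text{ on }\partial\Omega,$$ where $\nu$ is the exterior unit normal to $\partial\Omega$ (so $\partial/\partial\nu=\partial/\partial r$ for the unit ball). Here $\sigma$ and $\mathbf{n}$ are evaluated at $r=|x|$. *)

(* Defs.v *)
From HB Require Import structures.
From mathcomp Require Import all_boot all_order all_algebra.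
From mathcomp Require Import all_classical all_reals all_analysis.

Set Implicit Arguments.
Unset Strict Implicit.
Unset Printing Implicit Defensive.

Import Order.TTheory GRing.Theory Num.Theory.
Import numFieldNormedType.Exports.

Local Open Scope classical_set_scope.
Local Open Scope ring_scope.

(* R^n is 'rV[R]_n.  Its sigma-algebra is the one generated by the coordinates,
   that is, the Borel sigma-algebra. *)
Definition measure_rV_display : measure_display.
Proof. exact: default_measure_display. Qed.

Section measurable_rV.
Context {R : realType} {n : nat}.

Let coord (i : 'I_n) (x : 'rV[R]_n) : R := x 0 i.

Let rV_set0 : g_sigma_preimage coord set0.
Proof. exact: sigma_algebra0. Qed.

Let rV_setC A : g_sigma_preimage coord A -> g_sigma_preimage coord (~` A).
Proof. exact: sigma_algebraC. Qed.

Let rV_bigcup (F : _^nat) : (forall i, g_sigma_preimage coord (F i)) ->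
  g_sigma_preimage coord (\bigcup_i (F i)).
Proof. exact: sigma_algebra_bigcup. Qed.

HB.instance Definition _ := @isMeasurable.Build measure_rV_display
  'rV[R]_n (g_sigma_preimage coord) rV_set0 rV_setC rV_bigcup.

End measurable_rV.

Section rV_cons.
Context {R : realType}.

Definition rV_cons (n : nat) (p : measurableTypeR R * 'rV[R]_n) : 'rV[R]_n.+1 :=
  \row_i (if unlift ord0 i is Some j then p.2 0 j else p.1).

Lemma rV_cons0 n p : @rV_cons n p 0 ord0 = p.1.
Proof. by rewrite mxE unlift_none. Qed.

Lemma rV_consS n p i : @rV_cons n p 0 (lift ord0 i) = p.2 0 i.
Proof. by rewrite mxE liftK. Qed.

Lemma measurable_coord n (i : 'I_n) :
  measurable_fun [set: 'rV[R]_n] (fun x : 'rV[R]_n => x 0 i).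
Proof.
move=> _ Y mY; rewrite setTI; apply: sub_sigma_algebra => /=.
rewrite -bigcup_seq/=; exists i => /=; first by rewrite mem_index_enum.
by exists Y => //; rewrite setTI.
Qed.

Lemma measurable_fun_rV d (T : measurableType d) n (f : T -> 'rV[R]_n) :
  (forall i, measurable_fun [set: T] (fun x => f x 0 i)) ->
  measurable_fun [set: T] f.
Proof.
move=> mf _ Y; move: Y.
suff : (measurable : set (set 'rV[R]_n)) `<=` image_set_system setT f measurable.
  by move=> sub Y /sub; rewrite /image_set_system.
apply: smallest_sub; first exact/sigma_algebra_image/sigma_algebra_measurable.
rewrite -bigcup_seq/=; apply: bigcup_sub => i _ A [B mB <-].
by rewrite /image_set_system /= !setTI; have := mf i measurableT B mB; rewrite setTI.
Qed.

Lemma measurable_rV_cons n : measurable_fun setT (@rV_cons n).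
Proof.
apply: measurable_fun_rV => i; case: (unliftP ord0 i) => [j ->|->].
  under eq_fun do rewrite rV_consS.
  exact: (measurableT_comp (measurable_coord j) measurable_snd).
under eq_fun do rewrite rV_cons0.
exact: measurable_fst.
Qed.

End rV_cons.

Section lebesgue_rV_succ.
Local Open Scope ereal_scope.
Context {R : realType} (n : nat).
Variable m : {sigma_finite_measure set 'rV[R]_n -> \bar R}.

Definition lebesgue_rV_succ : set 'rV[R]_n.+1 -> \bar R :=
  pushforward (@lebesgue_measure R \x m) (@rV_cons R n).

Let mu := lebesgue_rV_succ.

Let measurable_preimage A : measurable A -> measurable (@rV_cons R n @^-1` A).
Proof. by move=> mA; rewrite -[X in measurable X]setTI; exact: measurable_rV_cons. Qed.

Let mu0 : mu set0 = 0.
Proof. by rewrite /mu /lebesgue_rV_succ /pushforward preimage_set0 measure0. Qed.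

Let mu_ge0 A : 0 <= mu A.
Proof. by rewrite /mu /lebesgue_rV_succ /pushforward; apply: measure_ge0. Qed.

Let mu_sigma_additive : semi_sigma_additive mu.
Proof.
move=> F mF tF mUF; rewrite /mu /lebesgue_rV_succ /pushforward preimage_bigcup.
apply: measure_semi_sigma_additive.
- by move=> i; exact: measurable_preimage.
- apply/trivIsetP => /= i j _ _ ij; rewrite -preimage_setI.
  by move/trivIsetP : tF => /(_ _ _ _ _ ij) ->//; rewrite preimage_set0.
- by rewrite -preimage_bigcup; exact: measurable_preimage.
Qed.

HB.instance Definition _ :=
  isMeasure.Build _ _ _ lebesgue_rV_succ mu0 mu_ge0 mu_sigma_additive.

Let uncons (x : 'rV[R]_n.+1) : measurableTypeR R * 'rV[R]_n :=
  (x 0%R ord0, (\row_i x 0 (lift ord0 i))%R).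

Let rV_consK : cancel (@rV_cons R n) uncons.
Proof.
move=> [a x]; rewrite /uncons rV_cons0; congr pair.
by apply/rowP => i; rewrite mxE rV_consS.
Qed.

Let measurable_uncons : measurable_fun setT uncons.
Proof.
apply/measurable_fun_pairP; split; first exact: measurable_coord.
apply: measurable_fun_rV => i.
rewrite (_ : (fun _ => _) = fun x : 'rV[R]_n.+1 => x 0%R (lift ord0 i)).
  exact: measurable_coord.
by apply/funext => x /=; rewrite mxE.
Qed.

Let prod_sigma_finite : sigma_finite setT (@lebesgue_measure R \x m).
Proof.
have /sigma_finiteP[F [TF ndF Foo]] := sigma_finiteT (@lebesgue_measure R).
have /sigma_finiteP[G [TG ndG Goo]] := sigma_finiteT m.
exists (fun n => F n `*` G n).
  rewrite -setXTT TF TG predeqE => -[x y]; split.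
    move=> [/= [i _ Fix] [k _ Gky]]; exists (maxn i k) => //; split.
    - by move: x Fix; exact/subsetPset/ndF/leq_maxl.
    - by move: y Gky; exact/subsetPset/ndG/leq_maxr.
  by move=> [i _ []/= ? ?]; split; exists i.
move=> k; have [? ?] := Foo k; have [? ?] := Goo k.
split; first exact: measurableX.
by rewrite product_measure1E// lte_mul_pinfty// ge0_fin_numE.
Qed.

Let mu_sigma_finite : sigma_finite setT mu.
Proof.
have [F TF Foo] := prod_sigma_finite.
exists (fun i => uncons @^-1` F i).
  by rewrite -preimage_bigcup -TF preimage_setT.
move=> i; have [mF Fi] := Foo i; split.
  by rewrite -[X in measurable X]setTI; exact: measurable_uncons.
rewrite /mu /lebesgue_rV_succ /pushforward -comp_preimage.
by rewrite (_ : uncons \o _ = id)//; apply/funext => x /=; rewrite rV_consK.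
Qed.

HB.instance Definition _ :=
  Measure_isSigmaFinite.Build _ _ _ lebesgue_rV_succ mu_sigma_finite.

End lebesgue_rV_succ.

Fixpoint lebesgue_rV (R : realType) (n : nat) :
    {sigma_finite_measure set 'rV[R]_n -> \bar R} :=
  match n with
  | 0 => @dirac _ 'rV[R]_0 0 R
  | n'.+1 => lebesgue_rV_succ (lebesgue_rV R n')
  end.

Lemma lebesgue_rV_box (R : realType) (n : nat) (A : 'I_n -> set R) :
  (forall i, measurable (A i)) ->
  lebesgue_rV R n [set x | forall i, A i (x 0 i)] =
  (\prod_(i < n) @lebesgue_measure R (A i))%E.
Proof.
elim: n A => [|n IHn] A mA.
  by rewrite big_ord0 /= diracE mem_set// => -[].
have mB : measurable [set x : 'rV[R]_n | forall i, A (lift ord0 i) (x 0 i)].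
  rewrite (_ : mkset _ = \big[setI/setT]_(i < n)
      ((fun x : 'rV[R]_n => x 0 i) @^-1` A (lift ord0 i))); last first.
    by apply/seteqP; split=> x; rewrite -bigcap_seq/= => H i;
      [move=> _; exact: H|apply: H; rewrite /= mem_index_enum].
  apply: bigsetI_measurable => i _; rewrite -[X in measurable X]setTI.
  exact: measurable_coord.
rewrite big_ord_recl -IHn//= /lebesgue_rV_succ /pushforward.
rewrite -product_measure1E//; last exact: mA.
congr ((_ \x _)%E _).
apply/seteqP; split => -[a x] /=.
  move=> H; split => [|i]; first by have := H ord0; rewrite rV_cons0.
  by have := H (lift ord0 i); rewrite rV_consS.
by move=> [Aa Ax] i; case: (unliftP ord0 i) => [j ->|->];
  rewrite ?rV_consS ?rV_cons0.
Qed.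

Section sobolev.
Context {R : realType} {N : nat}.
Implicit Types (D : set 'rV[R]_N) (u v w f phi : 'rV[R]_N -> R).
Implicit Types (F G : 'I_N -> 'rV[R]_N -> R).

Local Notation mu := (lebesgue_rV R N).

Definition enorm (x : 'rV[R]_N) : R := Num.sqrt (\sum_i x 0 i ^+ 2).

(* The norm of 'rV[R]_N in the library is the sup norm, so its [ball] is not
   the Euclidean one. *)
Definition eball (t : R) : set 'rV[R]_N := [set x | enorm x < t].

Definition in_L2 D u : Prop := u \_ D \in Lfun mu 2%:E.

Definition normL2 D u : \bar R := 'N[mu]_2%:E[EFin \o (u \_ D)]%E.

Definition partial (i : 'I_N) u : 'rV[R]_N -> R := 'D_(delta_mx 0 i) u.

(* Test functions: as in Gilbarg-Trudinger (ch. 7 and 8), weak derivatives, weak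
   solutions and H^1_0 are based on C^1 functions with compact support in D. *)
Definition C1c D phi : Prop :=
  [/\ forall i x, derivable phi x (delta_mx 0 i),
      forall i, continuous (partial i phi)
    & exists2 K, compact K /\ K `<=` D & forall x, ~ K x -> phi x = 0].

Definition dot F G (x : 'rV[R]_N) : R := \sum_i F i x * G i x.

(* u belongs to H^1(D), with weak gradient G. *)
Definition H1_grad D u G : Prop :=
  [/\ in_L2 D u, forall i, in_L2 D (G i)
    & forall phi i, C1c D phi ->
        \int[mu]_(x in D) (u x * partial i phi x) =
        - \int[mu]_(x in D) (G i x * phi x)].

(* The closure of C1c D in H^1(D). *)
Definition H10 D w : Prop :=
  exists2 G, H1_grad D w G & exists phi : nat -> 'rV[R]_N -> R,
    [/\ forall j, C1c D (phi j),
        normL2 D (w \- phi j) @[j --> \oo] --> 0%E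
      & forall i, normL2 D (G i \- partial i (phi j)) @[j --> \oo] --> 0%E].

Definition weak_div D F f : Prop :=
  [/\ forall i, in_L2 D (F i), in_L2 D f
    & forall phi, C1c D phi ->
        \int[mu]_(x in D) dot F (partial ^~ phi) x =
        - \int[mu]_(x in D) (f x * phi x)].

(* u = v on the boundary of D, in the sense of traces. *)
Definition eq_trace D u v : Prop := H10 D (u \- v).

(* Equality in H^(-1/2) of the normal traces of F and G on the boundary of D,
   when div F = f and div G = g: by Green's formula, the boundary pairing of the
   normal component of F with phi is the integral of F . grad phi + f phi. *)
Definition eq_normal_trace D F f G g : Prop :=
  forall phi Phi, H1_grad D phi Phi ->
    \int[mu]_(x in D) (dot F Phi x + f x * phi x) =
    \int[mu]_(x in D) (dot G Phi x + g x * phi x).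

(* Real-valued eigenfunctions, in the weak sense: div (sigma grad u) = - k^2 n^2 u
   and div (grad v) = - k^2 v in D, u = v and sigma du/dnu = dv/dnu on the
   boundary.  Functions are taken up to null sets. *)
Definition transmission_eigenfunctions D (sigma n : R -> R) (k : R) u v : Prop :=
  [/\ 0 < k,
      ~ {ae mu, forall x, D x -> u x = 0 /\ v x = 0}
    & exists Gu Gv,
        let sGu i x := sigma (enorm x) * Gu i x in
        let div_u x := - (k ^+ 2 * n (enorm x) ^+ 2 * u x) in
        let div_v x := - (k ^+ 2 * v x) in
        [/\ H1_grad D u Gu /\ H1_grad D v Gv,
            weak_div D sGu div_u,
            weak_div D Gv div_v,
            eq_trace D u v
          & eq_normal_trace D sGu div_u Gv div_v]].

End sobolev.

(* The difference quotient is restricted to A, so that the derivative is one-sided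
   at the end points when A is a closed interval. *)
Definition has_derivative_on {R : realType} (A : set R) (f f' : R -> R) : Prop :=
  forall x, A x -> (f y - f x) / (y - x) @[y --> within A x^'] --> f' x.

(* Main.v *)
Require Import Defs.
From mathcomp Require Import all_boot all_order all_algebra.
From mathcomp Require Import all_classical all_reals all_analysis.
From mathcomp Require Import measurable_realfun ring lra.

Import Order.TTheory GRing.Theory Num.Theory.
Import numFieldNormedType.Exports.

Set Implicit Arguments.
Unset Strict Implicit.
Unset Printing Implicit Defensive.

Local Open Scope classical_set_scope.
Local Open Scope ring_scope.

(** Separation of variables.  Let H be a harmonic polynomial of degree m in the first
  two coordinates, a Re (x_0 + i x_1)^m + b Im (x_0 + i x_1)^m.  Then u = w(|x|) H(x)
  and v = V(|x|) H(x) solve the two equations as soon as w and V solve a linear radial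
  equation which is singular at r = 0; its regular solutions are built by Picard
  iteration (ode_w, ode_y).  A multiple of u and v have the same Cauchy data on the
  sphere exactly when one scalar function of kappa = k^2 vanishes, namely the Wronskian
  type expression f(kappa) = conormal(w)(1) V(1) - w(1) conormal(V)(1).

  A zero of f is found in the window m^2 / (2 M2) <= kappa <= rho m^2, where rho < 1
  depends on M1 only (matching_eigenvalue).  There V does not vanish, because
  kappa <= m^2 is below the turning point.  The function w has no zero at the bottom of
  the window, since n^2 <= M2 sigma; but it oscillates near r = 1 at the top of the
  window, because n^2 >= M1 sigma with M1 > 1 makes the coefficient
  kappa r^2 n^2 - m^2 sigma positive of order m^2 there (mode_oscillates).  If f had no
  zero it would keep its sign, and at the parameters where w(1) = 0 this sign is the sign
  of w'(1).  Zeros of w are simple and can only enter through r = 1, so w would never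
  become negative if the sign is positive (zeros_enter_downwards), and would never become
  positive again after having been negative if the sign is negative
  (zeros_enter_upwards).  Both contradict the oscillation at the top of the window.

  Since kappa <= rho m^2 with rho < 1, the function v is concentrated near the sphere:
  if m = d g with (1 - rho) d^2 >= 1, then r^(m-g) V(r) is nondecreasing (mode_growth),
  so that r^m V(r) <= (r / s)^g s^m V(s) for r < s.  Comparing the energy in the ball of radius tau with the energy beyond a radius t < 1 such that
  tau < t^d gives a ratio at most C (tau / t^d)^g (mode_localization), and g, hence m and
  kappa, can be taken arbitrarily large.

  For the weak formulation, all the fields involved are C^1 on the punctured ball and
  O(|x|^2) at the origin once m >= 3.  Green's formula (green) is therefore proved by
  cutting off near the origin and near the sphere at once; the transmission conditions
  hold because the differences of the traces and of the fluxes of the two modes vanish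
  linearly at the sphere (transmission_pair). *)

(** * Primitives and derivation rules *)
Section calculus.
Context {R : realType}.
Implicit Types (f g h : R -> R) (a b r : R).

Lemma derive_ge0_le f f' a b : a <= b ->
  (forall x, a < x < b -> is_derive x 1 f (f' x)) ->
  {within `[a, b], continuous f} ->
  (forall x, a < x < b -> 0 <= f' x) -> f a <= f b.
Proof.
move=> ab df cf f'0; rewrite -subr_ge0.
move: ab; rewrite le_eqVlt => /predU1P[->|ab]; first by rewrite subrr.
have df' x : x \in `]a, b[ -> is_derive x 1 f (f' x) by rewrite in_itv/= => /df.
have [c cab ->] := MVT ab df' cf.
by rewrite mulr_ge0 ?subr_ge0 ?(ltW ab)// f'0//; move: cab; rewrite in_itv.
Qed.

Lemma continuous_within f (A : set R) : continuous f -> {within A, continuous f}.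
Proof. exact: continuous_subspaceT. Qed.

Definition prim f r : R := \int[lebesgue_measure]_(t in `[0, r]) f t.

Lemma integrable_cc f a b : continuous f ->
  (@lebesgue_measure R).-integrable `[a, b] (EFin \o f).
Proof.
move=> cf; apply: continuous_compact_integrable; first exact: segment_compact.
exact: continuous_subspaceT.
Qed.

Lemma prim_le0 f r : r <= 0 -> prim f r = 0.
Proof.
rewrite le_eqVlt => /predU1P[->|r0]; rewrite /prim; first by rewrite set_itv1 Rintegral_set1.
by rewrite set_itv_ge ?Rintegral_set0// bnd_simp -ltNge.
Qed.

Lemma is_derive_prim f r : continuous f -> 0 < r -> is_derive r 1 (prim f) (f r).
Proof.
move=> cf r0.
have r1 : r < r + 1 by rewrite ltrDl.
have [] := @continuous_FTC1_closed R f 0 r (r + 1) r1 (integrable_cc _ _ cf) r0 (cf r).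
by rewrite derive1E => d <-; exact: derivableP.
Qed.

Lemma continuous_prim f : continuous f -> continuous (prim f).
Proof.
move=> cf r; have [r0|r0] := ltP 0 r.
  have [d _] := is_derive_prim cf r0.
  by apply: differentiable_continuous; exact/derivable1_diffP.
move: r0; rewrite le_eqVlt => /predU1P[->|r0]; last first.
  rewrite /continuous_at (prim_le0 f (ltW r0)).
  apply: cvg_near_cst; near=> x; rewrite /= prim_le0//.
  by near: x; exact: lt_le_nbhsl.
rewrite /continuous_at prim_le0//.
have int01 : (@lebesgue_measure R).-integrable `[0, 1] (EFin \o f) by exact: integrable_cc.
have := @parameterized_integral_cvg_left R 0 1 f ltr01 int01.
rewrite /parameterized_integral => h; exact: h.
Unshelve. all: by end_near. Qed.

Lemma prim_bound f g h r : continuous f -> 0 <= r ->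
  (forall s, 0 < s < r -> is_derive s 1 h (g s)) -> {within `[0, r], continuous h} ->
  (forall s, 0 < s < r -> `|f s| <= g s) -> `|prim f r| <= h r - h 0.
Proof.
move=> cf r0 dh ch fg; rewrite ler_norml; apply/andP; split.
  suff : h 0 + prim f 0 <= h r + prim f r by rewrite (prim_le0 f (lexx 0))//; lra.
  apply: (@derive_ge0_le (h \+ prim f) (fun s => g s + f s)) => //.
  - move=> s s01; have ? := dh _ s01; have ? : is_derive s 1 (prim f) (f s).
      by apply: is_derive_prim => //; case/andP : s01.
    exact: is_deriveD.
  - move=> s; apply: continuousD; first exact: ch.
    by apply: continuous_within; exact: continuous_prim.
  - by move=> s /fg; rewrite ler_norml => /andP[]; lra.
suff : h 0 - prim f 0 <= h r - prim f r by rewrite (prim_le0 f (lexx 0))//; lra.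
apply: (@derive_ge0_le (h \- prim f) (fun s => g s - f s)) => //.
- move=> s s01; have ? := dh _ s01; have ? : is_derive s 1 (prim f) (f s).
    by apply: is_derive_prim => //; case/andP : s01.
  exact: is_deriveB.
- move=> s; apply: continuousB; first exact: ch.
  by apply: continuous_within; exact: continuous_prim.
- by move=> s /fg; rewrite ler_norml => /andP[]; lra.
Qed.

End calculus.

Section derivation_rules.
Context {R : realType} {V : normedModType R}.
Implicit Types (f g : V -> R) (x v : V).

Lemma derC (c : R) x v : is_derive x v (fun=> c) 0.
Proof. exact: is_derive_cst. Qed.

Lemma derD f g x v df dg : is_derive x v f df -> is_derive x v g dg ->
  is_derive x v (fun z => f z + g z) (df + dg).
Proof. by move=> ? ?; exact: is_deriveD. Qed.

Lemma derB f g x v df dg : is_derive x v f df -> is_derive x v g dg ->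
  is_derive x v (fun z => f z - g z) (df - dg).
Proof. by move=> ? ?; exact: is_deriveB. Qed.

Lemma derN f x v df : is_derive x v f df -> is_derive x v (fun z => - f z) (- df).
Proof. by move=> ?; exact: is_deriveN. Qed.

Lemma derM f g x v df dg : is_derive x v f df -> is_derive x v g dg ->
  is_derive x v (fun z => f z * g z) (f x * dg + df * g x).
Proof.
move=> ? ?; have -> : f x * dg + df * g x = f x *: dg + g x *: df.
  by rewrite /GRing.scale/= (mulrC df).
exact: is_deriveM.
Qed.

Lemma derX n f x v df : is_derive x v f df ->
  is_derive x v (fun z => f z ^+ n.+1) (n.+1%:R * f x ^+ n * df).
Proof.
elim: n => [|n ih] d; first by rewrite mul1r mul1r.
have := derM d (ih d).
rewrite (_ : (fun z => _) = (fun z => f z ^+ n.+2)); last first.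
  by apply/funext => z; rewrite (exprS _ n.+1).
by move/is_derive_eq; apply; rewrite exprS (mulrSr _ n.+1); ring.
Qed.

Lemma derV f x v df : f x != 0 -> is_derive x v f df ->
  is_derive x v (fun z => (f z)^-1) (- df / f x ^+ 2).
Proof.
move=> f0 [d <-]; have dV : derivable (fun z => (f z)^-1) x v by exact: derivableV.
by apply: DeriveDef => //; rewrite deriveV// /GRing.scale/= !mulNr mulrC.
Qed.

Lemma derMc f (c : R) x v df : is_derive x v f df ->
  is_derive x v (fun z => c * f z) (c * df).
Proof.
move=> d; have := derM (derC c x v) d.
by rewrite mul0r addr0.
Qed.

Lemma der_near f g x v df : v != 0 -> (\near x, f x = g x) ->
  is_derive x v f df -> is_derive x v g df.
Proof. by move=> v0 fg d; apply: near_eq_is_derive d => //. Qed.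

Lemma der_eq f g x v df dg : f =1 g -> df = dg ->
  is_derive x v f df -> is_derive x v g dg.
Proof. by move=> /funext -> ->. Qed.

End derivation_rules.

Section derivation_rules1.
Context {R : realType}.
Implicit Types (f g : R -> R) (x : R).

Lemma der_id x : is_derive x (1 : R) (fun z : R => z) 1.
Proof. exact: is_derive_id. Qed.

Lemma derXn n x : is_derive x (1 : R) (fun z : R => z ^+ n.+1) (n.+1%:R * x ^+ n).
Proof. by have := derX n (der_id x); rewrite mulr1. Qed.

Lemma derXp n x : (0 < n)%N ->
  is_derive x (1 : R) (fun z : R => z ^+ n) (n%:R * x ^+ n.-1).
Proof. by case: n => // n _; exact: derXn. Qed.

Lemma der_continuous f x df : is_derive x (1 : R) f df -> {for x, continuous f}.
Proof. by case=> d _; exact/differentiable_continuous/derivable1_diffP. Qed.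

End derivation_rules1.

(** * Averages with a power weight *)
Section prim_linear.
Context {R : realType}.
Implicit Types (f g : R -> R) (r : R).

Lemma primB f g r : continuous f -> continuous g ->
  prim f r - prim g r = prim (fun s => f s - g s) r.
Proof. by move=> cf cg; rewrite /prim RintegralB//; exact: integrable_cc. Qed.

Lemma prim_eq f h r : continuous f -> 0 <= r ->
  (forall s, 0 < s < r -> is_derive s 1 h (f s)) -> {within `[0, r], continuous h} ->
  prim f r = h r - h 0.
Proof.
move=> cf r0 dh ch.
have cp : {within `[0, r], continuous prim f}.
  by apply: continuous_within; exact: continuous_prim.
have dp s : 0 < s < r -> is_derive s 1 (prim f) (f s).
  by move=> /andP[s0 _]; exact: is_derive_prim.
have p0 : prim f 0 = 0 by rewrite prim_le0.
apply/eqP; rewrite eq_le; apply/andP; split.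
  suff : h 0 - prim f 0 <= h r - prim f r by lra.
  apply: (@derive_ge0_le _ (fun z => h z - prim f z) (fun=> 0)) => //.
    move=> s s0r; rewrite -(subrr (f s)); exact: (derB (dh _ s0r) (dp _ s0r)).
  by move=> s; apply: continuousB; [exact: ch|exact: cp].
suff : prim f 0 - h 0 <= prim f r - h r by lra.
apply: (@derive_ge0_le _ (fun z => prim f z - h z) (fun=> 0)) => //.
  move=> s s0r; rewrite -(subrr (f s)); exact: (derB (dp _ s0r) (dh _ s0r)).
by move=> s; apply: continuousB; [exact: cp|exact: ch].
Qed.

End prim_linear.

Section average.
Context {R : realType} (K : nat).
Hypothesis K0 : (0 < K)%N.
Implicit Types (f g : R -> R) (r : R).

(** The solution, regular at 0, of r y' + K y = f.  The value for r <= 0 makes it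
  continuous on the whole line when f is. *)
Definition avg f r : R :=
  if r <= 0 then f 0 / K%:R else prim (fun s => s ^+ K.-1 * f s) r / r ^+ K.

Let cpow f : continuous f -> continuous (fun s : R => s ^+ K.-1 * f s).
Proof. by move=> cf s; apply: cvgM; [exact: exprn_continuous|exact: cf]. Qed.

Let K1 : K = K.-1.+1. Proof. by rewrite prednK. Qed.

Let derXK (r : R) : is_derive r 1 (fun z : R => z ^+ K) (K%:R * r ^+ K.-1).
Proof. exact: derXp. Qed.

Lemma avgB f g r : continuous f -> continuous g ->
  avg f r - avg g r = avg (fun s => f s - g s) r.
Proof.
move=> cf cg; rewrite /avg; case: ifP => _; first by rewrite mulrBl.
rewrite -mulrBl primB; [|exact: cpow..].
by congr (prim _ _ / _); apply/funext => s; rewrite mulrBr.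
Qed.

Lemma avg_cst (a : R) r : avg (fun=> a) r = a / K%:R.
Proof.
rewrite /avg; case: leP => // r0.
have Kn : K%:R != 0 :> R by rewrite pnatr_eq0 -lt0n.
pose h (s : R) := a / K%:R * s ^+ K.
have -> : prim (fun s => s ^+ K.-1 * a) r = h r - h 0; last first.
  by rewrite /h expr0n [_ == _]gtn_eqF// mulr0 subr0 mulfK// expf_neq0// gt_eqF.
apply: prim_eq; rewrite ?(ltW r0)//.
- by apply: cpow => x; exact: cvg_cst.
- move=> s _; have := derMc (a / K%:R) (derXK s).
  by move/is_derive_eq; apply; field.
- by apply: continuous_within => s; apply: cvgM; [exact: cvg_cst|exact: exprn_continuous].
Qed.

Lemma avg_bound f r (B : R) : continuous f -> 0 < r ->
  (forall s, 0 < s <= r -> `|f s| <= B) -> `|avg f r| <= B.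
Proof.
move=> cf r0 fB; rewrite /avg (leNgt r) r0/= normrM normfV ler_pdivrMr ?normr_gt0; last first.
  by rewrite expf_neq0// gt_eqF.
rewrite (gtr0_norm (exprn_gt0 _ r0)).
have := @prim_bound _ _ (fun s => B * r ^+ K.-1) (fun s => B * r ^+ K.-1 * s) r
  (cpow cf) (ltW r0).
rewrite mulr0 subr0 -mulrA -exprSr -K1; apply.
- by move=> s _; have := derMc (B * r ^+ K.-1) (der_id s); rewrite mulr1.
- by apply: continuous_within => s; apply: cvgM; [exact: cvg_cst|exact: cvg_id].
move=> s /andP[s0 sr]; rewrite normrM mulrC ler_pM//; first by rewrite fB// s0 ltW.
by rewrite ger0_norm ?exprn_ge0 ?(ltW s0)// lerXn2r ?nnegrE ?(ltW s0) ?(ltW r0) ?(ltW sr).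
Qed.

Lemma is_derive_avg f r : continuous f -> 0 < r ->
  is_derive r 1 (avg f) ((f r - K%:R * avg f r) / r).
Proof.
move=> cf r0; have rn0 : r != 0 by rewrite gt_eqF.
apply: (@der_near _ _ (fun r => prim (fun s => s ^+ K.-1 * f s) r / r ^+ K)) => //.
  near=> s; rewrite /avg (leNgt s).
  by rewrite (_ : 0 < s)//; near: s; exact: lt_nbhsr.
have /is_derive_prim /(_ r0) d1 := cpow cf.
have rK0 : r ^+ K != 0 by rewrite expf_neq0.
have := derM d1 (@derV _ _ (fun z : R => z ^+ K) _ _ _ rK0 (derXK r)).
move/is_derive_eq; apply.
rewrite /avg (leNgt r) r0/=.
have [e eE] : exists e, e = r ^+ K.-1 by eexists.
rewrite [in X in X * f r]K1/= (_ : r ^+ K = r * e); last by rewrite {1}K1 exprS eE.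
rewrite -eE; set p := prim _ _; field.
by rewrite rn0 eE expf_neq0.
Unshelve. all: by end_near. Qed.

Lemma continuous_avg f : continuous f -> continuous (avg f).
Proof.
move=> cf r; have [r0|r0] := ltP 0 r.
  by apply: der_continuous; exact: is_derive_avg.
move: r0; rewrite le_eqVlt => /predU1P[->|r0]; last first.
  rewrite /continuous_at {2}/avg ltW//.
  apply: cvg_near_cst; near=> x; rewrite /avg ifT//.
  by near: x; exact: lt_le_nbhsl.
apply/cvgrPdist_le => /= e e0.
have /cvgrPdist_le /(_ _ e0)[d /= d0 fd] := cf 0.
exists d => //= x /=; rewrite sub0r normrN => xd.
have [x0|x0] := leP x 0; first by rewrite /avg lexx x0 subrr normr0 ltW.
rewrite distrC {2}/avg lexx -(avg_cst (f 0) x) avgB//; last by move=> z; exact: cvg_cst.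
apply: avg_bound => //; first by move=> z; apply: cvgB; [exact: cf|exact: cvg_cst].
move=> s /andP[s0 sx]; rewrite distrC fd//= sub0r normrN gtr0_norm//.
by rewrite (le_lt_trans sx)// -(gtr0_norm x0).
Unshelve. all: by end_near. Qed.

End average.

(** * The singular radial equation *)

(** The lower bounds u_i - 2 B / 2^i increase with i, so the limit of a geometrically
  Cauchy sequence is a supremum; this makes it an explicit function of the sequence. *)
Lemma fast_cauchy_limit (R : realType) (u : nat -> R) (B : R) : 0 <= B ->
  (forall j, `|u j.+1 - u j| <= B / 2 ^+ j) ->
  forall j, `|sup (range (fun i => u i - 2 * B / 2 ^+ i)) - u j| <= 2 * B / 2 ^+ j.
Proof.
move=> B0 uB.
have h2 j : 2 * B / 2 ^+ j.+1 = B / 2 ^+ j :> R.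
  by rewrite exprS; field; rewrite expf_neq0.
have lo i j : u i - 2 * B / 2 ^+ i <= u (i + j)%N - 2 * B / 2 ^+ (i + j).
  elim: j => [|j ih]; first by rewrite addn0.
  rewrite addnS; apply: (le_trans ih); have := uB (i + j)%N.
  rewrite ler_norml h2 => /andP[+ _]; rewrite -!mulrA.
  by move: (u _) (u _) (B / _) => a b e; lra.
have hi i j : u (i + j)%N + 2 * B / 2 ^+ (i + j) <= u i + 2 * B / 2 ^+ i.
  elim: j => [|j ih]; first by rewrite addn0.
  rewrite addnS; apply: le_trans ih; have := uB (i + j)%N.
  rewrite ler_norml h2 => /andP[_]; rewrite -!mulrA.
  by move: (u _) (u _) (B / _) => a b e; lra.
have B2 i : 0 <= 2 * B / 2 ^+ i by rewrite divr_ge0 ?exprn_ge0 ?mulr_ge0.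
have ub j : ubound (range (fun i => u i - 2 * B / 2 ^+ i)) (u j + 2 * B / 2 ^+ j).
  move=> _ [i _ <-]; apply: (le_trans (lo i j)).
  apply: le_trans (_ : u (i + j)%N + 2 * B / 2 ^+ (i + j) <= _).
    by rewrite lerD2l ge0_cp.
  by rewrite addnC; exact: hi.
have ne : range (fun i => u i - 2 * B / 2 ^+ i) !=set0 by exists (u 0%N - 2 * B / 2 ^+ 0), 0%N.
move=> j; rewrite ler_distl; apply/andP; split.
  apply: ub_le_sup; last by exists j.
  by exists (u 0%N + 2 * B / 2 ^+ 0); exact: ub.
by apply: ge_sup => //; exact: ub.
Qed.

Section singular_ode.
Context {R : realType} (K : nat) (sigma : R -> R) (c C : R).
Hypotheses (K0 : (0 < K)%N) (csigma : continuous sigma) (c0 : 0 < c).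
Hypotheses (sigma_ge : forall r, c <= sigma r) (C0 : 0 < C).
Implicit Types (Q f g : R -> R) (r : R).

(** The Picard operator of the radial system: its fixed points satisfy
  w(0) = 1 and sigma w' = y, where - y is the average of Q w. *)
Definition volterra Q f r : R :=
  1 - prim (fun s => avg K (fun z => Q z * f z) s / sigma s) r.

Let sigma_gt0 r : 0 < sigma r. Proof. exact: lt_le_trans (sigma_ge r). Qed.

(* With the weight exp (L r), this L makes the Picard operator a contraction by 1/2. *)
Let L : R := 2 * C / c.
Let e r : R := expR (L * r).

Let L0 : 0 < L. Proof. by rewrite divr_gt0 ?mulr_gt0. Qed.

Let e_homo : {homo e : x y / x <= y}.
Proof. by move=> x y xy; rewrite ler_expR ler_pM2l. Qed.

Let e_gt0 r : 0 < e r. Proof. exact: expR_gt0. Qed.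

Let is_derive_e r : is_derive r 1 e (L * e r).
Proof.
rewrite mulrC; apply: (is_derive1_comp (f := expR) (g := fun z => L * z)).
by have := derMc L (der_id r); rewrite mulr1.
Qed.

Let continuous_e : continuous e.
Proof. by move=> r; apply: der_continuous; exact: is_derive_e. Qed.

Let cmul Q f : continuous Q -> continuous f -> continuous (fun z => Q z * f z).
Proof. by move=> cQ cf r; apply: cvgM; [exact: cQ|exact: cf]. Qed.

Let cint Q f : continuous Q -> continuous f ->
  continuous (fun s => avg K (fun z => Q z * f z) s / sigma s).
Proof.
move=> cQ cf r; apply: cvgM; first by apply: continuous_avg => //; exact: cmul.
by apply: cvgV; [rewrite gt_eqF|exact: csigma].
Qed.

Lemma continuous_volterra Q f : continuous Q -> continuous f -> continuous (volterra Q f).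
Proof.
move=> cQ cf r; apply: cvgB; first exact: cvg_cst.
by apply: continuous_prim; exact: cint.
Qed.

(** Differences of Q and of f are estimated together, so that the same bound yields both
  the contraction and the dependence of the solution on Q. *)
Lemma volterra_diff Q Q' f g (D : R) r : continuous Q -> continuous Q' ->
  continuous f -> continuous g -> 0 <= r -> 0 <= D ->
  (forall s, 0 < s <= r -> `|Q s * f s - Q' s * g s| <= D * e s) ->
  `|volterra Q f r - volterra Q' g r| <= D / (2 * C) * e r.
Proof.
move=> cQ cQ' cf cg r0 D0 hD.
rewrite /volterra opprB addrC addrA subrK distrC primB; [|exact: cint..].
have De (s : R) : 0 <= D * e s by rewrite mulr_ge0 ?(ltW (e_gt0 _)).
have dh (s : R) : is_derive s 1 (fun s : R => D / (2 * C) * e s) (D * e s / c).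
  have := derMc (D / (2 * C)) (is_derive_e s); move/is_derive_eq; apply.
  by rewrite /L; field; rewrite !gt_eqF.
have := @prim_bound _ (fun s => avg K (fun z => Q z * f z) s / sigma s -
  avg K (fun z => Q' z * g z) s / sigma s) (fun s => D * e s / c)
  (fun s => D / (2 * C) * e s) r.
move=> h; apply: le_trans; first apply: h => //.
- by move=> x; apply: cvgB; exact: cint.
- by apply: continuous_within => s; apply: der_continuous; exact: dh.
- move=> s /andP[s0 sr]; rewrite -mulrBl normrM avgB; [|exact: cmul..].
  rewrite normfV (gtr0_norm (sigma_gt0 _)) ler_pM ?invr_ge0 ?(ltW (sigma_gt0 _))//.
    apply: avg_bound => //; first by move=> x; apply: cvgB; exact: cmul.
    move=> x /andP[x0 xs]; apply: le_trans (hD _ _) _.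
      by rewrite x0 (le_trans xs (ltW sr)).
    by rewrite ler_wpM2l// e_homo.
  by rewrite lef_pV2 ?posrE.
- by rewrite gerBl mulr_ge0 ?(ltW (e_gt0 _))// divr_ge0// mulr_ge0// ltW.
Qed.

Lemma volterra_contr Q f g (B : R) r : continuous Q -> (forall s, `|Q s| <= C) ->
  continuous f -> continuous g -> 0 <= r -> 0 <= B ->
  (forall s, 0 < s <= r -> `|f s - g s| <= B * e s) ->
  `|volterra Q f r - volterra Q g r| <= B / 2 * e r.
Proof.
move=> cQ QC cf cg r0 B0 fg.
rewrite (_ : B / 2 = C * B / (2 * C)); last by field; rewrite gt_eqF.
apply: volterra_diff => //; first by rewrite mulr_ge0// ltW.
by move=> s s0; rewrite -mulrBr normrM -mulrA ler_pM// fg.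
Qed.

Let picard Q j := iter j (volterra Q) (cst 0).

Let continuous_picard Q j : continuous Q -> continuous (picard Q j).
Proof.
move=> cQ; elim: j => [|j ih]; first by move=> x; exact: cvg_cst.
exact: continuous_volterra.
Qed.

(* On the negative half-line all iterates after the first are equal to 1. *)
Let E r := e (Num.max 0 r).

Let picard_step Q j r : continuous Q -> (forall s, `|Q s| <= C) ->
  `|picard Q j.+1 r - picard Q j r| <= E r / 2 ^+ j.
Proof.
move=> cQ QC; have [r0|r0] := leP 0 r; last first.
  have E1 : E r = 1 by rewrite /E max_l ?(ltW r0)// /e mulr0 expR0.
  case: j => [|j]; rewrite E1 /= /volterra !(prim_le0 _ (ltW r0)) subr0.
    by rewrite subr0 normr1 expr0 divr1.
  by rewrite subrr normr0 divr_ge0// exprn_ge0.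
rewrite {1}/E max_r// mulrC; elim: j r r0 => [|j ih] r r0.
  have -> : picard Q 1 r = 1.
    rewrite /= /volterra (_ : (fun s => _) = fun=> 0) ?/prim ?Rintegral_cst// ?mul0r ?subr0//.
    apply/funext => s; rewrite (_ : (fun z => _) = fun=> 0) ?avg_cst// ?mul0r//.
    by apply/funext => z; rewrite mulr0.
  rewrite subr0 normr1 expr0 invr1 mul1r /e -expR0 ler_expR.
  by rewrite mulr_ge0// ltW.
rewrite (_ : (2 ^+ j.+1)^-1 = (2 ^+ j)^-1 / 2); last by rewrite exprS invfM mulrC.
apply: (volterra_contr (f := picard Q j.+1) (g := picard Q j)) => //.
- exact: continuous_picard.
- exact: continuous_picard.
by move=> s /andP[s0 _]; apply: ih; exact: ltW.
Qed.

Definition ode_w Q r : R := sup (range (fun j => picard Q j r - 2 * E r / 2 ^+ j)).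

Definition ode_y Q r : R := - avg K (fun z => Q z * ode_w Q z) r.

Section solution.
Variable Q : R -> R.
Hypotheses (cQ : continuous Q) (QC : forall s, `|Q s| <= C).

Let E0 r : 0 <= E r. Proof. rewrite /E. exact: ltW. Qed.

Let approx r j : `|ode_w Q r - picard Q j r| <= 2 * E r / 2 ^+ j.
Proof.
apply: (@fast_cauchy_limit R (fun j => picard Q j r) (E r)) => // i.
exact: picard_step.
Qed.

Let geometric_small (a d : R) : 0 <= a -> 0 < d -> exists j : nat, a / 2 ^+ j <= d.
Proof.
move=> a0 d0; pose j := Num.bound (a / d); exists j.
have aj : a / d < j%:R by apply: archi_boundP; rewrite divr_ge0// ltW.
rewrite ler_pdivrMr ?exprn_gt0// mulrC -ler_pdivrMr// (le_trans (ltW aj))//.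
by rewrite -natrX ler_nat ltnW// ltn_expl.
Qed.

Lemma ode_w_cont : continuous (ode_w Q).
Proof.
move=> r; apply/cvgrPdist_le => /= d d0.
have [j hj] : exists j : nat, 2 * E (r + 1) / 2 ^+ j <= d / 3.
  by apply: geometric_small; rewrite ?mulr_ge0// divr_gt0.
have Emono x y : x <= y -> E x <= E y.
  by move=> xy; apply: e_homo; rewrite ge_max le_max lexx/= le_max xy orbT.
have d3 : 0 < d / 3 by rewrite divr_gt0.
have /cvgrPdist_le /(_ _ d3) := @continuous_picard Q j cQ r.
apply: filter_app; near=> s => ps.
have hs x : x <= r + 1 -> `|ode_w Q x - picard Q j x| <= d / 3.
  move=> xr; apply: (le_trans (approx _ _)); apply: le_trans hj.
  by rewrite ler_pM2r ?invr_gt0 ?exprn_gt0// ler_pM2l// Emono.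
have := hs r; rewrite lerDl ler01 => /(_ isT) h1.
have : s <= r + 1 by near: s; apply: lt_le_nbhsl; rewrite ltrDl.
move=> /hs h2.
have -> : ode_w Q r - ode_w Q s = (ode_w Q r - picard Q j r) +
  (picard Q j r - picard Q j s) - (ode_w Q s - picard Q j s) by ring.
rewrite (le_trans (ler_normB _ _))// (le_trans (lerD (ler_normD _ _) (lexx _)))//.
by move: h1 h2 ps; lra.
Unshelve. all: by end_near. Qed.

Lemma ode_w_fix r : ode_w Q r = volterra Q (ode_w Q) r.
Proof.
apply/eqP; rewrite -subr_eq0 -normr_eq0; apply/eqP/le_anti; rewrite normr_ge0 andbT.
apply/ler_addgt0Pr => d d0; rewrite add0r.
have [j hj] := geometric_small (mulr_ge0 (ler0n _ 2) (E0 r)) d0.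
apply: le_trans hj.
have -> : ode_w Q r - volterra Q (ode_w Q) r =
  (ode_w Q r - picard Q j.+1 r) + (volterra Q (picard Q j) r - volterra Q (ode_w Q) r).
  by rewrite [picard Q j.+1 r]/(volterra Q (picard Q j) r) addrA subrK.
have -> : 2 * E r / 2 ^+ j = 2 * E r / 2 ^+ j.+1 + E r / 2 ^+ j.
  by rewrite exprS; field; rewrite expf_neq0.
apply: (le_trans (ler_normD _ _)); rewrite lerD//.
have [r0|r0] := leP 0 r; last first.
  by rewrite /volterra !(prim_le0 _ (ltW r0)) subrr normr0 divr_ge0// exprn_ge0.
have Er s : 0 <= s -> E s = e s by move=> s0; rewrite /E max_r.
rewrite Er// mulrC (_ : (2 ^+ j)^-1 = (2 / 2 ^+ j) / 2); last by field; rewrite expf_neq0.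
apply: volterra_contr => //.
- exact: continuous_picard.
- exact: ode_w_cont.
- move=> s /andP[s0 _]; rewrite distrC (le_trans (approx _ _))// Er ?(ltW s0)//.
  by rewrite mulrAC.
Qed.

Lemma ode_w_bound r : 0 <= r -> `|ode_w Q r| <= 2 * e r.
Proof.
move=> r0; have := approx r 0; rewrite subr0 expr0 divr1.
by rewrite /E max_r.
Qed.

Lemma ode_y_cont : continuous (ode_y Q).
Proof.
move=> r; apply: cvgN; apply: continuous_avg => //; apply: cmul => //.
exact: ode_w_cont.
Qed.

Lemma ode_w0 : ode_w Q 0 = 1.
Proof. by rewrite ode_w_fix /volterra prim_le0// subr0. Qed.

Lemma is_derive_ode_w r : 0 < r -> is_derive r 1 (ode_w Q) (ode_y Q r / sigma r).
Proof.
move=> r0.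
have -> : ode_w Q = volterra Q (ode_w Q) by apply/funext => s; exact: ode_w_fix.
have := derB (derC 1 r 1) (is_derive_prim (cint cQ ode_w_cont) r0).
by move/is_derive_eq; apply; rewrite /ode_y sub0r mulNr.
Qed.

Lemma is_derive_ode_y r : 0 < r ->
  is_derive r 1 (ode_y Q) (- (K%:R * ode_y Q r + Q r * ode_w Q r) / r).
Proof.
move=> r0; have := derN (is_derive_avg K0 (cmul cQ ode_w_cont) r0).
by move/is_derive_eq; apply; rewrite /ode_y; field; rewrite gt_eqF.
Qed.

End solution.

(** The weighted maximum B of the difference of the two solutions satisfies
  B <= B / 2 + d / C by the contraction property. *)
Lemma ode_stable Q Q' (d : R) : continuous Q -> (forall s, `|Q s| <= C) ->
  continuous Q' -> (forall s, `|Q' s| <= C) -> (forall s, `|Q s - Q' s| <= d) ->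
  forall r, 0 <= r <= 1 ->
  `|ode_w Q r - ode_w Q' r| <= 4 * e 1 / C * d /\
  `|ode_y Q r - ode_y Q' r| <= 6 * e 1 * d.
Proof.
move=> cQ QC cQ' Q'C hd.
have d0 : 0 <= d by exact: le_trans (hd 0).
pose D r := `|ode_w Q r - ode_w Q' r| / e r.
have [cw cw'] := (ode_w_cont cQ QC, ode_w_cont cQ' Q'C).
have cD : {within `[0, 1], continuous D}.
  apply: continuous_within => r; apply: cvgM.
    by apply: cvg_norm; apply: cvgB; [exact: cw|exact: cw'].
  by apply: cvgV; [rewrite gt_eqF|exact: continuous_e].
have [r1] := EVT_max (ler01 : 0 <= 1 :> R) cD.
rewrite in_itv/= => /andP[r10 r11] Dmax.
pose B := D r1.
have B0 : 0 <= B by rewrite /B /D divr_ge0// ltW.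
have wB s : 0 <= s <= 1 -> `|ode_w Q s - ode_w Q' s| <= B * e s.
  by move=> s01; rewrite -ler_pdivrMr//; apply: Dmax; rewrite in_itv.
have QB s : 0 <= s <= 1 ->
    `|Q s * ode_w Q s - Q' s * ode_w Q' s| <= (C * B + 2 * d) * e s.
  move=> s01; have -> : Q s * ode_w Q s - Q' s * ode_w Q' s =
    Q s * (ode_w Q s - ode_w Q' s) + (Q s - Q' s) * ode_w Q' s.
    by move: (ode_w Q s) (ode_w Q' s) => a b; ring.
  apply: (le_trans (ler_normD _ _)); rewrite !normrM mulrDl lerD//.
    by rewrite -mulrA ler_pM// wB.
  rewrite [leRHS](_ : _ = d * (2 * e s)); last by rewrite mulrCA mulrA.
  by rewrite ler_pM// ode_w_bound//; case/andP : s01.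
have CB0 : 0 <= C * B + 2 * d by rewrite addr_ge0 // mulr_ge0 // ltW.
have B4 : B <= 2 * d / C.
  have : B * e r1 <= (C * B + 2 * d) / (2 * C) * e r1.
    rewrite {1}/B /D divfK ?gt_eqF// ode_w_fix// (ode_w_fix cQ')//.
    apply: volterra_diff => // s /andP[s0 s1]; apply: QB.
    by rewrite ltW// (le_trans s1).
  rewrite ler_pM2r// ler_pdivlMr ?mulr_gt0// ler_pdivlMr//.
  by move: (B) => b; lra.
move=> r /andP[r0 r1']; split.
  apply: (le_trans (wB _ _)); first by rewrite r0.
  apply: (@le_trans _ _ (2 * d / C * e 1)).
    by rewrite ler_pM ?(ltW (e_gt0 _))// e_homo.
  rewrite [leRHS](_ : _ = 2 * (2 * d / C * e 1)); last by move: (e 1) => a; ring.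
  have : 0 <= 2 * d / C * e 1.
    by rewrite !mulr_ge0 ?invr_ge0 ?(ltW C0) ?(ltW (e_gt0 _)).
  by move: (2 * d / C * e 1) => a; lra.
have CB4 : (C * B + 2 * d) * e 1 <= 6 * e 1 * d.
  have : C * B <= 2 * d by rewrite mulrC -ler_pdivlMr.
  rewrite (_ : 6 * e 1 * d = (6 * d) * e 1); last by rewrite mulrAC.
  by rewrite ler_pM2r//; lra.
move: r0; rewrite le_eqVlt => /predU1P[<-|r0].
  rewrite /ode_y opprK addrC distrC avgB//; [|exact: cmul..].
  rewrite /avg lexx normrM normfV ler_pdivrMr ?normr_gt0 ?pnatr_eq0 -?lt0n//.
  apply: (le_trans (QB 0 _)); first by rewrite lexx ler01.
  apply: (@le_trans _ _ ((C * B + 2 * d) * e 1)); first by rewrite ler_wpM2l// e_homo.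
  apply: (le_trans CB4); rewrite ler_peMr ?mulr_ge0 ?(ltW (e_gt0 _))//.
  by rewrite ger0_norm// ler1n.
rewrite /ode_y opprK addrC distrC avgB//; [|exact: cmul..].
apply: avg_bound => //; first by move=> x; apply: cvgB; exact: cmul.
move=> s /andP[s0 sr]; apply: le_trans CB4.
apply: (le_trans (QB s _)); first by rewrite ltW// (le_trans sr).
by rewrite ler_wpM2l// e_homo// (le_trans sr).
Qed.

End singular_ode.

(** The equation of the factor w of a mode w(|x|) H(x), H harmonic of degree m, as a
  first order system with y = sigma w'.  For the transmission problem in dimension N,
  K = 2 m + N - 1 and Q r = m sigma'(r) + kappa r n(r)^2. *)
Definition radial_ode {R : realType} (K : nat) (sigma Q w y : R -> R) : Prop :=
  [/\ w 0 = 1, continuous w, continuous y,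
      forall r : R, 0 < r -> is_derive r 1 w (y r / sigma r)
    & forall r : R, 0 < r -> is_derive r 1 y (- (K%:R * y r + Q r * w r) / r)].

Section no_double_zero.
Context {R : realType} (K : nat) (sigma Q w y : R -> R) (c C : R).
Hypotheses (c0 : 0 < c) (sigma_ge : forall r, c <= sigma r) (QC : forall s, `|Q s| <= C).
Hypothesis (ode : radial_ode K sigma Q w y).

(** Uniqueness at r > 0 propagates down to the singular point: for A large, the factor
  s^(A+1) absorbs the 1 / s singularity, and (w^2 + y^2) s^(A+1) is nondecreasing, so a
  double zero at r forces w = 0 on (0, r), against w(0) = 1. *)
Lemma no_double_zero (r : R) : 0 < r <= 1 -> w r = 0 -> y r = 0 -> False.
Proof.
case: ode => w0 cw cy dw dy /andP[r0 r1] wr yr.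
pose A := Num.bound (c^-1 + 2 * K%:R + C).
have C0 : 0 <= C by exact: le_trans (QC 0).
have Ab : c^-1 + 2 * K%:R + C <= A%:R.
  by rewrite ltW// archi_boundP// !addr_ge0 ?mulr_ge0// invr_ge0 ltW.
pose S (s : R) := w s ^+ 2 + y s ^+ 2.
have S0 s : 0 <= S s by rewrite addr_ge0// sqr_ge0.
pose dS (s : R) := (2 * w s ^+ 1 * (y s / sigma s) +
  2 * y s ^+ 1 * (- (K%:R * y s + Q s * w s) / s)).
have dSE (s : R) : 0 < s -> is_derive s 1 (fun s : R => S s * s ^+ A.+1)
    (S s * (A.+1%:R * s ^+ A) + dS s * s ^+ A.+1).
  by move=> s0; exact: derM (derD (derX 1 (dw _ s0)) (derX 1 (dy _ s0))) (derXn A s).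
have dS_ge (s : R) : 0 < s < r -> 0 <= S s * (A.+1%:R * s ^+ A) + dS s * s ^+ A.+1.
  move=> /andP[s0 sr].
  have -> : S s * (A.+1%:R * s ^+ A) + dS s * s ^+ A.+1 = s ^+ A *
      (A.+1%:R * S s + (s / sigma s) * (2 * w s * y s) -
       2 * K%:R * y s ^+ 2 - Q s * (2 * w s * y s)).
    rewrite /dS (exprS s A); move: (S s) (w s) (y s) (s ^+ A) (Q s) => a b d e q.
    by field; rewrite !gt_eqF// (lt_le_trans c0).
  apply: mulr_ge0; first by rewrite exprn_ge0// ltW.
  have X : `|2 * w s * y s| <= S s.
    rewrite ler_norml /S; have := sqr_ge0 (w s + y s); have := sqr_ge0 (w s - y s).
    by move: (w s) (y s) => a b; rewrite !expr2 => h1 h2; apply/andP; split; lra.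
  have sX : `|(s / sigma s) * (2 * w s * y s)| <= c^-1 * S s.
    rewrite normrM ler_pM// ger0_norm ?divr_ge0 ?(ltW s0)//; last first.
      by rewrite (le_trans _ (sigma_ge s))// ltW.
    rewrite -[c^-1]mul1r ler_pM ?invr_ge0 ?(ltW s0) ?(le_trans _ (sigma_ge s)) ?(ltW c0)//.
      by rewrite (le_trans (ltW sr)).
    by rewrite lef_pV2 ?posrE// (lt_le_trans c0).
  have QX : `|Q s * (2 * w s * y s)| <= C * S s by rewrite normrM ler_pM.
  have yS : K%:R * y s ^+ 2 <= K%:R * S s by rewrite ler_wpM2l// lerDr sqr_ge0.
  have AS : (c^-1 + 2 * K%:R + C) * S s <= A.+1%:R * S s.
    by rewrite ler_wpM2r// (le_trans Ab)// ler_nat.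
  move: sX QX yS AS; rewrite !ler_norml => /andP[+ _] /andP[_ +].
  move: (_ * (2 * w s * y s)) (_ * (2 * w s * y s)) => a b.
  rewrite !mulrDl -!mulrA.
  by move: (c^-1 * S s) (C * S s) (K%:R * S s) (A.+1%:R * S s) (K%:R * _) => *; lra.
have wS (s : R) : 0 < s < r -> w s = 0.
  move=> /andP[s0 sr].
  have : S s * s ^+ A.+1 <= S r * r ^+ A.+1.
    apply: (@derive_ge0_le _ (fun s : R => S s * s ^+ A.+1) _ s r (ltW sr)).
    - by move=> x /andP[sx _]; apply: dSE; exact: lt_trans sx.
    - by apply: continuous_within => x; apply: cvgM; [apply: cvgD; apply: cvgM;
        first [exact: cw|exact: cy] |exact: exprn_continuous].
    - by move=> x /andP[sx xr]; apply: dS_ge; rewrite (lt_trans s0 sx).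
  rewrite {2}/S wr yr !expr0n/= addr0 mul0r pmulr_lle0 ?exprn_gt0// => Sle.
  have : S s == 0 by rewrite eq_le Sle S0.
  by rewrite paddr_eq0 ?sqr_ge0// sqrf_eq0 => /andP[/eqP].
have /cvgrPdist_lt /(_ _ ltr01)[d /= d0 hd] := cw 0.
have [s /andP[s0 sm]] : exists s, 0 < s < Num.min d r.
  have m0 : 0 < Num.min d r by rewrite lt_min d0.
  by exists (Num.min d r / 2); rewrite divr_gt0//= ltr_pdivrMr// ltr_pMr// ltr1n.
move: sm; rewrite lt_min => /andP[sd sr].
have := hd s; rewrite /= sub0r normrN (gtr0_norm s0) => /(_ sd).
by rewrite w0 wS ?s0// subr0 normr1 ltxx.
Qed.

End no_double_zero.

(** * Growth and oscillation of one mode *)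
Lemma first_zero {R : realType} (w : R -> R) (z : R) : continuous w -> 0 <= z ->
  0 < w 0 -> w z <= 0 ->
  exists z0, [/\ 0 < z0, z0 <= z, w z0 = 0 & forall s, 0 <= s < z0 -> 0 < w s].
Proof.
move=> cw z0 w0 wz.
pose A := `[0, z]%classic `&` w @^-1` [set x | x <= 0].
have cA : compact A.
  apply: compact_closedI; first exact: segment_compact.
  by apply: closed_comp => // x _; exact: cw.
have cid : {within A, continuous (fun x : R => x)}.
  by apply: continuous_within => x; exact: cvg_id.
have [|c] := compact_EVT_min _ cA cid.
  by exists z; split => //=; rewrite in_itv/= z0 lexx.
rewrite inE => -[]; rewrite /= in_itv/= => /andP[c0 cz] wc cmin.
have wpos s : 0 <= s < c -> 0 < w s.
  move=> /andP[s0 sc]; rewrite ltNge; apply/negP => ws.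
  have /cmin : s \in A by rewrite inE; split => //=; rewrite in_itv/= s0 (le_trans (ltW sc)).
  by rewrite leNgt sc.
have c0' : 0 < c.
  by rewrite lt_neqAle c0 andbT; apply/eqP => c0E; move: wc w0; rewrite -c0E => /le_lt_trans h /h; rewrite ltxx.
have [|d] := @IVT R w 0 c 0 c0 (continuous_within cw).
  by rewrite ge_min wc orbT/= le_max ltW.
rewrite in_itv/= => /andP[d0 dc] wd; exists c; split => //.
move: dc; rewrite le_eqVlt => /predU1P[<-//|dc].
by have := wpos d; rewrite d0 dc wd ltxx => /(_ isT).
Qed.

Section mode.
Context {R : realType} (m p : nat) (sigma sigma1 q Q w y : R -> R) (kappa : R).
Hypotheses (m0 : (0 < m)%N) (csigma : continuous sigma).
Hypothesis (sigma_gt0 : forall r, 0 < sigma r).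
Hypothesis (dsigma : forall r : R, 0 < r < 1 -> is_derive r 1 sigma (sigma1 r)).
Hypothesis (QE : forall r, 0 < r < 1 -> Q r = m%:R * sigma1 r + kappa * r * q r).
Hypothesis (ode : radial_ode (2 * m + p.+1) sigma Q w y).
Implicit Type r : R.

(** The radial flux: with sigma and w evaluated at |x|, x . sigma grad (w H) is
  conormal(|x|) H(x), for H harmonic and homogeneous of degree m. *)
Definition conormal r : R := r * y r + m%:R * sigma r * w r.
Local Notation B := conormal.

Let lambda : R := m%:R * (m + p)%:R.

Lemma continuous_conormal : continuous B.
Proof.
case: ode => _ cw cy _ _ r; apply: cvgD; first by apply: cvgM; [exact: cvg_id|exact: cy].
by apply: cvgM; [apply: cvgM; [exact: cvg_cst|exact: csigma]|exact: cw].
Qed.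

Lemma is_derive_conormal r : 0 < r < 1 -> is_derive r 1 B
  (- ((m + p)%:R * (r * y r) + kappa * r ^+ 2 * q r * w r) / r).
Proof.
case: ode => _ _ _ dw dy r01; have /andP[r0 r1] := r01.
have := derD (derM (der_id r) (dy _ r0)) (derM (derMc m%:R (dsigma r01)) (dw _ r0)).
move/is_derive_eq; apply; rewrite QE//.
have := sigma_gt0 r; move: (w r) (y r) (sigma r) (sigma1 r) (q r) => a b s s1 q1 s0.
rewrite natrD natrM mulrSr natrD; field; rewrite !gt_eqF//.
Qed.

Let is_derive_Bpow r : 0 < r < 1 -> is_derive r 1 (fun r => r ^+ (m + p) * B r)
  (r ^+ (m + p).-1 * (w r * (lambda * sigma r - kappa * r ^+ 2 * q r))).
Proof.
move=> r01; have /andP[r0 r1] := r01.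
have mp : (0 < m + p)%N by rewrite addn_gt0 m0.
have := derM (derXp r mp) (is_derive_conormal r01).
move/is_derive_eq; apply.
rewrite -{1}(prednK mp) exprS /conormal /lambda.
move: (w r) (y r) (sigma r) (q r) (r ^+ _) => a b s q1 e.
by field; rewrite gt_eqF.
Qed.

Lemma is_derive_mode r : 0 < r -> is_derive r 1 (fun r => r ^+ m * w r)
  (r ^+ m.-1 * (B r / sigma r)).
Proof.
case: ode => _ _ _ dw _ r0.
have := derM (derXp r m0) (dw _ r0); move/is_derive_eq; apply.
rewrite -{1}(prednK m0) exprS /conormal.
have := sigma_gt0 r; move: (w r) (y r) (sigma r) (r ^+ _) => a b s e s0.
by field; rewrite gt_eqF.
Qed.

(** Up to the first zero of w, r^(m+p) times the conormal derivative is nondecreasing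
  from 0, hence r^m w is nondecreasing and cannot return to 0. *)
Lemma mode_gt0 : (forall r, 0 < r < 1 -> kappa * r ^+ 2 * q r <= lambda * sigma r) ->
  forall r, 0 <= r <= 1 -> 0 < w r.
Proof.
case: ode => w0 cw cy dw dy hk r /andP[r0 r1].
rewrite ltNge; apply/negP => wr.
have w00 : 0 < w 0 by rewrite w0.
have [z [z0 zr wz wpos]] := first_zero cw r0 w00 wr.
have z1 : z <= 1 by exact: le_trans r1.
have Bge x : 0 < x < z -> 0 <= B x.
  move=> /andP[x0 xz].
  have : 0 ^+ (m + p) * B 0 <= x ^+ (m + p) * B x.
    apply: (@derive_ge0_le _ (fun r => r ^+ (m + p) * B r) _ _ _ (ltW x0)).
    - by move=> s /andP[s0 sx]; apply: is_derive_Bpow; rewrite s0 (lt_trans sx)// (lt_le_trans xz).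
    - apply: continuous_within => s; apply: cvgM; first exact: exprn_continuous.
      exact: continuous_conormal.
    - move=> s /andP[s0 sx]; have sz := lt_trans sx xz.
      rewrite mulr_ge0 ?exprn_ge0 ?(ltW s0)// mulr_ge0 ?(ltW (wpos _ _)) ?(ltW s0)//.
      by rewrite subr_ge0 hk// s0 (lt_le_trans sz).
  by rewrite expr0n addn_eq0 -[m == 0%N]negbK -lt0n m0/= mul0r pmulr_rge0// exprn_gt0.
have : (z / 2) ^+ m * w (z / 2) <= z ^+ m * w z.
  apply: (@derive_ge0_le _ (fun r => r ^+ m * w r) (fun r => r ^+ m.-1 * (B r / sigma r))).
  - by rewrite ler_pdivrMr// ler_peMr ?ler1n// ltW.
  - by move=> x /andP[x0 _]; apply: is_derive_mode; apply: lt_trans x0; rewrite divr_gt0.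
  - by apply: continuous_within => s; apply: cvgM; [exact: exprn_continuous|exact: cw].
  - move=> x /andP[x0 xz].
    have x00 : 0 < x by apply: lt_trans x0; rewrite divr_gt0.
    by rewrite mulr_ge0 ?exprn_ge0 ?(ltW x00)// divr_ge0 ?(ltW (sigma_gt0 _))// Bge// x00.
rewrite wz mulr0 leNgt mulr_gt0// ?exprn_gt0 ?divr_gt0// wpos// ltW ?divr_gt0//=.
by rewrite ltr_pdivrMr// ltr_pMr// ltr1n.
Qed.

(** The sign of (r^(m-g) w)' is that of conormal - g w, which stays nonnegative because
  r^(m+p+g) (conormal - g w) has derivative
  r^(m+p+g-1) w ((m+p+g)(m-g) - kappa r^2 q). *)
Lemma mode_growth (g : nat) : (g < m)%N -> sigma = cst 1 ->
  (forall r, 0 < r < 1 -> kappa * q r <= (m + p + g)%:R * (m - g)%:R) ->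
  0 <= kappa -> (forall r, 0 <= q r) ->
  (forall r, 0 <= r <= 1 -> 0 < w r) ->
  forall r s, 0 <= r -> r <= s -> s <= 1 ->
  r ^+ (m - g) * w r <= s ^+ (m - g) * w s.
Proof.
move=> gm s1 hk k0 q0 wpos; case: ode => w0 cw cy dw dy.
pose e := (m + p + g)%N.
have e0 : (0 < e)%N by rewrite !addn_gt0 m0.
have mg0 : (0 < m - g)%N by rewrite subn_gt0.
have Bge r : 0 < r <= 1 -> 0 <= B r - g%:R * w r.
  move=> /andP[r0 r1].
  have : 0 ^+ e * (B 0 - g%:R * w 0) <= r ^+ e * (B r - g%:R * w r).
    apply: (@derive_ge0_le _ (fun r => r ^+ e * (B r - g%:R * w r))
      (fun r => r ^+ e.-1 * (w r * (e%:R * (m - g)%:R - kappa * r ^+ 2 * q r))) _ _ (ltW r0)).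
    - move=> s /andP[s0 sr]; have s01 : 0 < s < 1 by rewrite s0 (lt_le_trans sr).
      have := derM (derXp s e0) (derB (is_derive_conormal s01) (derMc g%:R (dw _ s0))).
      move/is_derive_eq; apply.
      rewrite -{1}(prednK e0) exprS /conormal s1 /= natrB 1?ltnW// /e !natrD.
      move: (w s) (y s) (q s) (s ^+ _) => a b q1 x.
      by field; rewrite gt_eqF.
    - apply: continuous_within => s; apply: cvgM; first exact: exprn_continuous.
      apply: cvgB; first exact: continuous_conormal.
      by apply: cvgM; [exact: cvg_cst|exact: cw].
    - move=> s /andP[s0 sr]; have s1' := lt_le_trans sr r1.
      rewrite mulr_ge0 ?exprn_ge0 ?(ltW s0)// mulr_ge0 ?(ltW (wpos _ _)) ?(ltW s0) ?(ltW s1')//.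
      rewrite subr_ge0; apply: le_trans (hk s _); last by rewrite s0.
      by rewrite mulrAC ler_piMr ?mulr_ge0// expr_le1// ltW.
  by rewrite expr0n [_ == _]gtn_eqF//= mul0r pmulr_rge0// exprn_gt0.
move=> r s r0 rs s1'.
apply: (@derive_ge0_le _ (fun r => r ^+ (m - g) * w r)
   (fun r => r ^+ (m - g).-1 * (B r - g%:R * w r)) _ _ rs).
- move=> x /andP[rx xs]; have x0 := le_lt_trans r0 rx.
  have := derM (derXp x mg0) (dw _ x0); move/is_derive_eq; apply.
  rewrite -{1}(prednK mg0) exprS /conormal s1 /= divr1 natrB 1?ltnW//.
  by move: (w x) (y x) (x ^+ _) => a b e1; ring.
- by apply: continuous_within => x; apply: cvgM; [exact: exprn_continuous|exact: cw].
- move=> x /andP[rx xs]; have x0 := le_lt_trans r0 rx.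
  by rewrite mulr_ge0 ?exprn_ge0 ?(ltW x0)// Bge// x0 (le_trans (ltW xs)).
Qed.

(** Riccati: without a zero of w, the quotient Y = conormal / w would satisfy
  - r Y' = Y^2 / sigma + p Y + (kappa r^2 q - m (m+p) sigma) >= c (m^2 + Y^2), and the
  angle atan (Y / m), which lies in an interval of length pi, would decrease at rate at
  least c m on an interval of length pi / (c m). *)
Lemma mode_oscillates (a b S A c : R) : 0 < a -> a < b -> b <= 1 -> 0 <= c -> 0 < A ->
  (forall r, a < r < b -> sigma r <= S) ->
  (forall r, a < r < b -> A * m%:R ^+ 2 <= kappa * r ^+ 2 * q r - lambda * sigma r) ->
  S * p%:R ^+ 2 <= A * m%:R ^+ 2 -> c * (2 * S) <= 1 -> 2 * c <= A ->
  pi <= c * m%:R * (b - a) ->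
  exists z, a <= z <= b /\ w z = 0.
Proof.
move=> a0 ab b1 c0 A0 sS hA pA cS cA hpi; apply: contrapT => nz.
case: ode => w0 cw cy dw dy.
have w_neq0 r : a <= r <= b -> w r != 0.
  by move=> rab; apply/eqP => wr; apply: nz; exists r.
have mR : 0 < m%:R :> R by rewrite ltr0n.
pose Y r := B r / w r.
pose dY r := - (Y r ^+ 2 / sigma r + p%:R * Y r +
   (kappa * r ^+ 2 * q r - lambda * sigma r)) / r.
have dYE r : a < r < b -> is_derive r 1 Y (dY r).
  move=> /andP[ar rb].
  have r0 : 0 < r by exact: lt_trans ar.
  have r01 : 0 < r < 1 by rewrite r0 (lt_le_trans rb).
  have wr : w r != 0 by rewrite w_neq0// !ltW.
  have := derM (is_derive_conormal r01) (derV wr (dw _ r0)).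
  move/is_derive_eq; apply; rewrite /dY /Y /conormal /lambda natrD.
  have := sigma_gt0 r; move: wr; move: (w r) (y r) (sigma r) (q r) => u v s q1 u0 s0.
  by field; rewrite u0 !gt_eqF.
pose Z r := atan (Y r / m%:R).
have dZE r : a < r < b ->
    is_derive r 1 Z ((1 + (Y r / m%:R) ^+ 2)^-1 * (m%:R^-1 * dY r)).
  move=> rab; apply: (is_derive1_comp (f := atan) (g := fun r => Y r / m%:R)).
  have := derMc m%:R^-1 (dYE _ rab).
  by rewrite (_ : (fun z => m%:R^-1 * Y z) = (fun r => Y r / m%:R))//;
    apply/funext => z; rewrite mulrC.
have : - Z a - c * m%:R * a <= - Z b - c * m%:R * b.
  apply: (@derive_ge0_le _ (fun r => - Z r - c * m%:R * r)
    (fun r => - ((1 + (Y r / m%:R) ^+ 2)^-1 * (m%:R^-1 * dY r)) - c * m%:R * 1) _ _ (ltW ab)).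
  - by move=> r rab; exact: derB (derN (dZE _ rab)) (derMc _ (der_id r)).
  - apply/continuous_in_subspaceT => r; rewrite inE /= in_itv/= => rab.
    apply: cvgB; last by apply: cvgM; [exact: cvg_cst|exact: cvg_id].
    apply: cvgN; apply: (@continuous_comp _ _ _ (fun r => Y r / m%:R) atan).
      apply: cvgM; last exact: cvg_cst.
      apply: cvgM; first exact: continuous_conormal.
      by apply: cvgV; [exact: w_neq0|exact: cw].
    exact: continuous_atan.
  - move=> r rab; have /andP[ar rb] := rab.
    have r0 : 0 < r by exact: lt_trans ar.
    have r1 : r <= 1 by rewrite (le_trans (ltW rb)).
    have := hA r rab; have := sS r rab; have := sigma_gt0 r.
    rewrite /dY; move: (kappa * _ * _ - _) => X; move: (sigma r) (Y r) => s u s0 sS' XA.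
    have S0 : 0 < S by exact: lt_le_trans sS'.
    have us : u ^+ 2 / S <= u ^+ 2 / s.
      by rewrite ler_wpM2l ?sqr_ge0// lef_pV2 ?posrE.
    have pu : - (u ^+ 2 / (2 * S) + S * p%:R ^+ 2 / 2) <= p%:R * u.
      rewrite -subr_ge0 opprK.
      have -> : p%:R * u + (u ^+ 2 / (2 * S) + S * p%:R ^+ 2 / 2) =
         (u + S * p%:R) ^+ 2 / (2 * S) by field; rewrite gt_eqF.
      by rewrite divr_ge0 ?sqr_ge0// mulr_ge0// ltW.
    have cu : c * u ^+ 2 <= u ^+ 2 / (2 * S).
      by rewrite ler_pdivlMr ?mulr_gt0// mulrAC ler_piMl ?sqr_ge0.
    have cm : c * m%:R ^+ 2 <= A * m%:R ^+ 2 / 2.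
      by rewrite mulrAC ler_wpM2r ?sqr_ge0//; lra.
    have main : c * (m%:R ^+ 2 + u ^+ 2) <= u ^+ 2 / s + p%:R * u + X.
      have uS : u ^+ 2 / S = u ^+ 2 / (2 * S) + u ^+ 2 / (2 * S) by field; rewrite gt_eqF.
      move: us pu cu cm XA pA; rewrite mulrDr uS.
      move: (c * m%:R ^+ 2) (u ^+ 2 / s) (u ^+ 2 / (2 * S)) (p%:R * u) (S * _)
        (c * u ^+ 2) (A * _).
      by move=> *; lra.
    move: main; move: (u ^+ 2 / s + p%:R * u + X) => N main.
    have mu0 : 0 < m%:R ^+ 2 + u ^+ 2 by rewrite ltr_pwDl ?exprn_gt0// sqr_ge0.
    have -> : - ((1 + (u / m%:R) ^+ 2)^-1 * (m%:R^-1 * (- N / r))) - c * m%:R * 1 =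
        m%:R / (m%:R ^+ 2 + u ^+ 2) * (N / r - c * (m%:R ^+ 2 + u ^+ 2)).
      field; rewrite !gt_eqF//=.
    rewrite mulr_ge0 ?divr_ge0 ?(ltW mR) ?(ltW mu0)// subr_ge0 (le_trans main)//.
    rewrite ler_pdivlMr// ler_piMr// (le_trans _ main)// mulr_ge0// ltW//.
have := atan_ltpi2 (Y a / m%:R); have := atan_gtNpi2 (Y b / m%:R).
rewrite -/(Z a) -/(Z b); move: hpi; rewrite mulrBr.
move: (Z a) (Z b) (c * _ * a) (c * _ * b) => za zb x1 x2.
by lra.
Qed.

End mode.

(** * Zeros of a family of solutions *)
Lemma clopen_propagates {R : realType} (P : R -> Prop) (a b : R) : a <= b -> P a ->
  (forall x, a <= x <= b -> P x -> \forall z \near x, a <= z <= b -> P z) ->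
  (forall x, a <= x <= b -> ~ P x -> \forall z \near x, a <= z <= b -> ~ P z) -> P b.
Proof.
move=> ab Pa oP oN; apply: contrapT => NPb.
pose f x : R := if `[< P x >] then 1 else 0.
have fP x : P x -> f x = 1 by move=> Px; rewrite /f asboolT.
have fN x : ~ P x -> f x = 0 by move=> Px; rewrite /f asboolF.
have cf : {within `[a, b], continuous f}.
  apply/subspace_continuousP => x; rewrite /= in_itv/= => xab.
  apply: cvg_near_cst; rewrite /within/=; have [Px|Px] := pselect (P x).
    apply: filterS (oP _ xab Px) => z h; rewrite in_itv/= => zab.
    exact: etrans (fP z (h zab)) (esym (fP x Px)).
  apply: filterS (oN _ xab Px) => z h; rewrite in_itv/= => zab.
  exact: etrans (fN z (h zab)) (esym (fN x Px)).
have [|c _] := @IVT R f a b (1 / 2) ab cf.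
  by rewrite (fP a)// (fN b)// ge_min le_max; apply/andP; split; apply/orP; [right|left]; lra.
by have [/fP ->|/fN ->] := pselect (P c) => h; lra.
Qed.

Section crossing.
Context {R : realType} (sigma w y : R -> R).
Hypotheses (sigma_gt0 : forall r, 0 < sigma r) (cw : continuous w) (cy : continuous y).
Hypothesis dw : forall r : R, 0 < r -> is_derive r 1 w (y r / sigma r).

Lemma incr_of_gt0 (a b : R) : 0 <= a -> a < b -> (forall s, a < s < b -> 0 < y s) -> w a < w b.
Proof.
move=> a0 ab ypos; rewrite -subr_gt0.
have d x : x \in `]a, b[ -> is_derive x 1 w (y x / sigma x).
  by rewrite in_itv/= => /andP[ax _]; apply: dw; exact: le_lt_trans ax.
have [s + ->] := MVT ab d (continuous_within cw).
by rewrite in_itv/= => sab; rewrite mulr_gt0 ?subr_gt0// divr_gt0// ypos.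
Qed.

Lemma upcrossing (r e : R) : 0 < r -> 0 < e -> w r = 0 -> 0 < y r ->
  (exists s, [/\ 0 < s, r - e < s, s < r & w s < 0]) /\
  (exists s, [/\ r < s, s < r + e & 0 < w s]).
Proof.
move=> r0 e0 wr yr.
have /cvgrPdist_lt /(_ _ yr)[d /= d0 hd] := @cy r.
have ypos s : `|r - s| < d -> 0 < y s.
  by move=> /hd; rewrite ltr_norml => /andP[_]; lra.
pose h := Num.min (Num.min d e) r / 2.
have h0 : 0 < h by rewrite divr_gt0// !lt_min d0 e0.
have [hd' he hr] : [/\ h < d, h < e & h < r].
  have : h < Num.min (Num.min d e) r.
    by rewrite /h ltr_pdivrMr// ltr_pMr ?ltr1n// !lt_min d0 e0.
  by rewrite !lt_min => /andP[/andP[-> ->] ->].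
split; [exists (r - h)|exists (r + h)]; split; rewrite ?subr_gt0// ?ltrD2l ?ltrN2 ?gtrBl ?ltrDl//.
  rewrite -wr; apply: incr_of_gt0; rewrite ?subr_ge0 ?(ltW hr) ?gtrBl//.
  by move=> s sr; apply: ypos; rewrite ltr_norml; lra.
rewrite -{1}wr; apply: incr_of_gt0; rewrite ?(ltW r0) ?ltrDl//.
by move=> s sr; apply: ypos; rewrite ltr_norml; lra.
Qed.

End crossing.

Section downcrossing.
Context {R : realType} (sigma w y : R -> R).
Hypotheses (sigma_gt0 : forall r, 0 < sigma r) (cw : continuous w) (cy : continuous y).
Hypothesis dw : forall r : R, 0 < r -> is_derive r 1 w (y r / sigma r).

Let cNw : continuous (fun r => - w r). Proof. by move=> r; apply: cvgN; exact: cw. Qed.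
Let cNy : continuous (fun r => - y r). Proof. by move=> r; apply: cvgN; exact: cy. Qed.
Let dNw (r : R) : 0 < r -> is_derive r 1 (fun r => - w r) (- y r / sigma r).
Proof. by move=> r0; rewrite mulNr; exact: derN (dw r0). Qed.

Lemma decr_of_lt0 (a b : R) : 0 <= a -> a < b -> (forall s, a < s < b -> y s < 0) -> w b < w a.
Proof.
move=> a0 ab yneg; rewrite -ltrN2; apply: (incr_of_gt0 sigma_gt0 cNw dNw) => //.
by move=> s /yneg; rewrite oppr_gt0.
Qed.

Lemma downcrossing (r e : R) : 0 < r -> 0 < e -> w r = 0 -> y r < 0 ->
  (exists s, [/\ 0 < s, r - e < s, s < r & 0 < w s]) /\
  (exists s, [/\ r < s, s < r + e & w s < 0]).
Proof.
move=> r0 e0 wr yr.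
have [||[s [s0 sr rs ws]] [t [rt te wt]]] := upcrossing sigma_gt0 cNw cNy dNw r0 e0.
- by rewrite wr oppr0.
- by rewrite oppr_gt0.
by split; [exists s; rewrite oppr_lt0 in ws|exists t; rewrite oppr_gt0 in wt].
Qed.

End downcrossing.

Section family.
Context {R : realType} (sigma : R -> R) (w y : R -> R -> R) (ka kb Lam : R).
Local Notation I k := (ka <= k <= kb).
Hypotheses (sigma_gt0 : forall r, 0 < sigma r).
Hypotheses (cw : forall k, I k -> continuous (w k)) (cy : forall k, I k -> continuous (y k)).
Hypothesis dw : forall k, I k -> forall r : R, 0 < r ->
  is_derive r 1 (w k) (y k r / sigma r).
Hypothesis w0 : forall k, I k -> w k 0 = 1.
Hypothesis simple : forall k, I k -> forall r, 0 < r <= 1 -> w k r = 0 -> y k r <> 0.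
Hypothesis lipw : forall k k' r, I k -> I k' -> 0 <= r <= 1 ->
  `|w k r - w k' r| <= Lam * `|k - k'|.
Hypothesis lipy : forall k k' r, I k -> I k' -> 0 <= r <= 1 ->
  `|y k r - y k' r| <= Lam * `|k - k'|.

(* Positivity at (k, r) is an open condition on the pair, since u is continuous in r and
   Lipschitz in k uniformly in r. *)
Let joint (u : R -> R -> R) (k r : R) : I k ->
  (forall k k' r, I k -> I k' -> 0 <= r <= 1 -> `|u k r - u k' r| <= Lam * `|k - k'|) ->
  (forall k, I k -> continuous (u k)) -> 0 < u k r ->
  \forall s \near r & l \near k, I l -> 0 <= s <= 1 -> 0 < u l s.
Proof.
move=> Ik lip cu ukr.
have h2 : 0 < u k r / 2 by rewrite divr_gt0.
have /cvgrPdist_lt /(_ _ h2) nr := @cu _ Ik r.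
have Lp : 0 < Num.max Lam 1 by rewrite lt_max ltr01 orbT.
have nk : \forall l \near k, `|k - l| < u k r / 2 / Num.max Lam 1.
  by exists (u k r / 2 / Num.max Lam 1); rewrite /= ?divr_gt0//.
near=> s l => Il s01.
have h1 : `|u k r - u k s| < u k r / 2 by near: s.
have : `|k - l| < u k r / 2 / Num.max Lam 1 by near: l.
rewrite ltr_pdivlMr// => h3.
have h4 : `|u k s - u l s| < u k r / 2.
  apply: le_lt_trans h3; apply: (le_trans (lip _ _ _ Ik Il s01)).
  by rewrite mulrC ler_wpM2l// le_max lexx.
by move: h1 h4; rewrite !ltr_norml; lra.
Unshelve. all: by end_near. Qed.

Let jointw (k r : R) : I k -> 0 < w k r -> \forall s \near r & l \near k, I l -> 0 <= s <= 1 -> 0 < w l s.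
Proof. by move=> Ik; exact: joint. Qed.

Let jointNw (k r : R) : I k -> w k r < 0 -> \forall s \near r & l \near k, I l -> 0 <= s <= 1 -> w l s < 0.
Proof.
move=> Ik wkr; have : 0 < - w k r by rewrite oppr_gt0.
move/(@joint (fun k r => - w k r) _ _ Ik) => h.
have : \forall s \near r & l \near k, I l -> 0 <= s <= 1 -> 0 < - w l s.
  apply: h => [k1 k2 s I1 I2 s01|k1 I1 s]; last by apply: cvgN; exact: cw.
  by rewrite -opprD normrN; exact: lipw.
by apply: filterS => -[s l] /= {}h Il s01; rewrite -oppr_gt0; exact: h.
Qed.

Let jointNy (k r : R) : I k -> y k r < 0 -> \forall s \near r & l \near k, I l -> 0 <= s <= 1 -> y l s < 0.
Proof.
move=> Ik ykr; have : 0 < - y k r by rewrite oppr_gt0.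
move/(@joint (fun k r => - y k r) _ _ Ik) => h.
have : \forall s \near r & l \near k, I l -> 0 <= s <= 1 -> 0 < - y l s.
  apply: h => [k1 k2 s I1 I2 s01|k1 I1 s]; last by apply: cvgN; exact: cy.
  by rewrite -opprD normrN; exact: lipy.
by apply: filterS => -[s l] /= {}h Il s01; rewrite -oppr_gt0; exact: h.
Qed.

Let c01 : compact `[0 : R, 1]%classic. Proof. exact: segment_compact. Qed.

Let persist (k z : R) : I k -> 0 <= z <= 1 -> w k z < 0 ->
  \forall l \near k, I l -> w l z < 0.
Proof.
move=> Ik z01 wz; have [[A B] /= [nA nB] AB] := jointNw Ik wz.
apply: filterS nB => l Bl Il; apply: (AB (z, l)) => //; split => //=.
exact: nbhs_singleton nA.
Qed.

Let persist_gt0 (k z : R) : I k -> 0 <= z <= 1 -> 0 < w k z ->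
  \forall l \near k, I l -> 0 < w l z.
Proof.
move=> Ik z01 wz; have [[A B] /= [nA nB] AB] := jointw Ik wz.
apply: filterS nB => l Bl Il; apply: (AB (z, l)) => //; split => //=.
exact: nbhs_singleton nA.
Qed.

(** A zero of a nonnegative w would be a minimum: this is excluded inside by simplicity,
  and at r = 1 by the assumption on the slope.  So nonnegativity is strict, hence stable
  under small changes of the parameter, and it is also a closed condition. *)
Lemma zeros_enter_downwards : ka <= kb ->
  (forall k, I k -> w k 1 = 0 -> 0 < y k 1) ->
  (forall r, 0 <= r <= 1 -> 0 < w ka r) ->
  forall z, 0 <= z <= 1 -> 0 <= w kb z.
Proof.
move=> kab up wa.
pose P k := forall r, 0 <= r <= 1 -> 0 <= w k r.
apply: (@clopen_propagates _ P ka kb kab); rewrite /P.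
- by move=> r /wa /ltW.
- move=> k Ik Pk.
  have /compact_near_coveringP := c01.
  move=> /(_ R (nbhs k) (fun l s => I l -> 0 <= s <= 1 -> 0 < w l s \/ 0 <= w l s) _).
  move=> h; have : \near k, `[0, 1]%classic `<=`
      (fun s => I k -> 0 <= s <= 1 -> 0 < w k s \/ 0 <= w k s).
    apply: h => r; rewrite /= in_itv/= => r01.
    suff wr : 0 < w k r by apply: filterS (jointw Ik wr) => -[s l] /= h Il s01; left; exact: h.
    rewrite lt_neqAle Pk// andbT; apply/eqP => /esym wr.
    have r0 : 0 < r.
      rewrite lt_neqAle; case/andP: r01 => -> _; rewrite andbT.
      by apply/eqP => r0; move: wr; rewrite -r0 w0// => /eqP; rewrite oner_eq0.
    have r01' : 0 < r <= 1 by rewrite r0; case/andP: r01.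
    have [yr|yr|yr] := ltgtP (y k r) 0; last by apply: (simple Ik r01').
    + have rn1 : r < 1.
        rewrite lt_neqAle; case/andP: r01 => _ ->; rewrite andbT; apply/eqP => r1.
        by move: wr yr; rewrite r1 => /(up _ Ik) h1; rewrite ltNge ltW.
      have e0 : 0 < 1 - r by rewrite subr_gt0.
      have [_ [s [rs s1 ws]]] := downcrossing sigma_gt0 (cw Ik) (cy Ik) (dw Ik) r0 e0 wr yr.
      have : 0 <= w k s by apply: Pk; lra.
      by rewrite leNgt ws.
    + have [[s [s0 _ sr ws]] _] := upcrossing sigma_gt0 (cw Ik) (cy Ik) (dw Ik) r0 r0 wr yr.
      have : 0 <= w k s by apply: Pk; lra.
      by rewrite leNgt ws.
  apply: filterS => l hl Il r r01.
  by have := hl r; rewrite /= in_itv/= => /(_ r01 Il r01) [/ltW|].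
- move=> k Ik /existsNP[r /not_implyP[r01 /negP]]; rewrite -ltNge => wr.
  apply: filterS (persist Ik r01 wr) => l h Il /(_ r r01).
  by rewrite leNgt h.
Qed.

(** The persistent property is that w is nonpositive after having been negative.
  It could only be lost through a new zero at which w turns from negative to positive;
  such a zero would have to enter at r = 1, where the slope is negative. *)
Lemma zeros_enter_upwards : ka <= kb ->
  (forall k, I k -> w k 1 = 0 -> y k 1 < 0) ->
  (forall r, 0 <= r <= 1 -> 0 < w ka r) ->
  forall z1 z2, 0 <= z1 -> z1 < z2 -> z2 <= 1 -> w kb z1 < 0 -> w kb z2 <= 0.
Proof.
move=> kab dn wa.
pose P k := forall z1 z2, 0 <= z1 -> z1 < z2 -> z2 <= 1 -> w k z1 < 0 -> w k z2 <= 0.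
apply: (@clopen_propagates _ P ka kb kab); rewrite /P.
- move=> z1 z2 z10 z12 z21 h; have := wa z1; rewrite z10 (le_trans (ltW z12))// => /(_ isT).
  by rewrite ltNge (ltW h).
- move=> k Ik Pk.
  pose bad l (s : R * R) := [/\ 0 <= s.1 <= 1, 0 <= s.2 <= 1, s.1 < s.2 & w l s.1 < 0 < w l s.2].
  have c2 : compact (`[0 : R, 1]%classic `*` `[0 : R, 1]%classic) by exact: compact_setX.
  have /compact_near_coveringP := c2.
  move=> /(_ R (nbhs k) (fun l s => I l -> ~ bad l s) _) h.
  have : \near k, (`[0, 1]%classic `*` `[0, 1]%classic) `<=` (fun s => I k -> ~ bad k s).
    apply: h => -[r1 r2]; rewrite /= !in_itv/= => -[r101 r201].
    have pos r : 0 <= r <= 1 -> w k r = 0 -> 0 < r <= 1.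
      move=> /andP[r0 ->] wr; rewrite andbT lt_neqAle r0 andbT; apply/eqP => r0'.
      by move: wr; rewrite -r0' w0// => /eqP; rewrite oner_eq0.
    have [wr1|wr1] := ltP 0 (w k r1).
      have [[A B] /= [nA nB] AB] := jointw Ik wr1.
      exists ([set s | A s.1], B) => /=.
        split => //; exists (A, setT) => /=; last by move=> ? [].
        by split => //; exact: filterT.
      move=> [[s1 s2] l] /= [As1 Bl] Il [s101 _ _ /andP[ws1 _]].
      by have := AB (s1, l) (conj As1 Bl) Il s101; rewrite ltNge ltW.
    have [wr2|wr2] := ltP (w k r2) 0.
      have [[A B] /= [nA nB] AB] := jointNw Ik wr2.
      exists ([set s | A s.2], B) => /=.
        split => //; exists (setT, A) => /=; last by move=> ? [].
        by split => //; exact: filterT.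
      move=> [[s1 s2] l] /= [As1 Bl] Il [_ s201 _ /andP[_ ws2]].
      by have := AB (s2, l) (conj As1 Bl) Il s201; rewrite ltNge ltW.
    have [r21|r12|r12] := ltgtP r2 r1.
    + exists ([set s | s.2 < s.1], setT) => /=; last first.
        by move=> [[s1 s2] l] /= [s21 _] _ [_ _ /ltW]; rewrite leNgt s21.
      split; last exact: filterT.
      pose mid := (r2 + r1) / 2.
      exists ([set s | mid < s], [set s | s < mid]) => /=.
        by split; [apply: lt_nbhsr; rewrite /mid; lra|apply: lt_nbhsl; rewrite /mid; lra].
      by move=> [s1 s2] /= [h1 h2]; exact: lt_trans h1.
    + (* the signs are attained strictly near r1 and r2, so w k itself violates Pk *)
      exfalso.
      have [s1 [s10 s1r ws1]] : exists s1, [/\ 0 <= s1 <= 1, s1 < (r1 + r2) / 2 & w k s1 < 0].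
        move: wr1; rewrite le_eqVlt => /predU1P[wr1|wr1]; last by exists r1; split => //; lra.
        have e0 : 0 < (r2 - r1) / 2 by lra.
        have /andP[r1p _] := pos _ r101 wr1.
        have [yr|yr|yr] := ltgtP (y k r1) 0; last by case: (simple Ik (pos _ r101 wr1) wr1 yr).
        * have [_ [s [rs s1 ws]]] := downcrossing sigma_gt0 (cw Ik) (cy Ik) (dw Ik) r1p e0 wr1 yr.
          by exists s; split => //; lra.
        * have [[s [s0 _ sr ws]] _] := upcrossing sigma_gt0 (cw Ik) (cy Ik) (dw Ik) r1p e0 wr1 yr.
          by exists s; split => //; lra.
      have [s2 [s20 s2r ws2]] : exists s2, [/\ 0 <= s2 <= 1, (r1 + r2) / 2 < s2 & 0 < w k s2].
        move: wr2; rewrite le_eqVlt => /predU1P[/esym wr2|wr2]; last by exists r2; split => //; lra.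
        have e0 : 0 < (r2 - r1) / 2 by lra.
        have /andP[r2p _] := pos _ r201 wr2.
        have [yr|yr|yr] := ltgtP (y k r2) 0; last by case: (simple Ik (pos _ r201 wr2) wr2 yr).
        * have [[s [s0 rs sr ws]] _] := downcrossing sigma_gt0 (cw Ik) (cy Ik) (dw Ik) r2p e0 wr2 yr.
          by exists s; split => //; lra.
        * have r2n1 : r2 < 1.
            rewrite lt_neqAle; case/andP: r201 => _ ->; rewrite andbT; apply/eqP => r1'.
            by move: wr2 yr; rewrite r1' => /(dn _ Ik) h1; rewrite ltNge ltW.
          have e1 : 0 < 1 - r2 by lra.
          have [_ [s [rs s1' ws]]] := upcrossing sigma_gt0 (cw Ik) (cy Ik) (dw Ik) r2p e1 wr2 yr.
          by exists s; split => //; lra.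
      have : w k s2 <= 0 by apply: (Pk s1) => //; lra.
      by rewrite leNgt ws2.
    + subst r2; have wr : w k r1 = 0 by apply/eqP; rewrite eq_le wr1 wr2.
      have /andP[r0 r1'] := pos _ r101 wr.
      have yr : y k r1 < 0.
        have [//|yr|yr] := ltgtP (y k r1) 0; last by case: (simple Ik (pos _ r101 wr) wr yr).
        exfalso.
        have rn1 : r1 < 1.
          rewrite lt_neqAle r1' andbT; apply/eqP => r1E.
          by move: wr yr; rewrite r1E => /(dn _ Ik) h1; rewrite ltNge ltW.
        have e1 : 0 < 1 - r1 by lra.
        have [[s [s0 _ sr ws]] [t [rt t1 wt]]] :=
          upcrossing sigma_gt0 (cw Ik) (cy Ik) (dw Ik) r0 e1 wr yr.
        have : w k t <= 0 by apply: (Pk s) => //; lra.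
        by rewrite leNgt wt.
      have [[A B] /= [[d /= d0 dA] nB] AB] := jointNy Ik yr.
      exists ([set s | `|r1 - s.1| < d /\ `|r1 - s.2| < d], B) => /=.
        split => //; exists ([set s | `|r1 - s| < d], [set s | `|r1 - s| < d]) => /=.
          by split; exists d.
        by move=> [].
      move=> [[s1 s2] l] /= [[h1 h2] Bl] Il [/= s101 s201 s12 /andP[ws1 ws2]].
      have : w l s2 < w l s1.
        apply: (decr_of_lt0 sigma_gt0 (cw Il) (dw Il)) => //; first by case/andP: s101.
        move=> t /andP[st ts]; apply: (AB (t, l)) => //=; last by lra.
        by split => //; apply: dA => /=; move: h1 h2; rewrite !ltr_norml; lra.
      by move: ws1 ws2; lra.
  apply: filterS => l hl Il z1 z2 z10 z12 z21 wz1; rewrite leNgt; apply/negP => wz2.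
  apply: (hl (z1, z2)) => //=; first by rewrite !in_itv/=; split; lra.
  by split => /=; lra.
- move=> k Ik /existsNP[z1 /existsNP[z2]] /not_implyP[z10 /not_implyP[z12 /not_implyP[z21]]].
  move=> /not_implyP[wz1 /negP]; rewrite -ltNge => wz2.
  have z101 : 0 <= z1 <= 1 by lra.
  have z201 : 0 <= z2 <= 1 by lra.
  near=> l => Il /(_ z1 z2 z10 z12 z21).
  have wl1 : w l z1 < 0 by move: Il; near: l; exact: persist.
  have wl2 : 0 < w l z2 by move: Il; near: l; exact: persist_gt0.
  by move=> /(_ wl1); rewrite leNgt wl2.
Unshelve. all: by end_near. Qed.

End family.

(** * Existence of a matching frequency *)
Lemma lipschitz_within {R : realType} (g : R -> R) (a b L : R) :
  (forall x x', a <= x <= b -> a <= x' <= b -> `|g x - g x'| <= L * `|x - x'|) ->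
  {within `[a, b], continuous g}.
Proof.
move=> lip; apply/subspace_continuousP => x; rewrite /= in_itv/= => xab.
apply/cvgrPdist_lt => e e0.
have L1 : 0 < Num.max L 1 by rewrite lt_max ltr01 orbT.
exists (e / Num.max L 1); rewrite /= ?divr_gt0// => z /=; rewrite ltr_pdivlMr// => xz.
rewrite in_itv/= => zab; apply: le_lt_trans xz.
by rewrite (le_trans (lip _ _ xab zab))// mulrC ler_wpM2l// le_max lexx.
Qed.

(** Composition with clamp extends the coefficients from [0, 1] to the whole line. *)
Definition clamp {R : realType} (r : R) : R := Num.max 0 (Num.min 1 r).

Lemma clamp_itv {R : realType} (r : R) : 0 <= clamp r <= 1.
Proof. by rewrite /clamp le_max lexx/= ge_max ler01 ge_min lexx. Qed.

Lemma clamp_id {R : realType} (r : R) : 0 <= r <= 1 -> clamp r = r.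
Proof. by move=> /andP[r0 r1]; rewrite /clamp min_r// max_r. Qed.

Lemma continuous_clamp {R : realType} : continuous (@clamp R).
Proof.
apply: (@max_fun_continuous _ R R (cst 0) (fun r : R => Num.min 1 r)).
  by move=> r; exact: cvg_cst.
apply: (@min_fun_continuous _ R R (cst 1) (fun r : R => r)) => r.
  exact: cvg_cst.
exact: cvg_id.
Qed.

Lemma radial_ode_exists {R : realType} (K : nat) (sigma : R -> R) (c C d : R)
    (Q : R -> R -> R) (ka kb : R) :
  (0 < K)%N -> continuous sigma -> 0 < c -> (forall r, c <= sigma r) -> 0 < C ->
  (forall k, continuous (Q k)) ->
  (forall k s, ka <= k <= kb -> `|Q k s| <= C) ->
  (forall k k' s, `|Q k s - Q k' s| <= d * `|k - k'|) ->
  exists w y : R -> R -> R,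
    (forall k, ka <= k <= kb -> radial_ode K sigma (Q k) (w k) (y k)) /\
    exists L, forall k k' r, ka <= k <= kb -> ka <= k' <= kb -> 0 <= r <= 1 ->
      `|w k r - w k' r| <= L * `|k - k'| /\ `|y k r - y k' r| <= L * `|k - k'|.
Proof.
move=> K0 cs c0 sc C0 cQ QC Qd.
exists (fun k => ode_w K sigma c C (Q k)), (fun k => ode_y K sigma c C (Q k)); split.
  move=> k kk; have QCk s := QC k s kk; split.
  - exact: ode_w0.
  - exact: ode_w_cont.
  - exact: ode_y_cont.
  - exact: is_derive_ode_w.
  - exact: is_derive_ode_y.
pose e := expR (2 * C / c * 1).
exists (Num.max (4 * e / C * d) (6 * e * d)) => k k' r kk kk' r01.
have [h1 h2] := ode_stable K0 cs c0 sc C0 (cQ k) (fun s => QC k s kk)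
  (cQ k') (fun s => QC k' s kk') (Qd k k') r01.
split.
  by apply: (le_trans h1); rewrite mulrA ler_wpM2r// le_max lexx.
by apply: (le_trans h2); rewrite mulrA ler_wpM2r// le_max lexx orbT.
Qed.

Section eigenvalue.
Context {R : realType} (m p : nat) (sigma sigma1 q : R -> R) (c S M1 M2 C1 : R).
Hypotheses (m0 : (0 < m)%N) (c0 : 0 < c) (M11 : 1 < M1) (M12 : M1 < M2).
Hypotheses (csigma : continuous sigma) (csigma1 : continuous sigma1) (cq : continuous q).
Hypotheses (sigma_ge : forall r, c <= sigma r) (sigma_le : forall r, sigma r <= S).
Hypothesis (sigma1_le : forall r, `|sigma1 r| <= C1).
Hypothesis (dsigma : forall r : R, 0 < r < 1 -> is_derive r 1 sigma (sigma1 r)).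
Hypothesis (q_sigma : forall r, M1 * sigma r <= q r <= M2 * sigma r).

Let sigma_gt0 r : 0 < sigma r. Proof. exact: lt_le_trans (sigma_ge r). Qed.
Let M10 : 0 < M1. Proof. exact: lt_trans M11. Qed.
Let M20 : 0 < M2. Proof. exact: lt_trans M12. Qed.
Let S0 : 0 < S. Proof. exact: lt_le_trans (sigma_le 0). Qed.
Let q_ge0 r : 0 <= q r.
Proof. by have /andP[+ _] := q_sigma r; apply: le_trans; rewrite mulr_ge0 ?ltW. Qed.
Let q_le r : q r <= M2 * S.
Proof. by have /andP[_] := q_sigma r; move/le_trans; apply; rewrite ler_pM2l. Qed.

(** The top of the spectral window, in units of m^2.  It lies below 1, and its cube times
  M1 lies above 1: kappa r^2 q >= rho^3 M1 m^2 sigma for kappa = rho m^2 and r >= rho. *)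
Definition spectral_top : R := 1 - (1 - M1^-1) / 6.
Local Notation rho := spectral_top.

Lemma spectral_top_lt1 : 0 < rho < 1.
Proof.
have h1 : M1^-1 < 1 by rewrite invf_lt1.
have h2 : 0 < M1^-1 by rewrite invr_gt0.
by rewrite /rho; lra.
Qed.

Lemma spectral_top_cube : (M1 + 1) / 2 <= rho ^+ 3 * M1.
Proof.
have h1 : M1^-1 < 1 by rewrite invf_lt1.
have h2 : 0 < M1^-1 by rewrite invr_gt0.
pose x := (1 - M1^-1) / 6.
have -> : (M1 + 1) / 2 = (1 - 3 * x) * M1 by rewrite /x; field; rewrite gt_eqF.
rewrite ler_pM2r// /rho -/x.
have -> : (1 - x) ^+ 3 = 1 - 3 * x + x ^+ 2 * (3 - x) by ring.
by rewrite lerDl mulr_ge0 ?sqr_ge0// /x; lra.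
Qed.

Let ka : R := m%:R ^+ 2 / (2 * M2).
Let kb : R := rho * m%:R ^+ 2.
Let K := (2 * m + p.+1)%N.

Let ka_gt0 : 0 < ka.
Proof. by rewrite divr_gt0 ?mulr_gt0 ?exprn_gt0 ?ltr0n. Qed.

Let kab : ka <= kb.
Proof.
rewrite /ka /kb mulrC ler_wpM2r ?sqr_ge0//.
have h3 : (2 * M2)^-1 <= 2^-1 by rewrite lef_pV2 ?posrE ?mulr_gt0//; have := M11; have := M12; lra.
apply: le_trans h3 _.
have h1 : M1^-1 < 1 by rewrite invf_lt1.
have h2 : 0 < M1^-1 by rewrite invr_gt0.
by rewrite /rho; lra.
Qed.

Let Q k s := m%:R * sigma1 s + k * clamp s * q s.
Let Q1 k s : R := m%:R * 0 + k * clamp s * 1.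

Let QE k r : 0 < r < 1 -> Q k r = m%:R * sigma1 r + k * r * q r.
Proof. by move=> /andP[r0 r1]; rewrite /Q clamp_id// !ltW. Qed.

Let Q1E k r : 0 < r < 1 -> Q1 k r = m%:R * 0 + k * r * 1.
Proof. by move=> /andP[r0 r1]; rewrite /Q1 clamp_id// !ltW. Qed.

Let families : exists w y v z : R -> R -> R, exists L,
  [/\ forall k, ka <= k <= kb -> radial_ode K sigma (Q k) (w k) (y k),
      forall k, ka <= k <= kb -> radial_ode K (cst 1) (Q1 k) (v k) (z k),
      forall k s, `|Q k s| <= m%:R * C1 + `|k| * (M2 * S),
      forall k s, `|Q1 k s| <= `|k|
    & forall u, u = w \/ u = y \/ u = v \/ u = z ->
      forall k k' r, ka <= k <= kb -> ka <= k' <= kb -> 0 <= r <= 1 ->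
      `|u k r - u k' r| <= L * `|k - k'|].
Proof.
have K0 : (0 < K)%N by rewrite /K addnS.
have Qb k s : `|Q k s| <= m%:R * C1 + `|k| * (M2 * S).
  have /andP[cl0 cl1] := clamp_itv s.
  apply: (le_trans (ler_normD _ _)); rewrite !normrM lerD//.
    by rewrite ger0_norm// ler_wpM2l.
  rewrite -mulrA ler_wpM2l// (ger0_norm cl0) ger0_norm//.
  by rewrite (le_trans _ (q_le s))// ler_piMl.
have Q1b k s : `|Q1 k s| <= `|k|.
  have /andP[cl0 cl1] := clamp_itv s.
  by rewrite /Q1 mulr0 add0r mulr1 normrM ler_piMr// ger0_norm.
have C10 : 0 <= C1 by exact: le_trans (sigma1_le 0).
have kb0 : 0 < kb by exact: lt_le_trans kab.
have kk k : ka <= k <= kb -> `|k| <= kb.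
  by move=> /andP[h1 h2]; rewrite ger0_norm// (le_trans (ltW ka_gt0)).
have C0 : 0 < m%:R * C1 + kb * (M2 * S).
  have h : 0 < kb * (M2 * S) by rewrite mulr_gt0// mulr_gt0.
  by apply: (lt_le_trans h); rewrite lerDr mulr_ge0.
have cQ k : continuous (Q k).
  move=> s; apply: cvgD; first by apply: cvgM; [exact: cvg_cst|exact: csigma1].
  apply: cvgM; last exact: cq.
  by apply: cvgM; [exact: cvg_cst|exact: continuous_clamp].
have QC k s : ka <= k <= kb -> `|Q k s| <= m%:R * C1 + kb * (M2 * S).
  move=> kI; apply: (le_trans (Qb k s)).
  by rewrite lerD2l ler_wpM2r ?kk// mulr_ge0// ltW.
have Qlip k k' s : `|Q k s - Q k' s| <= M2 * S * `|k - k'|.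
  have /andP[cl0 cl1] := clamp_itv s.
  have -> : Q k s - Q k' s = (k - k') * (clamp s * q s) by rewrite /Q; ring.
  rewrite normrM mulrC ler_wpM2r// ger0_norm ?mulr_ge0//.
  by rewrite (le_trans _ (q_le s))// ler_piMl.
have [w [y [ode [L lip]]]] := radial_ode_exists K0 csigma c0 sigma_ge C0 cQ QC Qlip.
have c1 : continuous (cst (1 : R) : R -> R) by move=> x; exact: cvg_cst.
have cQ1 k : continuous (Q1 k).
  move=> s; apply: cvgD; first exact: cvg_cst.
  apply: cvgM; last exact: cvg_cst.
  by apply: cvgM; [exact: cvg_cst|exact: continuous_clamp].
have Q1C k s : ka <= k <= kb -> `|Q1 k s| <= kb.
  by move=> kI; apply: (le_trans (Q1b k s)); exact: kk.
have Q1lip k k' s : `|Q1 k s - Q1 k' s| <= 1 * `|k - k'|.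
  have /andP[cl0 cl1] := clamp_itv s.
  have -> : Q1 k s - Q1 k' s = (k - k') * clamp s by rewrite /Q1; ring.
  by rewrite normrM mulrC ler_wpM2r// ger0_norm.
have [v [z [ode1 [L1 lip1]]]] :=
  radial_ode_exists K0 c1 ltr01 (fun=> lexx 1) kb0 cQ1 Q1C Q1lip.
exists w, y, v, z, (Num.max L L1); split => // u hu k k' r kI kI' r01.
have [h1 h2] := lip k k' r kI kI' r01; have [h3 h4] := lip1 k k' r kI kI' r01.
have mL : L * `|k - k'| <= Num.max L L1 * `|k - k'| by rewrite ler_wpM2r// le_max lexx.
have mL1 : L1 * `|k - k'| <= Num.max L L1 * `|k - k'|.
  by rewrite ler_wpM2r// le_max lexx orbT.
by case: hu => [->|[->|[->|->]]];
  [exact: le_trans mL|exact: le_trans mL|exact: le_trans mL1|exact: le_trans mL1].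
Qed.

Let delta : R := (1 - rho) / 4.
Let A : R := c * (M1 - 1) / 4.

(** The three terms make m large enough to absorb p in m (m + p), to absorb the term p Y
  of the Riccati equation, and to fit a rotation by pi into a quarter of [rho, 1]. *)
Definition frequency_bound : R :=
  4 * p%:R / (M1 - 1) + S * p%:R ^+ 2 / (c * (M1 - 1) / 4) +
  pi / (Num.min (2 * S)^-1 (c * (M1 - 1) / 4 / 2) * ((1 - rho) / 4)).

Hypothesis m_large : frequency_bound <= m%:R.

Let A0 : 0 < A. Proof. by rewrite /A divr_gt0// mulr_gt0// subr_gt0. Qed.

Let zero_between (w y : R -> R) a b : radial_ode K sigma (Q kb) w y ->
  rho <= a -> b <= 1 -> b - a = delta -> exists z, a <= z <= b /\ w z = 0.
Proof.
move=> ode ra b1 ba.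
have /andP[rho0 rho1] := spectral_top_lt1.
have delta0 : 0 < delta by rewrite /delta divr_gt0// subr_gt0.
pose e := Num.min (2 * S)^-1 (A / 2).
have e0 : 0 < e by rewrite /e lt_min invr_gt0 mulr_gt0//= divr_gt0.
have mR : 1 <= m%:R :> R by rewrite ler1n.
have [t1 [t2 t3]] : 0 <= 4 * p%:R / (M1 - 1) /\ 0 <= S * p%:R ^+ 2 / A /\
    0 <= pi / (e * delta).
  split; first by rewrite divr_ge0 ?mulr_ge0// subr_ge0 ltW.
  split; first by rewrite divr_ge0 ?(ltW A0)// mulr_ge0 ?(ltW S0)// sqr_ge0.
  by rewrite divr_ge0 ?pi_ge0// mulr_ge0 //; exact: ltW.
move: m_large; rewrite /frequency_bound -/A -/delta -/e => ml.
have l1 : 4 * p%:R <= m%:R * (M1 - 1) by rewrite -ler_pdivrMr ?subr_gt0//; lra.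
have l2 : S * p%:R ^+ 2 <= m%:R * A by rewrite -ler_pdivrMr//; lra.
have l3 : pi <= m%:R * (e * delta) by rewrite -ler_pdivrMr ?mulr_gt0//; lra.
apply: (@mode_oscillates R m p sigma sigma1 q (Q kb) w y kb m0 csigma sigma_gt0 dsigma
  (QE kb) ode a b S A e) => //.
- exact: lt_le_trans ra.
- by rewrite -subr_gt0 ba.
- exact: ltW.
- move=> r /andP[ar rb]; have rr := le_trans ra (ltW ar).
  have r2 : rho ^+ 2 <= r ^+ 2 by rewrite lerXn2r ?nnegrE ?(ltW rho0)// (le_trans (ltW rho0)).
  have /andP[qs _] := q_sigma r.
  have step1 : rho ^+ 3 * M1 * (m%:R ^+ 2 * sigma r) <= kb * r ^+ 2 * q r.
    have -> : rho ^+ 3 * M1 * (m%:R ^+ 2 * sigma r) =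
      (kb * rho ^+ 2) * (M1 * sigma r) by rewrite /kb; ring.
    have kb0 : 0 <= kb by rewrite mulr_ge0 ?sqr_ge0// ltW.
    apply: ler_pM => //; first by rewrite mulr_ge0 ?sqr_ge0.
      by rewrite mulr_ge0 ?ltW.
    by rewrite ler_wpM2l.
  have step2 : (M1 + 1) / 2 * (m%:R ^+ 2 * sigma r) <= kb * r ^+ 2 * q r.
    apply: le_trans step1; rewrite ler_wpM2r ?mulr_ge0 ?sqr_ge0 ?(ltW (sigma_gt0 _))//.
    exact: spectral_top_cube.
  have step3 : 4 * p%:R * (m%:R * sigma r) <= m%:R * (M1 - 1) * (m%:R * sigma r).
    by rewrite ler_wpM2r// mulr_ge0// ltW.
  have step4 : c * ((M1 - 1) / 4 * m%:R ^+ 2) <= sigma r * ((M1 - 1) / 4 * m%:R ^+ 2).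
    by rewrite ler_wpM2r// !mulr_ge0 ?invr_ge0 ?sqr_ge0 ?subr_ge0 ?(ltW M11).
  have -> : A * m%:R ^+ 2 = c * ((M1 - 1) / 4 * m%:R ^+ 2) by rewrite /A; ring.
  apply: (le_trans step4); rewrite lerBrDr; apply: le_trans step2.
  rewrite -subr_ge0 natrD; move: step3; rewrite -subr_ge0 => step3.
  rewrite [leRHS](_ : _ = (m%:R * (M1 - 1) * (m%:R * sigma r) - 4 * p%:R * (m%:R * sigma r)) / 4).
    by rewrite divr_ge0.
  by field.
- by apply: (le_trans l2); rewrite mulrC ler_pM2l// expr2 ler_peMl// (le_trans _ mR).
- rewrite -ler_pdivlMr ?mulr_gt0// div1r /e ge_min lexx//.
- by rewrite mulrC -ler_pdivlMr// /e ge_min lexx orbT.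
- by rewrite ba mulrAC mulrC.
Qed.

(** If the matching function f had no zero, it would keep the sign of f ka.  When
  w k 1 = 0, f k is y k 1 times the positive number v k 1, so this sign decides in which
  direction zeros can enter at r = 1.  The two separate zeros of w at kb, both of them
  simple, give points where w is negative and, further right, positive. *)
Lemma matching_eigenvalue : exists (k : R) (w y v z : R -> R),
  [/\ m%:R ^+ 2 / (2 * M2) <= k <= spectral_top * m%:R ^+ 2,
      radial_ode (2 * m + p.+1) sigma (fun s => m%:R * sigma1 s + k * clamp s * q s) w y,
      radial_ode (2 * m + p.+1) (cst 1) (fun s => m%:R * 0 + k * clamp s * 1) v z,
      forall r, 0 <= r <= 1 -> 0 < v r
    & w 1 != 0 /\
      conormal m sigma w y 1 * v 1 = w 1 * conormal m (cst 1) v z 1].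
Proof.
have [w [y [v [z [L [odew odev Qb Q1b lip]]]]]] := families.
have lipw := lip w (or_introl erefl).
have lipy := lip y (or_intror (or_introl erefl)).
have lipv := lip v (or_intror (or_intror (or_introl erefl))).
have lipz := lip z (or_intror (or_intror (or_intror erefl))).
have /andP[rho0 rho1] := spectral_top_lt1.
have mR : 0 < m%:R :> R by rewrite ltr0n.
have lam_ge : m%:R ^+ 2 <= m%:R * (m + p)%:R :> R.
  by rewrite expr2 ler_pM2l// ler_nat leq_addr.
have vpos k : ka <= k <= kb -> forall r, 0 <= r <= 1 -> 0 < v k r.
  move=> kI; have /andP[k1 k2] := kI; have k0 := lt_le_trans ka_gt0 k1.
  apply: (@mode_gt0 R m p (cst 1) (cst 0) (cst 1) (Q1 k) (v k) (z k) k m0) => //.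
  - by move=> r; exact: cvg_cst.
  - exact: Q1E.
  - exact: odev.
  - move=> r /andP[r0 r1]; rewrite /= !mulr1; apply: le_trans lam_ge.
    apply: (@le_trans _ _ kb); last first.
      by rewrite /kb ler_piMl ?sqr_ge0// ltW.
    by apply: le_trans k2; rewrite ler_piMr ?(ltW k0)// expr_le1// ltW.
have wpos : forall r, 0 <= r <= 1 -> 0 < w ka r.
  apply: (@mode_gt0 R m p sigma sigma1 q (Q ka) (w ka) (y ka) ka m0) => //.
  - exact: QE.
  - by apply: odew; rewrite lexx kab.
  - move=> r /andP[r0 r1]; have /andP[_ qM] := q_sigma r.
    apply: (@le_trans _ _ (m%:R ^+ 2 * sigma r)); last by rewrite ler_wpM2r// ltW.
    apply: (@le_trans _ _ (ka * (M2 * sigma r))).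
      rewrite -mulrA ler_wpM2l ?(ltW ka_gt0)//; apply: le_trans qM.
      by rewrite ler_piMl// expr_le1// ltW.
    have -> : ka * (M2 * sigma r) = m%:R ^+ 2 * sigma r / 2 by rewrite /ka; field; rewrite gt_eqF.
    by rewrite ler_pdivrMr// ler_peMr ?ler1n// mulr_ge0 ?sqr_ge0// ltW.
have simple k : ka <= k <= kb -> forall r, 0 < r <= 1 -> w k r = 0 -> y k r <> 0.
  move=> kI r r01 wr yr; exact: (no_double_zero c0 sigma_ge (Qb k) (odew _ kI) r01 wr yr).
pose f k := conormal m sigma (w k) (y k) 1 * v k 1 - w k 1 * conormal m (cst 1) (v k) (z k) 1.
have i1 : 0 <= (1 : R) <= 1 by rewrite ler01 lexx.
have cf : {within `[ka, kb], continuous f}.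
  have cu (u : R -> R -> R) : (forall k k' r, ka <= k <= kb -> ka <= k' <= kb -> 0 <= r <= 1 ->
      `|u k r - u k' r| <= L * `|k - k'|) -> {within `[ka, kb], continuous (fun k => u k 1)}.
    by move=> h; apply: (@lipschitz_within R (fun k => u k 1) ka kb L) => k k' kI kI'; exact: h.
  have ccon (s : R -> R) (u u' : R -> R -> R) : {within `[ka, kb], continuous (fun k => u k 1)} ->
     {within `[ka, kb], continuous (fun k => u' k 1)} ->
     {within `[ka, kb], continuous (fun k => conormal m s (u k) (u' k) 1)}.
    move=> h1 h2 k; apply: cvgD; apply: cvgM; [exact: cvg_cst|exact: h2|exact: cvg_cst|exact: h1].
  move=> k; apply: cvgB; apply: cvgM.
  - by apply: ccon; exact: cu.
  - exact: cu.
  - exact: cu.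
  - by apply: ccon; exact: cu.
have f_at0 k : ka <= k <= kb -> w k 1 = 0 -> f k = y k 1 * v k 1.
  by move=> kI wk; rewrite /f /conormal wk; ring.
have vk1 k : ka <= k <= kb -> 0 < v k 1 by move=> kI; exact: vpos.
have [[k [kI fk]]|nf] := pselect (exists k, ka <= k <= kb /\ f k = 0).
  exists k, (w k), (y k), (v k), (z k); split => //.
  - exact: odew.
  - exact: odev.
  - exact: vpos.
  - split; last by apply/eqP; rewrite -subr_eq0; apply/eqP.
    apply/eqP => wk; move: fk; rewrite f_at0// => /eqP; rewrite mulf_eq0 => /orP[|].
      by move=> /eqP; apply: simple => //; rewrite ltr01 lexx.
    by rewrite gt_eqF// vk1.
exfalso.
have kbI : ka <= kb <= kb by rewrite kab lexx.
have sgn k : ka <= k <= kb -> 0 < f ka * f k.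
  move=> kI; rewrite ltNge; apply/negP => fle.
  have /andP[k1 k2] := kI.
  have cf' : {within `[ka, k], continuous f}.
    by apply: continuous_subspaceW cf; apply: subset_itvl; rewrite bnd_simp.
  have [|l + fl] := @IVT R f ka k 0 k1 cf'.
    rewrite ge_min le_max; have [fa|fa|fa] := ltgtP (f ka) 0; rewrite /= ?orbT//.
    - by rewrite nmulr_rle0 in fle.
    - by move: fle; rewrite pmulr_rle0// => ->.
  rewrite in_itv/= => /andP[l1 l2]; apply: nf; exists l; split => //.
  by rewrite l1 (le_trans l2).
(* one zero in the first quarter of [rho, 1] and one in the third *)
have [z1 [/andP[z1a z1b] wz1]] := zero_between (a := rho) (b := rho + delta) (odew _ kbI) (lexx _)
  ltac:(rewrite /delta; lra) ltac:(lra).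
have [z2 [/andP[z2a z2b] wz2]] := zero_between (a := rho + 2 * delta) (b := rho + 3 * delta)
  (odew _ kbI) ltac:(rewrite /delta; lra) ltac:(rewrite /delta; lra) ltac:(lra).
have delta0 : 0 < delta by rewrite /delta divr_gt0// subr_gt0.
have [d4 [z10 z20]] : 4 * delta = 1 - rho /\ 0 < z1 /\ 0 < z2.
  by split; [rewrite /delta; lra|split; lra].
have [[w0 cwb cyb dwb _] e0] := (odew _ kbI, divr_gt0 delta0 (ltr0n R 2) : 0 < delta / 2).
have z1s : y kb z1 <> 0 by apply: simple => //; lra.
have z2s : y kb z2 <> 0 by apply: simple => //; lra.
have [s1 [s10 [s11 ws1]]] : exists s1, 0 <= s1 <= 1 /\ s1 < rho + 3 / 2 * delta /\ w kb s1 < 0.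
  have [yr|yr|//] := ltgtP (y kb z1) 0.
    have [_ [s [h1 h2 ws]]] := downcrossing sigma_gt0 cwb cyb dwb z10 e0 wz1 yr.
    by exists s; split; [lra|split => //; lra].
  have [[s [h0 h1 h2 ws]] _] := upcrossing sigma_gt0 cwb cyb dwb z10 e0 wz1 yr.
  by exists s; split; [lra|split => //; lra].
have [s2 [s20 [s21 ws2]]] : exists s2, 0 <= s2 <= 1 /\ rho + 3 / 2 * delta < s2 /\ 0 < w kb s2.
  have [yr|yr|//] := ltgtP (y kb z2) 0.
    have [[s [h0 h1 h2 ws]] _] := downcrossing sigma_gt0 cwb cyb dwb z20 e0 wz2 yr.
    by exists s; split; [lra|split => //; lra].
  have [_ [s [h1 h2 ws]]] := upcrossing sigma_gt0 cwb cyb dwb z20 e0 wz2 yr.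
  by exists s; split; [lra|split => //; lra].
have cwk k (kI : ka <= k <= kb) : continuous (w k) by case: (odew _ kI).
have cyk k (kI : ka <= k <= kb) : continuous (y k) by case: (odew _ kI).
have dwk k (kI : ka <= k <= kb) : forall r : R, 0 < r ->
  is_derive r 1 (w k) (y k r / sigma r) by case: (odew _ kI).
have w0k k (kI : ka <= k <= kb) : w k 0 = 1 by case: (odew _ kI).
have [fa|fa|fa] := ltgtP (f ka) 0; last by apply: nf; exists ka; rewrite lexx kab.
  have : w kb s2 <= 0.
    apply: (zeros_enter_upwards sigma_gt0 cwk cyk dwk w0k simple lipw lipy kab _ wpos _ _ _ ws1); try lra.
    move=> k kI wk; have := sgn k kI; rewrite nmulr_rgt0// f_at0//.
    by rewrite pmulr_llt0// vk1.
  by rewrite leNgt ws2.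
have : 0 <= w kb s1.
  apply: (zeros_enter_downwards sigma_gt0 cwk cyk dwk w0k simple lipw kab _ wpos s10).
  move=> k kI wk; have := sgn k kI; rewrite pmulr_rgt0// f_at0//.
  by rewrite pmulr_lgt0// vk1.
by rewrite leNgt ws1.
Qed.

End eigenvalue.

(** * Borel sets, lines and C^1 functions in R^n *)
Section measurability.
Context {R : realType} {n : nat}.
Implicit Types (f : 'rV[R]_n -> R) (A : set 'rV[R]_n).

Lemma measurable_rV_box (A : 'I_n -> set R) : (forall i, measurable (A i)) ->
  measurable [set x : 'rV[R]_n | forall i, A i (x 0 i)].
Proof.
move=> mA; rewrite (_ : mkset _ = \bigcap_(i in [set: 'I_n])
    ((fun x : 'rV[R]_n => x 0 i) @^-1` A i)); last first.
  by apply/seteqP; split => x H i; [move=> _; exact: H|exact: H].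
apply: fin_bigcap_measurable => // i _; rewrite -[X in measurable X]setTI.
exact: measurable_coord.
Qed.

(** An open set is the countable union of the cubes with rational centres and radii
  1 / (k + 1) that it contains. *)
Lemma open_measurable_rV A : open A -> measurable A.
Proof.
move=> oA.
pose F (p : 'rV[rat]_n * nat) : set 'rV[R]_n :=
  [set x | (forall y : 'rV[R]_n, (forall i, `|ratr (p.1 0 i) - y 0 i| < p.2.+1%:R^-1) -> A y) /\
    forall i, `|ratr (p.1 0 i) - x 0 i| < p.2.+1%:R^-1].
have -> : A = \bigcup_p F p.
  apply/seteqP; split => [x Ax|x [p _] [h1 h2]]; last exact: h1.
  have /nbhs_ballP[e /= e0 xA] : nbhs x A by exact: open_nbhs_nbhs.
  pose k := Num.bound (2 / e).
  have k2 : k.+1%:R^-1 < e / 2 :> R.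
    rewrite -[X in _ < X]invf_div ltf_pV2 ?posrE ?divr_gt0//.
    by rewrite (lt_le_trans (archi_boundP _)) ?divr_ge0 ?(ltW e0)// ler_nat.
  have k0 : 0 < k.+1%:R^-1 :> R by rewrite invr_gt0.
  have /choice[q hq] : forall i : 'I_n, exists q : rat, `|ratr q - x 0 i| < k.+1%:R^-1.
    move=> i; have [|q] := @rat_in_itvoo R (x 0 i - k.+1%:R^-1) (x 0 i + k.+1%:R^-1).
      by rewrite ltrD2l (lt_trans _ k0)// oppr_lt0.
    by rewrite in_itv/= => qx; exists q; rewrite ltr_distl.
  exists (\row_i q i, k) => //; split => /= [y hy|i]; last by rewrite mxE.
  apply: xA; split=> // i j; rewrite !ord1; rewrite /ball/=.
  have h2 := hq j; have := hy j; rewrite /= mxE => h1.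
  rewrite (_ : x 0 j - y 0 j = (ratr (q j) - y 0 j) - (ratr (q j) - x 0 j)); last by ring.
  by rewrite (le_lt_trans (ler_normB _ _))// (splitr e) ltrD// (lt_trans _ k2).
apply: countable_bigcupT_measurable => [|p]; first exact: countableP.
have [h|h] := pselect (forall y : 'rV[R]_n,
    (forall i, `|ratr (p.1 0 i) - y 0 i| < p.2.+1%:R^-1) -> A y).
  rewrite (_ : F p = [set x : 'rV[R]_n | forall i,
      [set z | `|ratr (p.1 0 i) - z| < p.2.+1%:R^-1] (x 0 i)]).
    apply: (@measurable_rV_box (fun i => ball (ratr (p.1 0 i) : R) p.2.+1%:R^-1)) => i.
    exact: measurable_ball.
  by apply/seteqP; split => x /= => [[]|].
rewrite (_ : F p = set0)//; apply/seteqP; split => x //= [].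
by move=> /h.
Qed.

Lemma continuous_measurable_rV f : continuous f -> measurable_fun setT f.
Proof.
move=> /continuousP cf; apply: (measurability _ (RGenOInfty.measurableE R)).
move=> _ [_ [a ->] <-]; rewrite setTI; apply: open_measurable_rV; apply: cf.
exact: interval_open.
Qed.

End measurability.

Section lines.
Context {R : realType} {V : normedModType R}.
Implicit Types (f : V -> R) (a v : V).

Lemma is_derive_line f a v (t d : R) : is_derive (a + t *: v) v f d <->
  is_derive t 1 (fun s : R => f (a + s *: v)) d.
Proof.
have E : (fun h : R => h^-1 *: ((f \o shift (a + t *: v)) (h *: v) - f (a + t *: v))) =
    (fun h : R => h^-1 *: (((fun s : R => f (a + s *: v)) \o shift t) (h *: 1) -
       f (a + t *: v))).
  apply/funext => h /=; congr (_ *: (f _ - _)).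
  by rewrite [h%:A]mulr1 scalerDl addrCA.
by split=> -[d1 d2]; apply: DeriveDef; rewrite /derivable /derive ?E -?E in d1 d2 *.
Qed.

Lemma line_lipschitz f v a (t C : R) : (forall s, `|s| <= `|t| -> exists2 d,
    is_derive (a + s *: v) v f d & `|d| <= C) ->
  `|f (a + t *: v) - f a| <= C * `|t|.
Proof.
move=> h.
have {h} /choice[d hd] : forall s : R, exists d : R, `|s| <= `|t| ->
    is_derive (a + s *: v) v f d /\ `|d| <= C.
  move=> s; have [/h[d d1 d2]|h1] := pselect (`|s| <= `|t|); first by exists d.
  by exists 0.
pose g s := f (a + s *: v).
have dg (s : R) : `|s| <= `|t| -> is_derive s 1 g (d s).
  by move=> /hd[+ _]; rewrite is_derive_line.
have cg (x y : R) : (forall s : R, x <= s <= y -> `|s| <= `|t|) -> {within `[x, y], continuous g}.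
  move=> h; apply/continuous_in_subspaceT => s; rewrite inE/= in_itv/= => /h/dg.
  exact: der_continuous.
have -> : f a = g 0 by rewrite /g scale0r addr0.
rewrite -/(g t); have [t0|t0|->] := ltgtP t 0; last first.
- by rewrite subrr !normr0 mulr0.
- have tb (s : R) : 0 <= s <= t -> `|s| <= `|t|.
    by move=> /andP[s0 st]; rewrite (ger0_norm s0) (gtr0_norm t0).
  have [|s] := @MVT R g d 0 t t0 _ (cg _ _ tb).
    by move=> s; rewrite in_itv/= => s0t; apply: dg; apply: tb; lra.
  rewrite in_itv/= => s0t ->; rewrite normrM subr0 ler_wpM2r//.
  by have [|] := hd s; first by apply: tb; lra.
- have tb (s : R) : t <= s <= 0 -> `|s| <= `|t|.
    by move=> /andP[s0 st]; rewrite (ler0_norm st) (ltr0_norm t0) lerN2.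
  have [|s] := @MVT R g d t 0 t0 _ (cg _ _ tb).
    by move=> s; rewrite in_itv/= => s0t; apply: dg; apply: tb; lra.
  rewrite in_itv/= distrC => s0t ->; rewrite normrM sub0r normrN ler_wpM2r//.
  by have [|] := hd s; first by apply: tb; lra.
Qed.

End lines.

Section continuity_of_C1.
Context {R : realType} {n : nat}.
Implicit Types (f : 'rV[R]_n -> R) (x y : 'rV[R]_n).
Local Notation basis i := (delta_mx 0 i : 'rV[R]_n).

(** The vectors obtained by changing the coordinates of x into those of y one at a
  time stay in the (sup-norm) ball, and consecutive ones lie on a coordinate line. *)
Lemma partials_continuous f (d : 'I_n -> 'rV[R]_n -> R) x :
  (\forall y \near x, forall i, is_derive y (basis i) f (d i y)) ->
  (forall i, {for x, continuous (d i)}) -> {for x, continuous f}.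
Proof.
move=> df cd.
pose C := \sum_i (`|d i x| + 1).
have C0 : 0 <= C by apply: sumr_ge0 => i _; rewrite addr_ge0.
have dC : \forall y \near x, forall i, `|d i y| <= C.
  apply: (@filter_forall _ _ (fun i y => `|d i y| <= C) (nbhs x)) => i.
  have /cvgrPdist_lt /(_ _ ltr01) := cd i.
  move=> h0; apply: filterS h0 => y; rewrite distrC => h.
  rewrite (@le_trans _ _ (`|d i x| + 1))//.
    rewrite -lerBlDl; apply: le_trans (ltW h); exact: lerB_dist.
  rewrite /C (bigD1 i)//= lerDl; apply: sumr_ge0 => j _; rewrite addr_ge0//.
have [e e0 he] : exists2 e : R, 0 < e & forall y, ball x e y ->
    (forall i, is_derive y (basis i) f (d i y)) /\ (forall i, `|d i y| <= C).
  have /nbhs_ballP[e /= e0 he] : nbhs x [set y |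
    (forall i, is_derive y (basis i) f (d i y)) /\ (forall i, `|d i y| <= C)].
    exact: filterI df dC.
  by exists e.
have step y : ball x e y -> `|f y - f x| <= \sum_(i < n) C * `|y 0 i - x 0 i|.
  move=> [_ xy].
  pose h k : 'rV[R]_n := \row_i (if (i < k)%N then y 0 i else x 0 i).
  have hk k : (k <= n)%N -> `|f (h k) - f x| <= \sum_(i < n | (i < k)%N) C * `|y 0 i - x 0 i|.
    elim: k => [|k ih] kn.
      rewrite big_pred0// (_ : h 0%N = x) ?subrr ?normr0//.
      by apply/rowP => i; rewrite mxE.
    rewrite (bigD1 (Ordinal kn))//=.
    rewrite (eq_bigl (fun i : 'I_n => (i < k)%N)); last first.
      move=> i; rewrite ltnS -val_eqE/= ltn_neqAle; case: (ltngtP i k) => //.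
    have := ih (ltnW kn); set S := \sum_(i < n | _) _ => hS.
    have hE t : h k + t *: basis (Ordinal kn) = \row_i
        (if (i < k)%N then y 0 i else if i == Ordinal kn then x 0 i + t else x 0 i).
      apply/rowP => i; rewrite !mxE/=; case: (ltnP i k) => ik.
        by rewrite (_ : i == _ = false) ?mulr0 ?addr0//; apply/negbTE; rewrite -val_eqE/= ltn_eqF.
      by case: eqP => _; rewrite ?mulr1 ?mulr0 ?addr0.
    pose t := y 0 (Ordinal kn) - x 0 (Ordinal kn).
    have -> : h k.+1 = h k + t *: basis (Ordinal kn).
      rewrite hE; apply/rowP => i; rewrite !mxE ltnS leq_eqVlt -val_eqE/=.
      case: (ltnP i k) => ik; first by rewrite orbT.
      rewrite orbF; case: eqP => // ik'.
      have -> : i = Ordinal kn by apply/val_inj.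
      by rewrite /t addrC subrK.
    rewrite (_ : f _ - f x = (f (h k + t *: basis (Ordinal kn)) - f (h k)) + (f (h k) - f x)).
      rewrite (le_trans (ler_normD _ _))// lerD//.
      apply: line_lipschitz => s st; exists (d (Ordinal kn) (h k + s *: basis (Ordinal kn))).
        apply: (he _ _).1; split => // i j; rewrite !ord1 hE mxE.
        case: ifP => _; first exact: xy.
        case: eqP => [->|_]; last exact: ballxx.
        rewrite /ball/= opprD addrA subrr sub0r normrN (le_lt_trans st)//.
        by rewrite /t distrC; exact: xy.
      apply: (he _ _).2; split => // i j; rewrite !ord1 hE mxE.
      case: ifP => _; first exact: xy.
      case: eqP => [->|_]; last exact: ballxx.
      rewrite /ball/= opprD addrA subrr sub0r normrN (le_lt_trans st)//.
      by rewrite /t distrC; exact: xy.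
    by rewrite addrA subrK.
  have := hk n (leqnn n); rewrite (_ : h n = y); last by apply/rowP => i; rewrite mxE ltn_ord.
  by rewrite (eq_bigl xpredT)// => i; rewrite ltn_ord.
apply/(cvgrPdist_lt (FF := nbhs_filter x)) => r r0.
have near1 : nbhs x [set y : 'rV[R]_n | forall i : 'I_n, C * `|y 0 i - x 0 i| < r / n.+1%:R].
  apply: (@filter_forall _ _ (fun i (y : 'rV[R]_n) => C * `|y 0 i - x 0 i| < r / n.+1%:R) (nbhs x)) => i.
  have /cvgrPdist_lt := @coord_continuous R 1 n 0 i x.
  move=> /(_ (r / n.+1%:R / (C + 1))) -[|]; first by rewrite !divr_gt0// ltr_wpDl.
  move=> e1 /= e10 h; exists e1 => // y /h.
  rewrite distrC ltr_pdivlMr ?ltr_wpDl// => hy; apply: le_lt_trans hy.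
  by rewrite mulrC ler_wpM2l// lerDl.
have near2 : nbhs x (ball x e) by exact: nbhsx_ballx.
apply: (@filterS _ (nbhs x) _ _ _ _ (filterI near2 near1)) => y [/step h1 h2]; rewrite distrC (le_lt_trans h1)//.
apply: (@le_lt_trans _ _ (\sum_(i < n) r / n.+1%:R)).
  by apply: ler_sum => i _; exact: ltW.
rewrite sumr_const card_ord -[X in X < _]mulr_natl mulrCA gtr_pMr// ltr_pdivrMr// mul1r.
by rewrite ltr_nat.
Qed.

End continuity_of_C1.

(** * Integrals of partial derivatives *)
Lemma compact_bound {R : realType} {T : topologicalType} (K : set T) (f : T -> R) :
  compact K -> continuous f -> exists2 C, 0 <= C & forall x, K x -> `|f x| <= C.
Proof.
move=> cK cf; have [->|/set0P K0] := eqVneq K set0; first by exists 0.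
have cn : {within K, continuous (fun x => `|f x|)}.
  by apply: continuous_subspaceT => x; apply: cvg_norm; exact: cf.
have [c _ hc] := compact_EVT_max K0 cK cn.
by exists `|f c| => // x Kx; apply: hc; rewrite inE.
Qed.

Lemma bounded_support_integrable d (T : measurableType d) (R : realType)
    (mu : {measure set T -> \bar R}) (A : set T) (f : T -> R) (C : R) :
  measurable A -> (mu A < +oo)%E -> measurable_fun setT f ->
  (forall x, `|f x| <= C) -> (forall x, ~ A x -> f x = 0) ->
  mu.-integrable setT (EFin \o f).
Proof.
move=> mA muA mf fC f0.
have -> : EFin \o f = (EFin \o f) \_ A.
  by apply/funext => x; rewrite patchE; case: ifPn => //= /negP xA;
    rewrite f0//; move=> Ax; apply: xA; rewrite inE.
apply/(integrable_mkcond _ mA); apply: measurable_bounded_integrable => //.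
  exact: measurable_funTS.
by exists C; split; [exact: num_real|move=> x Cx y _ /=; exact: le_trans (fC y) (ltW Cx)].
Qed.

Lemma continuous_rV {R : realType} {T : topologicalType} n (g : T -> 'rV[R]_n) :
  (forall i, continuous (fun x => g x 0 i)) -> continuous g.
Proof.
move=> cg x A [P nP PA]; rewrite /nbhs/=.
have : nbhs x [set z | forall i, P 0 i (g z 0 i)].
  apply: (@filter_forall _ _ (fun i z => P 0 i (g z 0 i)) (nbhs x)) => i.
  by apply: cg; exact: nP.
by apply: filterS => z h; apply: PA => i j; rewrite ord1.
Qed.

Section box.
Context {R : realType} (n : nat).

Definition box (M : R) : set 'rV[R]_n := [set x | forall i, `[- M, M]%classic (x 0 i)].

Lemma boxPn (M : R) x : ~ box M x -> exists i, M < `|x 0 i|.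
Proof.
move=> /existsNP[i /negP]; rewrite /= in_itv/= -ler_norml -ltNge => h; by exists i.
Qed.

Lemma measurable_box M : measurable (box M).
Proof. by apply: (@measurable_rV_box _ _ (fun=> `[- M, M]%classic)). Qed.

Lemma compact_box M : compact (box M).
Proof. by apply: (@rV_compact R n (fun=> `[- M, M]%classic)) => i; exact: segment_compact. Qed.

Lemma box_finite M : (lebesgue_rV R n (box M) < +oo)%E.
Proof.
rewrite (@lebesgue_rV_box R n (fun=> `[- M, M]%classic))//.
rewrite -ge0_fin_numE; last by apply: prode_ge0 => i _; exact: measure_ge0.
apply: (big_ind (fun x => x \is a fin_num)) => // [x y fx fy|i _].
  exact: fin_numM.
by rewrite /= lebesgue_measure_itv/=; case: ifP.
Qed.

End box.
Arguments box {R} n M.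

Section fubini.
Context {R : realType}.
Local Notation basis i := (delta_mx 0 i).

Lemma is_derive_line0 {V : normedModType R} (f : V -> R) (a v : V) (d : R) :
  is_derive a v f d <-> is_derive (0 : R) (1 : R) (fun s : R => f (a + s *: v)) d.
Proof. by rewrite -is_derive_line scale0r addr0. Qed.

Lemma is_derive_unique {V : normedModType R} (f : V -> R) (a v : V) (d d' : R) :
  is_derive a v f d -> is_derive a v f d' -> d = d'.
Proof. by move=> [_ <-] [_ <-]. Qed.

Lemma derive_off_support n (f d : 'rV[R]_n -> R) (i : 'I_n) (M : R) :
  (forall x, is_derive x (basis i) f (d x)) ->
  (forall x : 'rV[R]_n, (exists j, M < `|x 0 j|) -> f x = 0) ->
  forall x : 'rV[R]_n, (exists j, M < `|x 0 j|) -> d x = 0.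
Proof.
move=> df f0 x [j xj]; apply: is_derive_unique (df x) _.
apply: (@der_near _ _ (fun=> 0)).
  by apply/eqP => /rowP/(_ i); rewrite !mxE !eqxx => /eqP; rewrite oner_eq0.
have : nbhs (x 0 j) [set z | M < `|z|].
  by have /cvgr_gt := (@norm_continuous _ R (x 0 j)); exact.
move=> /(@coord_continuous R 1 n 0 j x) hx.
apply: (@filterS _ (nbhs x) (nbhs_filter x) _ _ _ hx) => z /= h.
by rewrite f0//; exists j.
Qed.

Lemma rV_cons_shift0 n (t : R) (x : 'rV[R]_n) (s : R) :
  rV_cons (t, x) + s *: basis ord0 = rV_cons (t + s, x).
Proof.
apply/rowP => i; case: (unliftP ord0 i) => [j ->|->].
  by rewrite mxE !rV_consS/= 2!mxE/= ?eqxx/= mulr0 addr0.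
by rewrite mxE !rV_cons0/= 2!mxE/= ?eqxx/= mulr1.
Qed.

Lemma rV_cons_shiftS n (t : R) (x : 'rV[R]_n) (s : R) (j : 'I_n) :
  rV_cons (t, x) + s *: basis (lift ord0 j) = rV_cons (t, x + s *: basis j).
Proof.
apply/rowP => i; case: (unliftP ord0 i) => [k ->|->].
  by rewrite mxE !rV_consS/= !mxE (inj_eq lift_inj).
by rewrite mxE !rV_cons0/= 2!mxE/= ?eqxx/= mulr0 addr0.
Qed.

Lemma integral_derive_line (g g' : R -> R) (M : R) :
  (forall t : R, is_derive t 1 g (g' t)) -> continuous g' ->
  (forall t : R, M < `|t| -> g t = 0) -> (\int[lebesgue_measure]_t (g' t)%:E = 0)%E.
Proof.
move=> dg cg' g0.
have g'0 (t : R) : M < `|t| -> g' t = 0.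
  move=> Mt; apply: is_derive_unique (dg t) _.
  apply: (@der_near _ _ (fun=> 0)).
    by rewrite oner_eq0.
  have : nbhs t [set z | M < `|z|].
    by have /cvgr_gt := (@norm_continuous _ R t); exact.
  by apply: filterS => z /= h; rewrite g0.
pose b := `|M| + 1.
have Mb : M < `|b| by rewrite ger0_norm ?addr_ge0// ltr_pwDr// ler_norm.
have -> : (fun t => (g' t)%:E) = (fun t => (g' t)%:E) \_ `[- b, b]%classic.
  apply/funext => t; rewrite patchE; case: ifPn => //; rewrite notin_setE/= in_itv/=.
  move=> /negP; rewrite -ler_norml -ltNge => tb; rewrite g'0// (lt_trans _ tb)//.
  by rewrite (lt_le_trans Mb)// ger0_norm ?addr_ge0.
rewrite -integral_mkcond (@continuous_FTC2 R g' g).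
- by rewrite !g0 ?subee// normrN.
- by rewrite /b; have := normr_ge0 M; lra.
- exact: continuous_within.
- split=> [t _||]; first by case: (dg t).
    by apply: cvg_at_right_filter; exact: (der_continuous (dg _)).
  by apply: cvg_at_left_filter; exact: (der_continuous (dg _)).
- by move=> t _; rewrite derive1E; case: (dg t).
Qed.

(** Fubini reduces to a line parallel to a coordinate axis, where the fundamental theorem
  of calculus applies. *)
Lemma integral_partial_eq0 n (i : 'I_n) (f d : 'rV[R]_n -> R) (M : R) :
  (forall x, is_derive x (basis i) f (d x)) -> continuous d ->
  (forall x : 'rV[R]_n, (exists j, M < `|x 0 j|) -> f x = 0) ->
  (\int[lebesgue_rV R n]_x (d x)%:E = 0)%E.
Proof.
elim: n i f d => [[]//|n ih] i f d df cd f0.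
have d0 := derive_off_support df f0.
have [C C0 dC] := compact_bound (@compact_box R n.+1 M) cd.
have dB x : `|d x| <= C.
  have [/dC//|/boxPn h] := pselect (box n.+1 M x).
  by rewrite d0// normr0.
have dBox x : ~ box n.+1 M x -> d x = 0 by move=> /boxPn; exact: d0.
have md := continuous_measurable_rV cd.
have intd : ((@lebesgue_measure R) \x (lebesgue_rV R n))%E.-integrable setT
    ((EFin \o d) \o @rV_cons R n).
  apply: (@bounded_support_integrable _ _ _ _ (@rV_cons R n @^-1` box n.+1 M) _ C) => //.
  - rewrite -[X in measurable X]setTI; apply: measurable_rV_cons => //.
    exact: measurable_box.
  - exact: (@box_finite R n.+1 M).
  - by apply: measurableT_comp => //; exact: measurable_rV_cons.
  - by move=> x; exact: dBox.
rewrite -[LHS]/(\int[pushforward ((@lebesgue_measure R) \x (lebesgue_rV R n)) (@rV_cons R n)]_x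
  (EFin \o d) x)%E.
rewrite (integral_pushforward (@measurable_rV_cons R n)) ?preimage_setT//; last first.
  exact/measurable_EFinP.
have ccons1 (x : 'rV[R]_n) : continuous (fun t : R => rV_cons (t, x)).
  apply: continuous_rV => j; case: (unliftP ord0 j) => [k ->|->].
    rewrite (_ : (fun t => _) = cst (x 0 k)) => [t|]; first exact: cvg_cst.
    by apply/funext => t; rewrite rV_consS.
  rewrite (_ : (fun t => _) = id) => [t|]; first exact: cvg_id.
  by apply/funext => t; rewrite rV_cons0.
have ccons2 (t : R) : continuous (fun x : 'rV[R]_n => rV_cons (t, x)).
  apply: continuous_rV => j; case: (unliftP ord0 j) => [k ->|->].
    rewrite (_ : (fun x => _) = (fun x : 'rV[R]_n => x 0 k)); first exact: coord_continuous.
    by apply/funext => x; rewrite rV_consS.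
  rewrite (_ : (fun x => _) = cst t); first exact: cst_continuous.
  by apply/funext => x; rewrite rV_cons0.
case: (unliftP ord0 i) => [j|] iE.
  rewrite -integral12_prod_meas1//= integral0_eq// => t _; rewrite /fubini_F/=.
  apply: (ih j (fun x => f (rV_cons (t, x)))).
  - move=> x; rewrite is_derive_line0.
    have := df (rV_cons (t, x)); rewrite iE is_derive_line0.
    by under eq_fun do rewrite rV_cons_shiftS.
  - by move=> x; apply: continuous_comp; [exact: ccons2|exact: cd].
  - by move=> x [k xk]; apply: f0; exists (lift ord0 k); rewrite rV_consS.
rewrite -integral21_prod_meas1//= integral0_eq// => x _; rewrite /fubini_G/=.
apply: (@integral_derive_line (fun t => f (rV_cons (t, x))) _ M).
- move=> t; have := df (rV_cons (t, x)); rewrite iE is_derive_line0.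
  under eq_fun do rewrite rV_cons_shift0.
  move=> h; rewrite is_derive_line0; apply: der_eq h => // s.
  by rewrite [s%:A]mulr1.
- by move=> t; apply: continuous_comp; [exact: ccons1|exact: cd].
- by move=> t tM; apply: f0; exists ord0; rewrite rV_cons0.
Qed.

End fubini.

(** * Calculus and square integrable functions on the unit ball *)
Section bounded_real_integrals.
Context d (T : measurableType d) (R : realType) (mu : {measure set T -> \bar R}).
Implicit Types (D : set T) (f g : T -> R).

Lemma Rintegral_dominated_cvg D (f_ : nat -> T -> R) f g : measurable D ->
  (forall j, measurable_fun D (f_ j)) -> mu.-integrable D (EFin \o g) ->
  (forall x, D x -> f_ j x @[j --> \oo] --> f x) ->
  (forall j x, D x -> `|f_ j x| <= g x) ->
  \int[mu]_(x in D) f_ j x @[j --> \oo] --> \int[mu]_(x in D) f x.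
Proof.
move=> mD mf ig ff fg.
have mff : measurable_fun D f.
  exact: (measurable_fun_cvg mf ff).
have [|||||intf _ cv] := @dominated_convergence _ _ _ mu D mD (fun j => EFin \o f_ j)
  (EFin \o f) (EFin \o g).
- by move=> j; exact/measurable_EFinP.
- exact/measurable_EFinP.
- by apply: aeW => x Dx; apply: cvg_EFin; [exact: nearW|exact: ff].
- exact: ig.
- by apply: aeW => x j Dx; rewrite lee_fin; exact: fg.
apply: fine_cvg; rewrite /Rintegral fineK; first exact: cv.
exact: integrable_fin_num.
Qed.

End bounded_real_integrals.

Section chain_rule.
Context {R : realType} {V : normedModType R}.

Lemma derComp (g : R -> R) (f : V -> R) (x v : V) (dg df : R) :
  is_derive (f x) 1 g dg -> is_derive x v f df ->
  is_derive x v (fun z => g (f z)) (dg * df).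
Proof.
move=> dgx /is_derive_line0 dfx; apply/is_derive_line0.
apply: (is_derive1_comp (f := g) (g := fun s : R => f (x + s *: v))) => //.
by rewrite scale0r addr0.
Qed.

End chain_rule.

(* Pointwise forms of the continuity rules, with the function displayed in the
   conclusion, so that they apply to an expression by syntactic descent. *)
Section continuity_rules.
Context {R : realType} {T : topologicalType}.
Implicit Types (f g : T -> R) (x : T).

Lemma ctC (c : R) x : {for x, continuous (fun=> c : R)}.
Proof. exact: cvg_cst. Qed.

Lemma ctD f g x : {for x, continuous f} -> {for x, continuous g} ->
  {for x, continuous (fun z => f z + g z)}.
Proof. exact: cvgD. Qed.

Lemma ctB f g x : {for x, continuous f} -> {for x, continuous g} ->
  {for x, continuous (fun z => f z - g z)}.
Proof. exact: cvgB. Qed.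

Lemma ctM f g x : {for x, continuous f} -> {for x, continuous g} ->
  {for x, continuous (fun z => f z * g z)}.
Proof. exact: cvgM. Qed.

Lemma ctX n f x : {for x, continuous f} -> {for x, continuous (fun z => f z ^+ n)}.
Proof. by move=> cf; exact: (@continuous_comp _ _ _ f (fun z => z ^+ n) x cf (@exprn_continuous _ _ _)). Qed.

Lemma ctV f x : f x != 0 -> {for x, continuous f} -> {for x, continuous (fun z => (f z)^-1)}.
Proof. exact: cvgV. Qed.

Lemma ctComp (g : R -> R) f x : {for f x, continuous g} -> {for x, continuous f} ->
  {for x, continuous (fun z => g (f z))}.
Proof. by move=> cg cf; exact: (continuous_comp cf cg). Qed.

Lemma ctSum (I : Type) (r : seq I) (f : I -> T -> R) x : (forall i, {for x, continuous (f i)}) ->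
  {for x, continuous (fun z => \sum_(i <- r) f i z)}.
Proof. by move=> cf; apply: cvg_big => [|i _]; [exact: add_continuous|exact: cf]. Qed.

Lemma ct_near f g x : (\near x, f x = g x) -> {for x, continuous f} -> {for x, continuous g}.
Proof.
move=> fg cf; rewrite /prop_for /continuous_at -(nbhs_singleton fg).
apply: cvg_trans cf; exact: near_eq_cvg.
Qed.

End continuity_rules.

Section ball_geometry.
Context {R : realType} {N : nat}.
Implicit Types x : 'rV[R]_N.
Local Notation basis i := (delta_mx 0 i : 'rV[R]_N).
Local Notation D := (@eball R N 1).
Local Notation mu := (lebesgue_rV R N).

Definition sqnorm x : R := \sum_i x 0 i ^+ 2.

(** Positive exactly on the punctured unit ball: it measures at once the distance to the
  origin and the distance to the sphere. *)
Definition weight x : R := sqnorm x * (1 - sqnorm x).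

Lemma sqnorm_ge0 x : 0 <= sqnorm x.
Proof. by apply: sumr_ge0 => i _; exact: sqr_ge0. Qed.

Lemma enorm_sq x : enorm x ^+ 2 = sqnorm x.
Proof. by rewrite sqr_sqrtr// sqnorm_ge0. Qed.

Lemma enorm_ge0 x : 0 <= enorm x. Proof. exact: sqrtr_ge0. Qed.

Lemma enorm_gt0 x : (0 < enorm x) = (0 < sqnorm x).
Proof. by rewrite sqrtr_gt0. Qed.

Lemma coord_le_enorm x i : `|x 0 i| <= enorm x.
Proof.
rewrite -sqrtr_sqr ler_wsqrtr// (bigD1 i)//= lerDl.
by apply: sumr_ge0 => j _; exact: sqr_ge0.
Qed.

Lemma eballE (t : R) x : 0 < t -> (eball t x <-> sqnorm x < t ^+ 2).
Proof.
move=> t0; rewrite -enorm_sq ltr_pXn2r ?nnegrE ?(ltW t0)//.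
exact: enorm_ge0.
Qed.

Lemma eball1E x : D x <-> sqnorm x < 1.
Proof. by rewrite eballE// expr1n. Qed.

Lemma weight_gt0 x : (0 < weight x) = (0 < sqnorm x < 1).
Proof.
rewrite /weight; have := sqnorm_ge0 x; rewrite le_eqVlt => /predU1P[<-|s0].
  by rewrite mul0r ltxx.
by rewrite pmulr_rgt0// subr_gt0 s0.
Qed.

Lemma weight_gt0_ball x : 0 < weight x -> D x.
Proof. by rewrite weight_gt0 eball1E => /andP[]. Qed.

Lemma sqnorm_eq0 x : sqnorm x = 0 -> x = 0.
Proof.
move/eqP; rewrite psumr_eq0; last by move=> i _; exact: sqr_ge0.
by move/allP => h; apply/rowP => i; rewrite mxE; apply/eqP; have := h i;
  rewrite mem_index_enum sqrf_eq0 => /(_ isT).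
Qed.

Lemma ball_cases x : D x -> x = 0 \/ 0 < weight x.
Proof.
rewrite eball1E weight_gt0 => ->; rewrite andbT.
have := sqnorm_ge0 x; rewrite le_eqVlt => /predU1P[/esym/sqnorm_eq0|]; by [left|right].
Qed.

Lemma sqnorm0 : sqnorm 0 = 0.
Proof. by rewrite /sqnorm big1// => i _; rewrite mxE expr0n. Qed.

Lemma weight0 : weight 0 = 0. Proof. by rewrite /weight sqnorm0 mul0r. Qed.

Lemma continuous_coord i : continuous (fun x => x 0 i).
Proof. exact: coord_continuous. Qed.

Lemma continuous_sqnorm : continuous sqnorm.
Proof.
by move=> x; apply: ctSum => i; apply: ctX; exact: continuous_coord.
Qed.

Lemma continuous_weight : continuous weight.
Proof.
move=> x; apply: ctM; first exact: continuous_sqnorm.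
by apply: ctB; [exact: ctC|exact: continuous_sqnorm].
Qed.

Lemma continuous_enorm : continuous (@enorm R N).
Proof.
move=> x; apply: ctComp; first exact: sqrt_continuous.
exact: continuous_sqnorm.
Qed.

Lemma is_derive_coord x (i j : 'I_N) :
  is_derive x (basis j) (fun x => x 0 i) (i == j)%:R.
Proof.
rewrite is_derive_line0; have := derD (derC (x 0 i) (0 : R) 1) (derMc (i == j)%:R (der_id (0 : R))).
rewrite add0r mulr1; apply: der_eq => // s.
by rewrite !mxE/= mulrC.
Qed.

Lemma basis_neq0 (j : 'I_N) : basis j != 0.
Proof. by apply/eqP => /rowP/(_ j); rewrite !mxE !eqxx => /eqP; rewrite oner_eq0. Qed.

Lemma derSum n (f : 'I_n -> 'rV[R]_N -> R) (df : 'I_n -> R) x v :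
  (forall i, is_derive x v (f i) (df i)) ->
  is_derive x v (fun z => \sum_i f i z) (\sum_i df i).
Proof.
move=> h; have := is_derive_sum h.
by apply: der_eq => // z; rewrite fct_sumE.
Qed.

Lemma is_derive_sqnorm x (j : 'I_N) : is_derive x (basis j) sqnorm (2 * x 0 j).
Proof.
have := derSum (fun i => derX 1 (is_derive_coord x i j)).
move/is_derive_eq; apply; rewrite (bigD1 j)//= eqxx mulr1 expr1 big1 ?addr0// => i ij.
by rewrite (negbTE ij) mulr0.
Qed.

Lemma is_derive_weight x (j : 'I_N) :
  is_derive x (basis j) weight ((1 - 2 * sqnorm x) * (2 * x 0 j)).
Proof.
have := derM (is_derive_sqnorm x j) (derB (derC 1 x _) (is_derive_sqnorm x j)).
by move/is_derive_eq; apply; ring.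
Qed.

Lemma is_derive_enorm x (j : 'I_N) : 0 < enorm x ->
  is_derive x (basis j) (@enorm R N) (x 0 j / enorm x).
Proof.
rewrite enorm_gt0 => s0; have := derComp (is_derive1_sqrt s0) (is_derive_sqnorm x j).
move/is_derive_eq; apply; rewrite -/(enorm x).
by field; rewrite gt_eqF// enorm_gt0.
Qed.

Lemma measurable_enorm : measurable_fun setT (@enorm R N).
Proof. apply: continuous_measurable_rV; exact: continuous_enorm. Qed.

Lemma measurable_eball (t : R) : measurable (@eball R N t).
Proof.
rewrite (_ : eball t = setT `&` (@enorm R N) @^-1` `]-oo, t[%classic).
  exact: measurable_enorm.
by rewrite setTI; apply/seteqP; split => x; rewrite /eball/= in_itv.
Qed.

Lemma eball_sub_box (t : R) : @eball R N t `<=` box N t.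
Proof.
move=> x xt i /=; rewrite in_itv/= -ler_norml (le_trans (coord_le_enorm x i))//.
exact: ltW.
Qed.

Lemma eball_finite (t : R) : (mu (eball t) < +oo)%E.
Proof.
apply: le_lt_trans (@box_finite R N t).
by apply: le_measure; rewrite ?inE; [exact: measurable_eball|exact: measurable_box|
  exact: eball_sub_box].
Qed.

End ball_geometry.

Section L2.
Context {R : realType} {N : nat}.
Local Notation D := (@eball R N 1).
Local Notation mu := (lebesgue_rV R N).
Implicit Types f g : 'rV[R]_N -> R.

Lemma in_L2_integrableM f g : in_L2 D f -> in_L2 D g ->
  mu.-integrable D (EFin \o (fun x => f x * g x)).
Proof.
move=> f2 g2; apply/(integrable_mkcond _ (measurable_eball 1)).
have := Lfun2_mul_Lfun1 f2 g2; move/Lfun1_integrable.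
rewrite (_ : EFin \o _ = (EFin \o (fun x => f x * g x)) \_ D)//.
by apply/funext => x /=; rewrite !patchE; case: ifP; rewrite ?mulr0.
Qed.

Lemma bounded_integrable (A : set 'rV[R]_N) f (C : R) : measurable A -> (mu A < +oo)%E ->
  measurable_fun A f -> (forall x, A x -> `|f x| <= C) -> mu.-integrable A (EFin \o f).
Proof.
move=> mA Afin mf fC; apply: measurable_bounded_integrable => //.
by exists C; split; [exact: num_real|move=> y Cy x Ax /=; exact: le_trans (fC x Ax) (ltW Cy)].
Qed.

Lemma normL2E (A : set 'rV[R]_N) f (C : R) : measurable A -> (mu A < +oo)%E ->
  measurable_fun A f -> (forall x, A x -> `|f x| <= C) ->
  normL2 A f = (Num.sqrt (\int[mu]_(x in A) (f x ^+ 2)))%:E.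
Proof.
move=> mA Afin mf fC; rewrite /normL2 unlock.
rewrite (_ : (fun x => _) = (EFin \o (fun x => f x ^+ 2)) \_ A); last first.
  apply/funext => x /=; rewrite !patchE; case: ifPn => _ /=.
    by rewrite powR_mulrn// -normrX ger0_norm// sqr_ge0.
  by rewrite normr0 powR0.
rewrite -integral_mkcond.
have int2 : mu.-integrable A (EFin \o (fun x => f x ^+ 2)).
  apply: (@bounded_integrable _ _ (C ^+ 2)) => //; first exact: measurable_funX.
  by move=> x Ax; rewrite normrX lerXn2r ?nnegrE// ?fC// (le_trans _ (fC x Ax)).
rewrite -[X in (X `^ _)%E]fineK; last exact: integrable_fin_num.
rewrite poweR_EFin powR12_sqrt//.
by apply: Rintegral_ge0 => x _; exact: sqr_ge0.
Qed.

Lemma in_L2_bounded f (C : R) : measurable_fun D f -> (forall x, D x -> `|f x| <= C) ->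
  in_L2 D f.
Proof.
move=> mf fC; rewrite /in_L2 inE; apply/andP; split; rewrite inE /=.
  by apply/(measurable_restrictT f (measurable_eball 1)).
rewrite /finite_norm -/(normL2 D f) (@normL2E _ _ C)//; [by rewrite ltry|exact: measurable_eball|exact: eball_finite].
Qed.

Lemma integrable_in_L2 f : in_L2 D f -> mu.-integrable D (EFin \o f).
Proof.
move=> f2; have one : in_L2 D (cst 1 : 'rV[R]_N -> R).
  by apply: (@in_L2_bounded _ 1) => // x _; rewrite normr1.
have := in_L2_integrableM f2 one; rewrite (_ : (fun x => _) = f)//.
by apply/funext => x; rewrite /= mulr1.
Qed.

Lemma normL2_cvg0 (f_ : nat -> 'rV[R]_N -> R) (C : R) : (forall j, measurable_fun D (f_ j)) ->
  (forall j x, D x -> `|f_ j x| <= C) -> (forall x, D x -> f_ j x @[j --> \oo] --> 0) ->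
  normL2 D (f_ j) @[j --> \oo] --> 0%E.
Proof.
move=> mf fC f0; have mD := @measurable_eball R N 1.
have -> : (fun j => normL2 D (f_ j)) = EFin \o (fun j => Num.sqrt (\int[mu]_(x in D) (f_ j x ^+ 2))).
  by apply/funext => j; rewrite (normL2E mD (eball_finite 1) (mf j) (fC j)).
apply: cvg_EFin; first exact: nearW.
suff h : \int[mu]_(x in D) (f_ j x ^+ 2) @[j --> \oo] --> 0.
  have := cvg_comp _ _ h (@sqrt_continuous R 0); rewrite sqrtr0; exact.
have -> : 0 = \int[mu]_(x in D) ((fun=> 0) x : R).
  by rewrite Rintegral_cst// mul0r.
apply: (@Rintegral_dominated_cvg _ _ _ _ D _ _ (fun=> C ^+ 2)) => //.
- by move=> j; exact: measurable_funX.
- apply: (@bounded_integrable _ _ (C ^+ 2)) => //; first exact: eball_finite.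
  by move=> x _; rewrite ger0_norm// sqr_ge0.
- move=> x Dx; rewrite -[X in _ --> X](mulr0 0).
  by apply: cvgM; exact: f0.
- by move=> j x Dx; rewrite normrX lerXn2r ?nnegrE// ?fC// (le_trans _ (fC j x Dx)).
Qed.

End L2.

(** * Test functions and cutoffs *)
Section compactly_supported.
Context {R : realType} {N : nat}.
Implicit Types (x : 'rV[R]_N) (f phi : 'rV[R]_N -> R).
Local Notation basis i := (delta_mx 0 i : 'rV[R]_N).
Local Notation D := (@eball R N 1).
Local Notation mu := (lebesgue_rV R N).

Lemma C1c_intro phi (dphi : 'I_N -> 'rV[R]_N -> R) (K : set 'rV[R]_N) :
  (forall i x, is_derive x (basis i) phi (dphi i x)) ->
  (forall i, continuous (dphi i)) -> compact K -> K `<=` D ->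
  (forall x, ~ K x -> phi x = 0) ->
  C1c D phi /\ forall i, partial i phi = dphi i.
Proof.
move=> dp cdp cK KD phi0.
have pE i : partial i phi = dphi i by apply/funext => x; case: (dp i x).
split => //; split; last by exists K.
  by move=> i x; case: (dp i x).
by move=> i; rewrite pE.
Qed.

Lemma C1c_derive phi i x : C1c D phi -> is_derive x (basis i) phi (partial i phi x).
Proof. by move=> [dp _ _]; exact: derivableP. Qed.

Lemma C1c_continuous phi : C1c D phi -> continuous phi.
Proof.
move=> h x; apply: (@partials_continuous _ _ _ (fun i => partial i phi)).
  by apply: (@filterE _ (nbhs x) (nbhs_filter x)) => y i; exact: C1c_derive.
by move=> i; case: h => _ + _; exact.
Qed.

Lemma C1c_bound phi : C1c D phi -> exists2 C, 0 <= C & forall x, `|phi x| <= C.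
Proof.
move=> h; have cphi := C1c_continuous h; case: h => _ _ [K [cK _] phi0].
have [C C0 hC] := compact_bound cK cphi.
by exists C => // x; have [/hC//|/phi0 ->] := pselect (K x); rewrite normr0.
Qed.

Lemma C1c_partial_bound phi i : C1c D phi ->
  exists2 C, 0 <= C & forall x, D x -> `|partial i phi x| <= C.
Proof.
move=> [_ cp _]; have [C C0 hC] := compact_bound (@compact_box R N 1) (cp i).
by exists C => // x Dx; apply: hC; exact: (@eball_sub_box _ _ 1).
Qed.

Lemma C1c_off phi x : C1c D phi -> ~ D x -> phi x = 0.
Proof. by move=> [_ _ [K [_ KD] phi0]] Dx; apply: phi0 => /KD. Qed.

Lemma C1c_partial_off phi i x : C1c D phi -> ~ D x -> partial i phi x = 0.
Proof.
move=> h Dx; case: (h) => _ _ [K [cK KD] phi0].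
have cloK : closed K by apply: compact_closed => //; exact: norm_hausdorff.
apply: is_derive_unique (C1c_derive i x h) _.
apply: (@der_near _ _ (fun=> 0)); first exact: basis_neq0.
have : nbhs x (~` K).
  by apply: open_nbhs_nbhs; split; [exact: closed_openC|move=> /KD].
by apply: (@filterS _ (nbhs x) (nbhs_filter x)) => y Ky; rewrite phi0.
Qed.

(** A compact subset of the open ball stays away from the sphere. *)
Lemma C1c_boundary_decay phi : C1c D phi ->
  exists2 C, 0 <= C & forall x, D x -> `|phi x| <= C * (1 - sqnorm x).
Proof.
move=> h; have [C C0 hC] := C1c_bound h; case: (h) => _ _ [K [cK KD] phi0].
have [K0|/set0P Kn] := eqVneq K set0.
  exists 0 => // x _; rewrite mul0r phi0 ?normr0//.
  by rewrite K0.
have cs : {within K, continuous (@sqnorm R N)}.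
  by apply: continuous_subspaceT; exact: continuous_sqnorm.
have [c + cmax] := compact_EVT_max Kn cK cs.
rewrite inE => /KD /eball1E c1.
have d0 : 0 < 1 - sqnorm c by rewrite subr_gt0.
exists (C / (1 - sqnorm c)); first by rewrite divr_ge0// ltW.
move=> x Dx; have [Kx|/phi0 ->] := pselect (K x); last first.
  rewrite normr0 mulr_ge0 ?divr_ge0 ?(ltW d0)// subr_ge0 ltW//.
  exact/eball1E.
apply: (le_trans (hC x)); rewrite mulrAC ler_pdivlMr// ler_wpM2l// lerD2l lerN2.
by apply: cmax; rewrite inE.
Qed.

Lemma integral_partial phi i : C1c D phi -> \int[mu]_(x in D) partial i phi x = 0.
Proof.
move=> h; rewrite Rintegral_mkcond /Rintegral.
rewrite (_ : (fun x => _) = (fun x => (partial i phi x)%:E)); last first.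
  apply/funext => x; rewrite patchE; case: ifPn => // xD.
  by rewrite C1c_partial_off//; move: xD; rewrite notin_setE.
have -> // : (\int[mu]_x (partial i phi x)%:E = 0)%E.
apply: (@integral_partial_eq0 _ _ i phi (partial i phi) 1).
- by move=> x; exact: C1c_derive.
- by case: h.
- move=> x [j xj]; apply: (C1c_off h) => Dx.
  by have := coord_le_enorm x j; rewrite leNgt (lt_trans Dx xj).
Qed.

(** Turns the Green formula against H^1 functions into a divergence theorem. *)
Lemma H1_one : H1_grad D (fun=> 1) (fun _ _ => 0).
Proof.
have one (c : R) : in_L2 D (fun=> c).
  by apply: (@in_L2_bounded _ _ _ `|c|) => //; exact: measurable_cst.
split => // phi i h.
under eq_Rintegral do rewrite mul1r.
under [in RHS]eq_Rintegral do rewrite mul0r.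
by rewrite integral_partial// Rintegral_cst ?mul0r ?oppr0//; exact: measurable_eball.
Qed.

End compactly_supported.

Section squared_positive_part.
Context {R : realType}.

Lemma is_derive_sqpos (t : R) :
  is_derive t 1 (fun s : R => Num.max 0 s ^+ 2) (2 * Num.max 0 t).
Proof.
have [t0|t0|->] := ltgtP t 0.
- rewrite mulr0.
  apply: (@der_near _ _ (fun=> 0)); first by rewrite oner_eq0.
  near=> s; rewrite max_l ?expr0n//.
  by apply: ltW; near: s; exact: lt_nbhsl.
- apply: (@der_near R R (fun s : R => s ^+ 2)); first by rewrite oner_eq0.
    near=> s; rewrite max_r//.
    by apply: ltW; near: s; exact: lt_nbhsr.
  by have := derXn 1 t; rewrite expr1.
- rewrite mulr0.
  have cv : (fun h : R => h^-1 *: (((fun s : R => Num.max 0 s ^+ 2) \o shift 0) (h *: 1) -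
      Num.max 0 0 ^+ 2)) @ 0^' --> (0 : R).
    apply/cvgrPdist_le => e e0; near=> h.
    rewrite /= addr0 [h%:A]mulr1 maxxx expr0n subr0 sub0r normrN normrM normfV.
    have h0 : h != 0 by near: h; exact: nbhs_dnbhs_neq.
    rewrite ler_pdivrMl ?normr_gt0//.
    have hm : `|Num.max 0 h| <= `|h|.
      by case: (leP 0 h) => hh; rewrite ?normr0.
    rewrite normrX expr2 ler_pM// (le_trans hm)//.
    by near: h; exact: dnbhs0_le.
  apply: DeriveDef; first by apply/cvg_ex; exists 0.
  by apply/cvg_lim => //; exact: Rhausdorff.
Unshelve. all: by end_near. Qed.

(** A C1 approximation from below of the indicator of (0, +oo), vanishing on
  (-oo, e]. *)
Definition eta (e t : R) : R := Num.max 0 (t - e) ^+ 2 * t^-1 ^+ 2.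

Definition deta (e t : R) : R := 2 * Num.max 0 (t - e) * e * t^-1 ^+ 3.

Lemma is_derive_eta (e t : R) : 0 < t -> is_derive t 1 (eta e) (deta e t).
Proof.
move=> t0; have tn0 : t != 0 by rewrite gt_eqF.
have d1 := @derComp R R (fun s => Num.max 0 s ^+ 2) (fun t => t - e) t 1 _ _
  (is_derive_sqpos (t - e)) (derB (der_id t) (derC e t 1)).
have := derM d1 (derX 1 (@derV R R (fun t : R => t) t 1 1 tn0 (der_id t))).
move/is_derive_eq; apply; rewrite /deta.
have [te|te] := leP 0 (t - e); last by rewrite expr0n/=; ring.
by field.
Qed.

Lemma eta_le (e t : R) : t <= e -> eta e t = 0.
Proof. by move=> te; rewrite /eta max_l ?subr_le0// expr0n mul0r. Qed.

Lemma deta_le (e t : R) : t <= e -> deta e t = 0.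
Proof. by move=> te; rewrite /deta max_l ?subr_le0// mulr0 !mul0r. Qed.

Lemma eta_bound (e t : R) : 0 < e -> 0 <= t -> 0 <= eta e t <= 1.
Proof.
move=> e0 t0; have [te|te] := leP t e; first by rewrite eta_le// lexx ler01.
have t1 := lt_trans e0 te.
rewrite /eta max_r ?subr_ge0 ?(ltW te)// -exprMn.
have h : 0 <= (t - e) / t <= 1.
  by rewrite divr_ge0 ?subr_ge0 ?(ltW te)//= ler_pdivrMr// mul1r lerBlDr lerDl ltW.
by rewrite exprn_ge0 ?expr_le1//; case/andP: h.
Qed.

Lemma eta_approx (e t : R) : 0 < e -> 0 < t -> `|1 - eta e t| <= 2 * e / t.
Proof.
move=> e0 t0; have [te|te] := leP t e.
  rewrite eta_le// subr0 normr1 ler_pdivlMr// mul1r (le_trans te)// ler_peMl ?ler1n//.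
  exact: ltW.
rewrite /eta max_r ?subr_ge0 ?(ltW te)// exprVn.
have -> : 1 - (t - e) ^+ 2 / t ^+ 2 = (2 * e / t) * (1 - e / t / 2).
  by field; rewrite gt_eqF.
have h1 : 0 <= e / t <= 1.
  by rewrite divr_ge0 ?(ltW e0) ?(ltW t0)//= ler_pdivrMr// mul1r ltW.
rewrite normrM ger0_norm ?divr_ge0 ?mulr_ge0 ?(ltW e0) ?(ltW t0)//.
rewrite ler_piMr ?divr_ge0 ?mulr_ge0 ?(ltW e0) ?(ltW t0)// ler_norml.
by move: h1; move: (e / t) => z; lra.
Qed.

Lemma deta_approx (e t : R) : 0 < e -> 0 < t -> `|deta e t * t| <= 2 * e / t.
Proof.
move=> e0 t0; have [te|te] := leP t e.
  by rewrite deta_le// mul0r normr0 divr_ge0 ?mulr_ge0 ?(ltW e0) ?(ltW t0).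
rewrite /deta max_r ?subr_ge0 ?(ltW te)// exprVn.
have -> : 2 * (t - e) * e / t ^+ 3 * t = (2 * e / t) * (1 - e / t).
  by field; rewrite gt_eqF.
have h1 : 0 <= e / t <= 1.
  by rewrite divr_ge0 ?(ltW e0) ?(ltW t0)//= ler_pdivrMr// mul1r ltW.
rewrite normrM ger0_norm ?divr_ge0 ?mulr_ge0 ?(ltW e0) ?(ltW t0)//.
rewrite ler_piMr ?divr_ge0 ?mulr_ge0 ?(ltW e0) ?(ltW t0)// ler_norml.
by move: h1; move: (e / t) => z; lra.
Qed.

(** t eta'(t) stays bounded and tends to 0 pointwise, so a flux which is O(weight) leaves
  no trace in the limit of the cutoffs. *)
Lemma deta_bound (e t : R) : 0 < e -> 0 <= t -> `|deta e t * t| <= 2.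
Proof.
move=> e0 t0; have [te|te] := leP t e; first by rewrite deta_le// mul0r normr0.
have t1 := lt_trans e0 te.
apply: (le_trans (deta_approx e0 t1)).
by rewrite ler_pdivrMr// ler_pM2l// ltW.
Qed.

Lemma continuous_eta (e t : R) : 0 < t -> {for t, continuous (eta e)}.
Proof. by move=> t0; exact: der_continuous (is_derive_eta e t0). Qed.

Lemma continuous_deta (e t : R) : 0 < t -> {for t, continuous (deta e)}.
Proof.
move=> t0; apply: ctM; last by apply: ctX; apply: ctV; [rewrite gt_eqF|exact: cvg_id].
apply: ctM; last exact: ctC.
apply: ctM; first exact: ctC.
have cm : continuous (fun s : R => Num.max 0 s).
  apply: (@max_fun_continuous _ R R (cst 0) id) => s; [exact: cvg_cst|exact: cvg_id].
apply: (@ctComp _ _ (fun s => Num.max 0 s)); first exact: cm.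
by apply: ctB; [exact: cvg_id|exact: ctC].
Qed.

End squared_positive_part.

Section cutoff.
Context {R : realType} {N : nat}.
Implicit Types (x : 'rV[R]_N) (f : 'rV[R]_N -> R).
Local Notation basis i := (delta_mx 0 i : 'rV[R]_N).
Local Notation D := (@eball R N 1).
Local Notation mu := (lebesgue_rV R N).

Definition cutoff (j : nat) x : R := eta j.+1%:R^-1 (weight x).

Definition dcut (j : nat) (i : 'I_N) x : R :=
  deta j.+1%:R^-1 (weight x) * ((1 - 2 * sqnorm x) * (2 * x 0 i)).

Let e0 (j : nat) : 0 < j.+1%:R^-1 :> R. Proof. by rewrite invr_gt0. Qed.

Lemma is_derive_cut j i x : 0 < weight x -> is_derive x (basis i) (cutoff j) (dcut j i x).
Proof. by move=> bx; exact: derComp (is_derive_eta _ bx) (is_derive_weight x i). Qed.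

Lemma cut_continuous j x : 0 < weight x -> {for x, continuous (cutoff j)}.
Proof.
move=> bx; apply: (@ctComp _ _ (eta _)); [exact: continuous_eta|exact: continuous_weight].
Qed.

Lemma dcut_continuous j i x : 0 < weight x -> {for x, continuous (dcut j i)}.
Proof.
move=> bx; apply: ctM.
  by apply: (@ctComp _ _ (deta _)); [exact: continuous_deta|exact: continuous_weight].
apply: ctM; last by apply: ctM; [exact: ctC|exact: continuous_coord].
by apply: ctB; [exact: ctC|apply: ctM; [exact: ctC|exact: continuous_sqnorm]].
Qed.

Lemma cut_bound j x : D x -> 0 <= cutoff j x <= 1.
Proof.
move=> Dx; apply: eta_bound => //.
by case: (ball_cases Dx) => [->|/ltW//]; rewrite weight0.
Qed.

Lemma cut_cvg x : 0 < weight x -> cutoff j x @[j --> \oo] --> (1 : R).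
Proof.
move=> bx; apply/cvgrPdist_le => e ep.
have h : 0 < e * weight x / 2 by rewrite divr_gt0// mulr_gt0.
have /cvgrPdist_le /(_ _ h) := @cvg_harmonic R.
apply: filterS => j; rewrite sub0r normrN ger0_norm ?invr_ge0// => hj.
apply: (le_trans (eta_approx (e0 j) bx)); rewrite ler_pdivrMr//.
by rewrite mulrC -ler_pdivlMr.
Qed.

Lemma dcut_cvg x : 0 < weight x -> deta j.+1%:R^-1 (weight x) * weight x @[j --> \oo] --> (0 : R).
Proof.
move=> bx; apply/cvgrPdist_le => e ep.
have h : 0 < e * weight x / 2 by rewrite divr_gt0// mulr_gt0.
have /cvgrPdist_le /(_ _ h) := @cvg_harmonic R.
apply: filterS => j; rewrite sub0r normrN ger0_norm ?invr_ge0// => hj.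
rewrite sub0r normrN; apply: (le_trans (deta_approx (e0 j) bx)); rewrite ler_pdivrMr//.
by rewrite mulrC -ler_pdivlMr.
Qed.

Let support j : set 'rV[R]_N := [set x | j.+1%:R^-1 <= weight x].

Let support_sub j : support j `<=` D.
Proof. by move=> x hx; apply: weight_gt0_ball; exact: lt_le_trans hx. Qed.

Let compact_support j : compact (support j).
Proof.
apply: (@subclosed_compact _ _ (box N 1)); last 2 first.
- exact: compact_box.
- by move=> x /support_sub /eball_sub_box.
apply: (@closed_comp _ _ weight [set t | j.+1%:R^-1 <= t]); last exact: closed_ge.
by move=> x _; exact: continuous_weight.
Qed.

Let near_weight_gt x (a : R) : a < weight x -> \forall y \near x, a < weight y.
Proof.
move=> h; have : nbhs (weight x) [set t | a < t] by exact: lt_nbhsr.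
by move=> /(@continuous_weight R N x).
Qed.

Let near_weight_lt x (a : R) : weight x < a -> \forall y \near x, weight y < a.
Proof.
move=> h; have : nbhs (weight x) [set t | t < a] by exact: lt_nbhsl.
by move=> /(@continuous_weight R N x).
Qed.

Let near_zero j x (g h : 'rV[R]_N -> R) i : weight x < j.+1%:R^-1 ->
  \forall y \near x, cutoff j y * g y + dcut j i y * h y = 0.
Proof.
move=> /near_weight_lt; apply: (@filterS _ (nbhs x) (nbhs_filter x)) => y /ltW by_.
by rewrite /cutoff /dcut eta_le// deta_le// !mul0r addr0.
Qed.

Definition punctured_C1 f (df : 'I_N -> 'rV[R]_N -> R) : Prop :=
  forall x, 0 < weight x -> forall i,
    is_derive x (basis i) f (df i x) /\ {for x, continuous (df i)}.

Lemma punctured_C1_continuous f df x : punctured_C1 f df -> 0 < weight x ->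
  {for x, continuous f}.
Proof.
move=> hf bx; apply: (@partials_continuous _ _ _ df); last first.
  by move=> i; exact: (hf _ bx i).2.
apply: (@filterS _ (nbhs x) (nbhs_filter x) _ _ _ (near_weight_gt bx)) => y by_ i.
exact: (hf _ by_ i).1.
Qed.

Lemma cutoff_continuous j f : (forall x, 0 < weight x -> {for x, continuous f}) ->
  continuous (fun x => cutoff j x * f x).
Proof.
move=> cf x; have [bx|bx] := ltP 0 (weight x).
  by apply: ctM; [exact: cut_continuous|exact: cf].
have bx' := le_lt_trans bx (e0 j).
apply: (@ct_near _ _ (fun=> 0)); last exact: ctC.
apply: (@filterS _ (nbhs x) (nbhs_filter x) _ _ _ (near_weight_lt bx')) => y /ltW by_.
by rewrite /cutoff eta_le// mul0r.
Qed.

Lemma cutoff_C1c j f df : punctured_C1 f df ->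
  C1c D (fun x => cutoff j x * f x) /\
  forall i, partial i (fun x => cutoff j x * f x) = (fun x => cutoff j x * df i x + dcut j i x * f x).
Proof.
move=> hf; apply: (@C1c_intro _ _ _ (fun i x => cutoff j x * df i x + dcut j i x * f x)
  (support j)).
- move=> i x; have [bx|bx] := ltP 0 (weight x).
    exact: derM (is_derive_cut j i bx) (hf _ bx i).1.
  have bx' := le_lt_trans bx (e0 j).
  apply: (@der_near _ _ (fun=> 0)); first exact: basis_neq0.
    apply: (@filterS _ (nbhs x) (nbhs_filter x) _ _ _ (near_weight_lt bx')) => y /ltW by_.
    by rewrite /cutoff eta_le// mul0r.
  rewrite (nbhs_singleton (near_zero (df i) f i bx')); exact: derC.
- move=> i x; have [bx|bx] := ltP 0 (weight x).
    apply: (@ctD _ _ (fun x => cutoff j x * df i x) (fun x => dcut j i x * f x)); apply: ctM.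
    + exact: cut_continuous.
    + exact: (hf _ bx i).2.
    + exact: dcut_continuous.
    + exact: punctured_C1_continuous hf bx.
  have bx' := le_lt_trans bx (e0 j).
  apply: (@ct_near _ _ (fun=> 0)); last exact: ctC.
  have := near_zero (df i) f i bx'.
  by apply: (@filterS _ (nbhs x) (nbhs_filter x)) => y ->.
- exact: compact_support.
- exact: support_sub.
- move=> x /negP; rewrite -ltNge => /ltW bx; by rewrite /cutoff eta_le// mul0r.
Qed.

(** A pointwise limit of continuous cutoffs. *)
Lemma punctured_measurable f : (forall x, 0 < weight x -> {for x, continuous f}) ->
  f 0 = 0 -> measurable_fun D f.
Proof.
move=> cf f0; apply: (@measurable_fun_cvg _ _ _ D (fun j x => cutoff j x * f x)).
  by move=> j; apply: measurable_funTS; apply: continuous_measurable_rV; exact: cutoff_continuous.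
move=> x /ball_cases[->|bx].
  by rewrite f0; under eq_fun do rewrite mulr0; exact: cvg_cst.
by rewrite -[X in _ --> X]mul1r; apply: cvgM; [exact: cut_cvg|exact: cvg_cst].
Qed.

End cutoff.

(** * Green's formula on the punctured ball *)
Section integral_sums.
Context d (T : measurableType d) (R : realType) (mu : {measure set T -> \bar R}).
Variable D : set T.
Hypothesis mD : measurable D.

Lemma integrable_Radd (f g : T -> R) : mu.-integrable D (EFin \o f) ->
  mu.-integrable D (EFin \o g) -> mu.-integrable D (EFin \o (fun x => f x + g x)).
Proof.
move=> intf intg.
have -> : EFin \o (fun x => f x + g x) = ((EFin \o f) \+ (EFin \o g))%E by apply/funext.
exact: integrableD.
Qed.

Lemma integrable_Rsum (I : Type) (r : seq I) (f : I -> T -> R) :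
  (forall i, mu.-integrable D (EFin \o f i)) ->
  mu.-integrable D (EFin \o (fun x => \sum_(i <- r) f i x)).
Proof.
move=> intf; elim: r => [|i r ih].
  rewrite (_ : _ \o _ = cst 0%E); first exact: integrable0.
  by apply/funext => x /=; rewrite big_nil.
have -> : EFin \o (fun x => \sum_(j <- i :: r) f j x) =
    ((EFin \o f i) \+ (EFin \o (fun x => \sum_(j <- r) f j x)%R))%E.
  by apply/funext => x /=; rewrite big_cons.
exact: integrableD.
Qed.

Lemma Rintegral_sum (I : Type) (r : seq I) (f : I -> T -> R) :
  (forall i, mu.-integrable D (EFin \o f i)) ->
  \int[mu]_(x in D) (\sum_(i <- r) f i x) = \sum_(i <- r) \int[mu]_(x in D) f i x.
Proof.
move=> intf; elim: r => [|i r ih].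
  by under eq_Rintegral do rewrite big_nil; rewrite big_nil Rintegral_cst// mul0r.
rewrite big_cons -ih -RintegralD//; last exact: integrable_Rsum.
by under eq_Rintegral do rewrite big_cons.
Qed.

End integral_sums.

Section green.
Context {R : realType} {N : nat}.
Implicit Types (x : 'rV[R]_N) (f g phi : 'rV[R]_N -> R).
Local Notation basis i := (delta_mx 0 i : 'rV[R]_N).
Local Notation D := (@eball R N 1).
Local Notation mu := (lebesgue_rV R N).

Let mD : measurable D. Proof. exact: measurable_eball. Qed.

(** Cutting such a function off near 0 costs nothing in the limit, as the quadratic bound
  compensates for the gradient of the cutoff. *)
Definition tame f (df : 'I_N -> 'rV[R]_N -> R) : Prop :=
  punctured_C1 f df /\ exists2 C, 0 <= C & forall x, D x -> `|f x| <= C * sqnorm x.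

Definition small f : Prop :=
  (forall x, 0 < weight x -> {for x, continuous f}) /\
  exists2 C, 0 <= C & forall x, D x -> `|f x| <= C * sqnorm x.

Lemma tame_small f df : tame f df -> small f.
Proof. by move=> [h1 h2]; split => // x wx; exact: punctured_C1_continuous h1 wx. Qed.

Lemma ball0 : D 0. Proof. by apply/eball1E; rewrite sqnorm0. Qed.

Lemma small0 f : small f -> f 0 = 0.
Proof.
move=> [_ [C _ h]]; have := h _ ball0; rewrite sqnorm0 mulr0 normr_le0.
by move/eqP.
Qed.

Lemma small_measurable f : small f -> measurable_fun D f.
Proof. by move=> hf; apply: punctured_measurable; [case: hf|exact: small0]. Qed.

Lemma small_bound f : small f -> exists2 C, 0 <= C & forall x, D x -> `|f x| <= C.
Proof.
move=> [_ [C C0 h]]; exists C => // x Dx; apply: (le_trans (h x Dx)).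
by rewrite ler_piMr// ltW//; exact/eball1E.
Qed.

Lemma small_L2 f : small f -> in_L2 D f.
Proof.
move=> hf; have [C _ hC] := small_bound hf.
exact: (in_L2_bounded (small_measurable hf) hC).
Qed.

Lemma C1c_L2 phi : C1c D phi -> in_L2 D phi.
Proof.
move=> h; have [C _ hC] := C1c_bound h.
apply: (@in_L2_bounded _ _ _ C) => //; apply: measurable_funTS.
by apply: continuous_measurable_rV; exact: C1c_continuous.
Qed.

Lemma C1c_partial_L2 phi i : C1c D phi -> in_L2 D (partial i phi).
Proof.
move=> h; have [C _ hC] := C1c_partial_bound i h.
apply: (@in_L2_bounded _ _ _ C) => //; apply: measurable_funTS.
by apply: continuous_measurable_rV; case: h.
Qed.

Lemma dcut_bound (j : nat) x (C a : R) : D x -> 0 <= C -> `|a| <= C * weight x ->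
  `|deta j.+1%:R^-1 (weight x) * ((1 - 2 * sqnorm x) * (2 * a))| <= 4 * C.
Proof.
move=> Dx C0 ha; have w0 : 0 <= weight x.
  by case: (ball_cases Dx) => [->|/ltW//]; rewrite weight0.
have j0 : 0 < j.+1%:R^-1 :> R by rewrite invr_gt0.
have db := deta_bound j0 w0.
have s1 : `|1 - 2 * sqnorm x| <= 1.
  have := sqnorm_ge0 x; have /eball1E := Dx; rewrite ler_norml.
  by move: (sqnorm x) => s; lra.
move: db; move: (deta _ _) => d db; rewrite !normrM; set e := `|d|.
have he : e * weight x <= 2.
  by move: db; rewrite normrM (ger0_norm w0).
apply: (@le_trans _ _ (e * (1 * (2 * (C * weight x))))).
  apply: ler_wpM2l; first exact: normr_ge0.
  apply: ler_pM => //.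
  by rewrite (ger0_norm (ler0n _ 2)); apply: ler_wpM2l.
rewrite mul1r (_ : e * _ = (e * weight x) * (2 * C)); last by ring.
rewrite (_ : 4 * C = 2 * (2 * C)); last by ring.
by rewrite ler_wpM2r// mulr_ge0.
Qed.

(** Green's formula for a field whose flux through the sphere of radius r tends to
  0 as r -> 0 and r -> 1: apply the definition of the weak gradient to the
  components of the field cut off near 0 and near the unit sphere. *)
Lemma green (F : 'I_N -> 'rV[R]_N -> R) (dF : 'I_N -> 'I_N -> 'rV[R]_N -> R) g (Cn : R)
    phi (Phi : 'I_N -> 'rV[R]_N -> R) :
  (forall i, tame (F i) (dF i)) -> small g ->
  (forall x, 0 < weight x -> \sum_i dF i i x = g x) ->
  0 <= Cn -> (forall x, D x -> `|\sum_i x 0 i * F i x| <= Cn * weight x) ->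
  H1_grad D phi Phi ->
  \int[mu]_(x in D) (dot F Phi x + g x * phi x) = 0.
Proof.
move=> hF hg divF Cn0 flux [phi2 Phi2 wphi].
have psi j i := cutoff_C1c j (hF i).1.
pose psij j (i : 'I_N) x := cutoff j x * F i x.
pose I j (i : 'I_N) x := phi x * partial i (psij j i) x + Phi i x * psij j i x.
have intI1 j i : mu.-integrable D (EFin \o (fun x => phi x * partial i (psij j i) x)).
  by apply: in_L2_integrableM => //; apply: C1c_partial_L2; exact: (psi j i).1.
have intI2 j i : mu.-integrable D (EFin \o (fun x => Phi i x * psij j i x)).
  by apply: in_L2_integrableM => //; apply: C1c_L2; exact: (psi j i).1.
have intI j i : mu.-integrable D (EFin \o I j i) by exact: integrable_Radd.
have I0 j : \int[mu]_(x in D) (\sum_i I j i x) = 0.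
  rewrite Rintegral_sum// big1// => i _; rewrite RintegralD//.
  by rewrite (wphi _ i (psi j i).1) addNr.
pose S x := \sum_i x 0 i * F i x.
pose kappa j x := deta j.+1%:R^-1 (weight x) * ((1 - 2 * sqnorm x) * (2 * S x)).
have F0 i : F i 0 = 0 by exact: small0 (tame_small (hF i)).
have IE j x : D x -> \sum_i I j i x =
    cutoff j x * (dot F Phi x + g x * phi x) + phi x * kappa j x.
  move=> Dx; have -> : \sum_i I j i x = \sum_i
      (phi x * (cutoff j x * dF i i x) + (phi x * dcut j i x * F i x + cutoff j x * (F i x * Phi i x))).
    apply: eq_bigr => i _; rewrite /I /psij (psi j i).2.
    by move: (F i x) (Phi i x) (dF i i x) (cutoff j x) (dcut j i x) (phi x) => *; ring.
  rewrite !big_split/= -!mulr_sumr -/(dot F Phi x).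
  have -> : \sum_i phi x * dcut j i x * F i x = phi x * kappa j x.
    rewrite /kappa /S /dcut; move: (deta _ _) (sqnorm x) => a s.
    rewrite !mulr_sumr; apply: eq_bigr => i _.
    by move: (F i x) (phi x) (x 0 i) => *; ring.
  have -> : cutoff j x * \sum_i dF i i x = cutoff j x * g x.
    case: (ball_cases Dx) => [->|/divF -> //].
    by rewrite (small0 hg) mulr0 /cutoff weight0 eta_le ?mul0r// invr_ge0.
  by move: (dot F Phi x) (g x) (phi x) (cutoff j x) (kappa j x) => *; ring.
have kb j x : D x -> `|kappa j x| <= 4 * Cn.
  by move=> Dx; apply: dcut_bound => //; exact: flux.
have intFPhi : mu.-integrable D (EFin \o (fun x => dot F Phi x + g x * phi x)).
  apply: integrable_Radd => //.
    apply: integrable_Rsum => // i; apply: in_L2_integrableM => //.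
    exact: small_L2 (tame_small (hF i)).
  by apply: in_L2_integrableM => //; exact: small_L2.
have intphi : mu.-integrable D (EFin \o (fun x => 4 * Cn * `|phi x|)).
  have := integrableZl mD (4 * Cn) (integrable_abse (integrable_in_L2 phi2)).
  by [].
have : \int[mu]_(x in D) (\sum_i I j i x) @[j --> \oo] -->
    \int[mu]_(x in D) (dot F Phi x + g x * phi x).
  apply: (@Rintegral_dominated_cvg _ _ _ mu D _ _
    (fun x => `|dot F Phi x + g x * phi x| + 4 * Cn * `|phi x|)) => //.
  - move=> j; have := integrable_Rsum mD (index_enum 'I_N) (intI j).
    by move=> /measurable_int /measurable_EFinP.
  - by apply: integrable_Radd => //; have := integrable_abse intFPhi.
  - move=> x Dx; have -> : (fun j => \sum_i I j i x) =
        (fun j => cutoff j x * (dot F Phi x + g x * phi x) + phi x * kappa j x).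
      by apply/funext => j; exact: IE.
    rewrite -[X in _ --> X]addr0; apply: cvgD.
      case: (ball_cases Dx) => [->|wx].
        have -> : dot F Phi 0 + g 0 * phi 0 = 0.
          rewrite (small0 hg) mul0r addr0 /dot big1// => i _; by rewrite F0 mul0r.
        rewrite (_ : (fun j => _) = cst 0); first exact: cvg_cst.
        by apply/funext => j; rewrite mulr0.
      by rewrite -[X in _ --> X]mul1r; apply: cvgM; [exact: cut_cvg|exact: cvg_cst].
    rewrite -[X in _ --> X](mulr0 (phi x)); apply: cvgM; first exact: cvg_cst.
    case: (ball_cases Dx) => [->|wx].
      rewrite /kappa /S big1 => [|i _]; last by rewrite F0 mulr0.
      rewrite (_ : (fun j => _) = cst 0); first exact: cvg_cst.
      by apply/funext => j; rewrite !mulr0.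
    have -> : (fun j => kappa j x) = (fun j => (deta j.+1%:R^-1 (weight x) * weight x) *
        ((1 - 2 * sqnorm x) * (2 * S x) / weight x)).
      apply/funext => j; rewrite /kappa; move: (deta _ _) (S x) (sqnorm x) => a b s.
      by field; rewrite gt_eqF.
    by rewrite -[X in _ --> X](mul0r ((1 - 2 * sqnorm x) * (2 * S x) / weight x));
      apply: cvgM; [exact: dcut_cvg|exact: cvg_cst].
  - move=> j x Dx; rewrite IE//; apply: (le_trans (ler_normD _ _)).
    rewrite (normrM (cutoff j x)) (normrM (phi x)) lerD//.
      have /andP[c0 c1] := cut_bound j Dx.
      by rewrite ler_piMl// ger0_norm.
    by rewrite mulrC ler_wpM2r// kb.
rewrite (_ : (fun j => _) = cst 0); last by apply/funext.
by move=> h; exact: (cvg_unique (@Rhausdorff R) h (cvg_cst _)).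
Qed.

(** The constant function 1 is an admissible test function in Green's formula. *)
Lemma green1 (F : 'I_N -> 'rV[R]_N -> R) (dF : 'I_N -> 'I_N -> 'rV[R]_N -> R) g (Cn : R) :
  (forall i, tame (F i) (dF i)) -> small g ->
  (forall x, 0 < weight x -> \sum_i dF i i x = g x) ->
  0 <= Cn -> (forall x, D x -> `|\sum_i x 0 i * F i x| <= Cn * weight x) ->
  \int[mu]_(x in D) g x = 0.
Proof.
move=> hF hg divF Cn0 flux; have := green hF hg divF Cn0 flux H1_one.
under eq_Rintegral.
  move=> x _; rewrite /dot big1 ?add0r ?mulr1; last by move=> i _; rewrite mulr0.
  over.
by [].
Qed.

(** The factor phi supplies the decay at the sphere that the other factor lacks. *)
Lemma small_mul_C1c f phi : small f -> C1c D phi ->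
  small (fun x => f x * phi x) /\
  exists2 C, 0 <= C & forall x, D x -> `|f x * phi x| <= C * weight x.
Proof.
move=> [cf [C C0 fC]] h; have [C1 C10 hC1] := C1c_bound h.
have [C2 C20 hC2] := C1c_boundary_decay h.
split; [split|].
- move=> x wx; apply: ctM; first exact: cf.
  exact: C1c_continuous.
- exists (C * C1); first exact: mulr_ge0.
  by move=> x Dx; rewrite normrM mulrAC ler_pM// fC.
- exists (C * C2); first exact: mulr_ge0.
  move=> x Dx; rewrite normrM /weight.
  rewrite (_ : C * C2 * _ = (C * sqnorm x) * (C2 * (1 - sqnorm x))); last by ring.
  by rewrite ler_pM// ?fC ?hC2.
Qed.

Lemma tame_mul_C1c f df phi : tame f df -> C1c D phi ->
  tame (fun x => f x * phi x) (fun i x => f x * partial i phi x + df i x * phi x).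
Proof.
move=> hf h; have := small_mul_C1c (tame_small hf) h; move=> [[_ hC] _]; split => // x wx i.
have [d1 c1] := hf.1 x wx i; split; first exact: derM d1 (C1c_derive i x h).
apply: (@ctD _ _ (fun x => f x * partial i phi x)); apply: ctM.
- exact: punctured_C1_continuous hf.1 wx.
- by case: h => _ + _; exact.
- exact: c1.
- exact: C1c_continuous.
Qed.

Lemma small_sum (I : finType) (f : I -> 'rV[R]_N -> R) : (forall i, small (f i)) ->
  small (fun x => \sum_i f i x).
Proof.
move=> hf; split; first by move=> x wx; apply: ctSum => i; exact: (hf i).1.
have /choice[C hC] : forall i, exists C, 0 <= C /\ forall x, D x -> `|f i x| <= C * sqnorm x.
  by move=> i; have [_ [C C0 hC]] := hf i; exists C.
exists (\sum_i C i); first by apply: sumr_ge0 => i _; case: (hC i).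
move=> x Dx; rewrite mulr_suml (le_trans (ler_norm_sum _ _ _))//.
by apply: ler_sum => i _; case: (hC i) => _; exact.
Qed.

Lemma small_add f g : small f -> small g -> small (fun x => f x + g x).
Proof.
move=> [cf [C C0 hC]] [cg [C' C'0 hC']]; split.
  by move=> x wx; apply: ctD; [exact: cf|exact: cg].
exists (C + C'); first exact: addr_ge0.
move=> x Dx; rewrite mulrDl (le_trans (ler_normD _ _))// lerD ?hC ?hC'//.
Qed.

Lemma small_mul_partial f phi i : small f -> C1c D phi ->
  small (fun x => f x * partial i phi x).
Proof.
move=> [cf [C C0 fC]] h; have [C1 C10 hC1] := C1c_partial_bound i h.
split.
  move=> x wx; apply: ctM; first exact: cf.
  by case: h => _ + _; exact.
exists (C * C1); first exact: mulr_ge0.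
by move=> x Dx; rewrite normrM mulrAC ler_pM// ?fC ?hC1.
Qed.

Lemma tame_H1 u (du : 'I_N -> 'rV[R]_N -> R) : tame u du -> (forall i, small (du i)) ->
  H1_grad D u du.
Proof.
move=> hu hdu; split => [|i|phi i h]; first exact: small_L2 (tame_small hu).
  exact: small_L2.
have s1 := small_mul_partial i (tame_small hu) h.
have [s2 _] := small_mul_C1c (hdu i) h.
have [_ [C C0 hC]] := small_mul_C1c (tame_small hu) h.
have up := tame_mul_C1c hu h.
have : \int[mu]_(x in D) (u x * partial i phi x + du i x * phi x) = 0.
  apply: (@green1 (fun k x => (k == i)%:R * (u x * phi x))
    (fun k l x => (k == i)%:R * (u x * partial l phi x + du l x * phi x)) _ C) => //.
  - move=> k; split.
      move=> x wx l; have [d1 c1] := up.1 x wx l; split; first exact: derMc.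
      by apply: ctM => //; exact: ctC.
    have [_ [C1 C10 hC1]] := up; exists C1 => // x Dx; rewrite normrM.
    apply: le_trans (hC1 x Dx); rewrite ler_piMl//.
    by case: (k == i); rewrite ?normr1 ?normr0.
  - exact: small_add.
  - move=> x wx; rewrite (bigD1 i)//= eqxx mul1r big1 ?addr0// => k ki.
    by rewrite (negbTE ki) mul0r.
  - move=> x Dx; rewrite (bigD1 i)//= eqxx mul1r big1 ?addr0 => [|k ki]; last first.
      by rewrite (negbTE ki) mul0r mulr0.
    rewrite normrM; apply: le_trans (hC x Dx); rewrite ler_piMl//.
    by rewrite (le_trans (coord_le_enorm x i))// ltW.
rewrite RintegralD//; first by move/eqP; rewrite addr_eq0 => /eqP.
- by apply: in_L2_integrableM; [exact: small_L2 (tame_small hu)|exact: C1c_partial_L2].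
- by apply: in_L2_integrableM; [exact: small_L2|exact: C1c_L2].
Qed.

(** The fields F_k phi have no flux through the sphere, because phi vanishes near it. *)
Lemma tame_weak_div (F : 'I_N -> 'rV[R]_N -> R) (dF : 'I_N -> 'I_N -> 'rV[R]_N -> R) g :
  (forall i, tame (F i) (dF i)) -> small g ->
  (forall x, 0 < weight x -> \sum_i dF i i x = g x) -> weak_div D F g.
Proof.
move=> hF hg divF; split => [i||phi h]; first exact: small_L2 (tame_small (hF i)).
  exact: small_L2.
have s1 : small (dot F (partial ^~ phi)).
  apply: small_sum => i; exact: small_mul_partial (tame_small (hF i)) h.
have [s2 _] := small_mul_C1c hg h.
have /choice[C hC] : forall i, exists C, 0 <= C /\
    forall x, D x -> `|F i x * phi x| <= C * weight x.
  by move=> i; have [_ [C C0 hC]] := small_mul_C1c (tame_small (hF i)) h; exists C.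
have : \int[mu]_(x in D) (dot F (partial ^~ phi) x + g x * phi x) = 0.
  apply: (@green1 (fun k x => F k x * phi x)
    (fun k l x => F k x * partial l phi x + dF k l x * phi x) _ (\sum_i C i)) => //.
  - by move=> k; exact: tame_mul_C1c.
  - exact: small_add.
  - by move=> x wx; rewrite big_split/= -mulr_suml divF.
  - by apply: sumr_ge0 => i _; case: (hC i).
  - move=> x Dx; rewrite mulr_suml (le_trans (ler_norm_sum _ _ _))//.
    apply: ler_sum => i _; rewrite normrM; case: (hC i) => _ /(_ x Dx); apply: le_trans.
    by rewrite ler_piMl// (le_trans (coord_le_enorm x i))// ltW.
rewrite RintegralD//; first by move/eqP; rewrite addr_eq0 => /eqP.
- apply: integrable_Rsum => // i; apply: in_L2_integrableM; last exact: C1c_partial_L2.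
  exact: small_L2 (tame_small (hF i)).
- by apply: in_L2_integrableM; [exact: small_L2|exact: C1c_L2].
Qed.

(** Zero trace: the functions cut off converge in H1 because the function vanishes
  to first order at the sphere, which compensates for the gradient of the cutoff. *)
Lemma tame_H10 w (dw : 'I_N -> 'rV[R]_N -> R) (C : R) : tame w dw -> (forall i, small (dw i)) ->
  0 <= C -> (forall x, D x -> `|w x| <= C * weight x) -> H10 D w.
Proof.
move=> hw hdw C0 wC; exists dw; first exact: tame_H1.
have cc j := cutoff_C1c j hw.1.
have w0 := small0 (tame_small hw).
exists (fun j x => cutoff j x * w x); split.
- by move=> j; exact: (cc j).1.
- have [C1 C10 hC1] := small_bound (tame_small hw).
  have -> : (fun j => normL2 D (w \- (fun x => cutoff j x * w x))) =
    (fun j => normL2 D (fun x => (1 - cutoff j x) * w x)).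
    by apply/funext => j; congr normL2; apply/funext => x /=; ring.
  apply: (@normL2_cvg0 _ _ _ C1).
  + move=> j; rewrite (_ : (fun x => _) = (w \- (fun x => cutoff j x * w x))).
      apply: measurable_funB; first exact: small_measurable (tame_small hw).
      by apply: measurable_funTS; apply: continuous_measurable_rV; exact: C1c_continuous (cc j).1.
    by apply/funext => x /=; ring.
  + move=> j x Dx; rewrite normrM; apply: le_trans (hC1 x Dx); rewrite ler_piMl//.
    by have /andP[? ?] := cut_bound j Dx; rewrite ger0_norm; lra.
  + move=> x /ball_cases[->|wx].
      rewrite w0 (_ : (fun j => _) = cst 0); first exact: cvg_cst.
      by apply/funext => j; rewrite mulr0.
    rewrite -[X in _ --> X](mul0r (w x)); apply: cvgM; last exact: cvg_cst.
    by rewrite -[X in _ --> X](subrr 1); apply: cvgB; [exact: cvg_cst|exact: cut_cvg].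
- move=> i; have [C1 C10 hC1] := small_bound (hdw i).
  have dw0 := small0 (hdw i).
  have -> : (fun j => normL2 D (dw i \- partial i (fun x => cutoff j x * w x))) =
    (fun j => normL2 D (fun x => (1 - cutoff j x) * dw i x - dcut j i x * w x)).
    by apply/funext => j; congr normL2; apply/funext => x /=; rewrite (cc j).2; ring.
  have dcutE j x : dcut j i x * w x =
      deta j.+1%:R^-1 (weight x) * ((1 - 2 * sqnorm x) * (2 * (x 0 i * w x))).
    by rewrite /dcut; move: (deta _ _) (sqnorm x) (w x) (x 0 i) => *; ring.
  have xw x : D x -> `|x 0 i * w x| <= C * weight x.
    move=> Dx; apply: le_trans (wC x Dx); rewrite normrM ler_piMl//.
    by rewrite (le_trans (coord_le_enorm x i))// ltW.
  apply: (@normL2_cvg0 _ _ _ (C1 + 4 * C)).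
  + move=> j; rewrite (_ : (fun x => _) = (dw i \- partial i (fun x => cutoff j x * w x))).
      apply: measurable_funB; first exact: small_measurable.
      by apply: measurable_funTS; apply: continuous_measurable_rV; case: (cc j) => -[].
    by apply/funext => x /=; rewrite (cc j).2; ring.
  + move=> j x Dx; apply: (le_trans (ler_normB _ _)); rewrite lerD//.
      rewrite normrM; apply: le_trans (hC1 x Dx); rewrite ler_piMl//.
      by have /andP[? ?] := cut_bound j Dx; rewrite ger0_norm; lra.
    by rewrite dcutE; apply: dcut_bound => //; exact: xw.
  + move=> x Dx; rewrite -[X in _ --> X](subrr 0); apply: cvgB.
      case: (ball_cases Dx) => [->|wx].
        rewrite dw0 (_ : (fun j => _) = cst 0); first exact: cvg_cst.
        by apply/funext => j; rewrite mulr0.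
      rewrite -[X in _ --> X](mul0r (dw i x)); apply: cvgM; last exact: cvg_cst.
      by rewrite -[X in _ --> X](subrr 1); apply: cvgB; [exact: cvg_cst|exact: cut_cvg].
    case: (ball_cases Dx) => [->|wx].
      rewrite w0 (_ : (fun j => _) = cst 0); first exact: cvg_cst.
      by apply/funext => j; rewrite mulr0.
    have -> : (fun j => dcut j i x * w x) = (fun j => (deta j.+1%:R^-1 (weight x) * weight x) *
        ((1 - 2 * sqnorm x) * (2 * (x 0 i * w x)) / weight x)).
      apply/funext => j; rewrite dcutE; move: (deta _ _) (sqnorm x) (x 0 i * w x) => a s b.
      by field; rewrite gt_eqF.
    rewrite -[X in _ --> X](mul0r ((1 - 2 * sqnorm x) * (2 * (x 0 i * w x)) / weight x)).
    by apply: cvgM; [exact: dcut_cvg|exact: cvg_cst].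
Qed.

Lemma tame_sub f df g dg : tame f df -> tame g dg ->
  tame (fun x => f x - g x) (fun i x => df i x - dg i x).
Proof.
move=> [hf [C C0 fC]] [hg [C' C'0 gC]]; split.
  move=> x wx i; have [d1 c1] := hf x wx i; have [d2 c2] := hg x wx i.
  by split; [exact: derB|exact: ctB].
exists (C + C'); first exact: addr_ge0.
by move=> x Dx; rewrite mulrDl (le_trans (ler_normB _ _))// lerD ?fC ?gC.
Qed.

Lemma small_sub f g : small f -> small g -> small (fun x => f x - g x).
Proof.
move=> [cf [C C0 hC]] [cg [C' C'0 hC']]; split.
  by move=> x wx; apply: ctB; [exact: cf|exact: cg].
exists (C + C'); first exact: addr_ge0.
by move=> x Dx; rewrite mulrDl (le_trans (ler_normB _ _))// lerD ?hC ?hC'.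
Qed.

(** Only the flux of the difference of the two fields has to vanish at the sphere. *)
Lemma tame_normal_trace (F G : 'I_N -> 'rV[R]_N -> R) (dF dG : 'I_N -> 'I_N -> 'rV[R]_N -> R)
    f g (C : R) :
  (forall i, tame (F i) (dF i)) -> (forall i, tame (G i) (dG i)) -> small f -> small g ->
  (forall x, 0 < weight x -> \sum_i dF i i x = f x) ->
  (forall x, 0 < weight x -> \sum_i dG i i x = g x) ->
  0 <= C -> (forall x, D x -> `|\sum_i x 0 i * (F i x - G i x)| <= C * weight x) ->
  eq_normal_trace D F f G g.
Proof.
move=> hF hG hf hg divF divG C0 flux phi Phi h; have [phi2 Phi2 _] := h.
have : \int[mu]_(x in D) (dot (fun i x => F i x - G i x) Phi x + (f x - g x) * phi x) = 0.
  apply: (@green _ (fun k l x => dF k l x - dG k l x) _ C) => //.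
  - by move=> i; exact: tame_sub.
  - exact: small_sub.
  - by move=> x wx; rewrite sumrB divF ?divG.
have int (H : 'I_N -> 'rV[R]_N -> R) (k : 'rV[R]_N -> R) : (forall i, small (H i)) -> small k ->
    mu.-integrable D (EFin \o (fun x => dot H Phi x + k x * phi x)).
  move=> hH hk; apply: integrable_Radd => //; last by apply: in_L2_integrableM => //; exact: small_L2.
  by apply: integrable_Rsum => // i; apply: in_L2_integrableM => //; exact: small_L2.
have -> : \int[mu]_(x in D) (dot (fun i x => F i x - G i x) Phi x + (f x - g x) * phi x) =
    \int[mu]_(x in D) ((dot F Phi x + f x * phi x) - (dot G Phi x + g x * phi x)).
  apply: eq_Rintegral => x _; rewrite /dot.
  under eq_bigr do rewrite mulrBl.
  by rewrite sumrB; move: (\sum_i _) (\sum_i _) => a b; ring.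
rewrite RintegralB//; first by move/eqP; rewrite subr_eq0 => /eqP.
- by apply: int => // i; exact: tame_small (hF i).
- by apply: int => // i; exact: tame_small (hG i).
Qed.

End green.

(** * Separated modes *)
Section continuity.
Context {T : topologicalType} {R : realType}.
Implicit Types f g : T -> R.

Lemma continuous_mul f g : continuous f -> continuous g -> continuous (fun x => f x * g x).
Proof. by move=> cf cg x; exact: ctM (cf x) (cg x). Qed.

Lemma continuous_add f g : continuous f -> continuous g -> continuous (fun x => f x + g x).
Proof. by move=> cf cg x; exact: ctD (cf x) (cg x). Qed.

Lemma continuous_sub f g : continuous f -> continuous g -> continuous (fun x => f x - g x).
Proof. by move=> cf cg x; exact: ctB (cf x) (cg x). Qed.

Lemma continuous_opp f : continuous f -> continuous (fun x => - f x).
Proof. by move=> cf x; exact: cvgN (cf x). Qed.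

Lemma continuous_scale c f : continuous f -> continuous (fun x => c * f x).
Proof. by apply: continuous_mul => x; exact: ctC. Qed.

Lemma continuous_divr f g : continuous f -> continuous g -> (forall x, g x != 0) ->
  continuous (fun x => f x / g x).
Proof. by move=> cf cg g0; apply: continuous_mul cf _ => x; exact: ctV (g0 x) (cg x). Qed.

End continuity.

Section harmonic_polynomials.
Context {R : realType} {p : nat}.
Implicit Types (x : 'rV[R]_p.+2) (a b : R).
Local Notation basis i := (delta_mx 0 i : 'rV[R]_p.+2).

Definition i0 : 'I_p.+2 := ord0.
Definition i1 : 'I_p.+2 := lift ord0 ord0.

(** a Re z^m + b Im z^m with z = x_0 + i x_1, by the multiplication formula for z z^m. *)
Fixpoint harm m a b x : R :=
  if m is m'.+1 then x 0 i0 * harm m' a b x + x 0 i1 * harm m' b (- a) x else a.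

Definition harm_grad m a b (i : 'I_p.+2) x : R :=
  if i == i0 then m%:R * harm m.-1 a b x
  else if i == i1 then m%:R * harm m.-1 b (- a) x else 0.

Definition harm_hess m a b (i l : 'I_p.+2) x : R :=
  if i == i0 then m%:R * harm_grad m.-1 a b l x
  else if i == i1 then m%:R * harm_grad m.-1 b (- a) l x else 0.

Lemma harmN m a b x : harm m (- a) (- b) x = - harm m a b x.
Proof. by elim: m a b => [//|m ih] a b /=; rewrite (ih a b) (ih b (- a)); ring. Qed.

Lemma is_derive_harm m a b i x :
  is_derive x (basis i) (harm m a b) (harm_grad m a b i x).
Proof.
elim: m a b => [|m ih] a b.
  rewrite /harm_grad !mul0r if_same if_same; exact: derC.
have := derD (derM (is_derive_coord x i0 i) (ih a b)) (derM (is_derive_coord x i1 i) (ih b (- a))).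
apply: der_eq => //; rewrite /harm_grad /= ![_ == i]eq_sym.
have [->|ni0] := eqVneq i i0.
  rewrite /= mul0r addr0 mul1r -[in RHS]addn1 natrD mulrDl mul1r addrC.
  case: m {ih} => [|m] /=; first by rewrite !mul0r !mulr0 !add0r.
  by move: (m.+1%:R) (harm m a b x) (harm m b (- a) x) (x 0 i0) (x 0 i1) => *; ring.
have [_|ni1] := eqVneq i i1; last by rewrite !mulr0 !mul0r !addr0.
rewrite mul0r addr0 mul1r -[in RHS]addn1 natrD mulrDl mul1r.
case: m {ih} => [|m] /=; first by rewrite !mul0r !mulr0 !add0r.
rewrite !harmN; move: (m.+1%:R) (harm m a b x) (harm m b (- a) x) (x 0 i0) (x 0 i1) => *; ring.
Qed.

Lemma is_derive_harm_grad m a b i l x :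
  is_derive x (basis l) (harm_grad m a b i) (harm_hess m a b i l x).
Proof.
rewrite /harm_grad /harm_hess; case: ifP => _; first exact: derMc (is_derive_harm _ _ _ _ _).
by case: ifP => _; [exact: derMc (is_derive_harm _ _ _ _ _)|exact: derC].
Qed.

Lemma sum_01 (f : 'I_p.+2 -> R) : (forall i, i != i0 -> i != i1 -> f i = 0) ->
  \sum_i f i = f i0 + f i1.
Proof.
move=> f0; rewrite (bigD1 i0)//= (bigD1 i1)//= big1 ?addr0// => i /andP[n0 n1].
exact: f0.
Qed.

Lemma harm_euler m a b x : \sum_i x 0 i * harm_grad m a b i x = m%:R * harm m a b x.
Proof.
rewrite sum_01 => [|i n0 n1]; last by rewrite /harm_grad (negbTE n0) (negbTE n1) mulr0.
by rewrite /harm_grad /=; case: m => [|m] /=; ring.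
Qed.

Lemma harm_laplace m a b x : \sum_i harm_hess m a b i i x = 0.
Proof.
rewrite sum_01 => [|i n0 n1]; last by rewrite /harm_hess (negbTE n0) (negbTE n1).
by rewrite /harm_hess /harm_grad /= harmN; ring.
Qed.

(** |z^m|^2 = |z|^(2m): harm m b (-a) is the harmonic conjugate, up to sign, of
  harm m a b. *)
Lemma harm_sq m a b x : harm m a b x ^+ 2 + harm m b (- a) x ^+ 2 =
  (a ^+ 2 + b ^+ 2) * (x 0 i0 ^+ 2 + x 0 i1 ^+ 2) ^+ m.
Proof.
elim: m a b => [|m ih] a b /=; first by ring.
rewrite (exprS _ m) harmN.
have -> : forall c d u v : R, (c * u + d * v) ^+ 2 + (c * v + d * - u) ^+ 2 =
  (c ^+ 2 + d ^+ 2) * (u ^+ 2 + v ^+ 2) by move=> *; ring.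
by rewrite ih; ring.
Qed.

Lemma harm_bound m a b x : a ^+ 2 + b ^+ 2 <= 1 -> `|harm m a b x| <= enorm x ^+ m.
Proof.
move=> ab; rewrite -(@ler_pXn2r _ 2)// ?nnegrE ?exprn_ge0 ?enorm_ge0//.
rewrite real_normK ?num_real// -exprM mulnC exprM enorm_sq.
apply: (@le_trans _ _ ((x 0 i0 ^+ 2 + x 0 i1 ^+ 2) ^+ m)).
  rewrite -[leRHS]mul1r.
  apply: (@le_trans _ _ ((a ^+ 2 + b ^+ 2) * (x 0 i0 ^+ 2 + x 0 i1 ^+ 2) ^+ m)).
    by rewrite -harm_sq lerDl sqr_ge0.
  by rewrite ler_wpM2r// exprn_ge0// addr_ge0// sqr_ge0.
rewrite lerXn2r ?nnegrE ?addr_ge0 ?sqr_ge0 ?sqnorm_ge0//.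
rewrite /sqnorm (bigD1 i0)//= (bigD1 i1)//= addrA lerDl.
by apply: sumr_ge0 => i _; exact: sqr_ge0.
Qed.

Lemma harm_grad_bound m a b i x : a ^+ 2 + b ^+ 2 <= 1 ->
  `|harm_grad m a b i x| <= m%:R * enorm x ^+ m.-1.
Proof.
move=> ab; have ba : b ^+ 2 + (- a) ^+ 2 <= 1 by rewrite sqrrN addrC.
rewrite /harm_grad; case: ifP => _; last case: ifP => _.
- by rewrite normrM (ger0_norm (ler0n _ m)) ler_wpM2l// harm_bound.
- by rewrite normrM (ger0_norm (ler0n _ m)) ler_wpM2l// harm_bound.
- by rewrite normr0 mulr_ge0// exprn_ge0// enorm_ge0.
Qed.

Lemma continuous_harm m a b : continuous (harm m a b).
Proof.
elim: m a b => [|m ih] a b x; first exact: ctC.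
change {for x, continuous (fun x : 'rV[R]_p.+2 => x 0 i0 * harm m a b x + x 0 i1 * harm m b (- a) x)}.
by apply: ctD; apply: ctM; [exact: continuous_coord|exact: ih|exact: continuous_coord|exact: ih].
Qed.

Lemma continuous_harm_grad m a b i : continuous (harm_grad m a b i).
Proof.
rewrite /harm_grad; case: (i == i0); last case: (i == i1); move=> x.
- by apply: (@ctM _ _ (fun=> m%:R)); [exact: ctC|exact: continuous_harm].
- by apply: (@ctM _ _ (fun=> m%:R)); [exact: ctC|exact: continuous_harm].
- exact: ctC.
Qed.

Lemma continuous_harm_hess m a b i l : continuous (harm_hess m a b i l).
Proof.
rewrite /harm_hess; case: (i == i0); last case: (i == i1); move=> x.
- by apply: (@ctM _ _ (fun=> m%:R)); [exact: ctC|exact: continuous_harm_grad].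
- by apply: (@ctM _ _ (fun=> m%:R)); [exact: ctC|exact: continuous_harm_grad].
- exact: ctC.
Qed.

End harmonic_polynomials.

Section mode_functions.
Context {R : realType} {p : nat} (m : nat) (a b : R).
Variables (sigma sigma1 q W Y : R -> R) (kappa : R).
Hypotheses (m3 : (3 <= m)%N) (ab : a ^+ 2 + b ^+ 2 <= 1).
Hypotheses (csigma : continuous sigma) (csigma1 : continuous sigma1) (cq : continuous q).
Hypothesis (sigma_gt0 : forall r, 0 < sigma r).
Hypothesis (dsigma : forall r : R, 0 < r < 1 -> is_derive r 1 sigma (sigma1 r)).
Hypotheses (cW : continuous W) (cY : continuous Y).
Hypothesis (dW : forall r : R, 0 < r < 1 -> is_derive r 1 W (Y r / sigma r)).
Hypothesis (dY : forall r : R, 0 < r < 1 -> is_derive r 1 Y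
  (- ((2 * m + p.+1)%:R * Y r + (m%:R * sigma1 r + kappa * r * q r) * W r) / r)).
Implicit Types x : 'rV[R]_p.+2.
Local Notation basis i := (delta_mx 0 i : 'rV[R]_p.+2).
Local Notation D := (@eball R p.+2 1).
Local Notation P := (@harm R p m a b).
Local Notation P1 := (@harm_grad R p m a b).
Local Notation P2 := (@harm_hess R p m a b).

Definition mode x : R := W (enorm x) * P x.

Definition mode_grad (i : 'I_p.+2) x : R :=
  Y (enorm x) / sigma (enorm x) * (x 0 i / enorm x) * P x + W (enorm x) * P1 i x.

(** The field sigma grad (mode), with sigma cancelled against the quotient Y / sigma. *)
Definition mode_flux (i : 'I_p.+2) x : R :=
  Y (enorm x) * (x 0 i / enorm x) * P x + sigma (enorm x) * W (enorm x) * P1 i x.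

Let dYr r : R := - ((2 * m + p.+1)%:R * Y r + (m%:R * sigma1 r + kappa * r * q r) * W r) / r.

Definition mode_dflux (i l : 'I_p.+2) x : R :=
  let r := enorm x in
  dYr r * (x 0 l / r) * (x 0 i / r) * P x
  + Y r * ((i == l)%:R / r - x 0 i * x 0 l / r ^+ 3) * P x
  + Y r * (x 0 i / r) * P1 l x
  + (sigma1 r * W r + Y r) * (x 0 l / r) * P1 i x + sigma r * W r * P2 i l x.

Lemma mode_fluxE i x : sigma (enorm x) * mode_grad i x = mode_flux i x.
Proof.
rewrite /mode_grad /mode_flux; have := sigma_gt0 (enorm x).
move: (sigma _) (_ / enorm x) (W _) (Y _) (P x) (P1 i x) => s *; field.
by rewrite gt_eqF.
Qed.

Let r01 x : 0 < weight x -> 0 < enorm x < 1.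
Proof.
move=> wx; rewrite enorm_gt0; move: wx (wx) => /weight_gt0_ball; rewrite weight_gt0 /eball/=.
by move=> -> /andP[->].
Qed.

Let derRad (g g' : R -> R) x i : (forall r : R, 0 < r < 1 -> is_derive r 1 g (g' r)) ->
  0 < weight x -> is_derive x (basis i) (fun x => g (enorm x)) (g' (enorm x) * (x 0 i / enorm x)).
Proof.
move=> dg /r01 hr; apply: derComp; first exact: dg.
by apply: is_derive_enorm; case/andP: hr.
Qed.

Let ctRad (g : R -> R) x : continuous g -> {for x, continuous (fun x : 'rV[R]_p.+2 => g (enorm x))}.
Proof. by move=> cg; apply: ctComp; [exact: cg|exact: continuous_enorm]. Qed.

Let derDir x i l : 0 < weight x -> is_derive x (basis l) (fun x => x 0 i / enorm x)
  ((i == l)%:R / enorm x - x 0 i * x 0 l / enorm x ^+ 3).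
Proof.
move=> /r01 /andP[r0 _]; have rn : enorm x != 0 by rewrite gt_eqF.
have := derM (is_derive_coord x i l) (derV rn (is_derive_enorm l r0)).
move/is_derive_eq; apply; move: (enorm x) rn (x 0 i) (x 0 l) ((i == l)%:R) => r rn *.
by field.
Qed.

Let ctInv x : 0 < weight x -> {for x, continuous (fun x : 'rV[R]_p.+2 => (enorm x)^-1)}.
Proof.
move=> /r01 /andP[r0 _]; apply: ctV; first by rewrite gt_eqF.
exact: continuous_enorm.
Qed.

Let ctDir x i : 0 < weight x -> {for x, continuous (fun x => x 0 i / enorm x)}.
Proof. by move=> wx; apply: ctM; [exact: continuous_coord|exact: ctInv]. Qed.

Let ratio_le1 x i : `|x 0 i / enorm x| <= 1.
Proof.
have := enorm_ge0 x; rewrite le_eqVlt => /predU1P[<-|r0]; first by rewrite invr0 mulr0 normr0.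
by rewrite normrM normfV (gtr0_norm r0) ler_pdivrMr// mul1r coord_le_enorm.
Qed.

Let pow_le (k : nat) x : D x -> (2 <= k)%N -> enorm x ^+ k <= sqnorm x.
Proof.
move=> Dx k2; rewrite -enorm_sq -(subnKC k2) exprD ler_piMr ?sqr_ge0//.
by rewrite exprn_ile1// ?enorm_ge0// ltW.
Qed.

Let rad_bound (g : R -> R) : continuous g -> exists2 C, 0 <= C &
  forall x : 'rV[R]_p.+2, D x -> `|g (enorm x)| <= C.
Proof.
move=> cg; have [C C0 hC] := compact_bound (@segment_compact R 0 1) cg.
exists C => // x Dx; apply: hC; rewrite /= in_itv/= enorm_ge0/=.
exact: ltW.
Qed.

Let P_le x : D x -> `|P x| <= sqnorm x.
Proof.
move=> Dx; apply: (le_trans (harm_bound m x ab)); apply: pow_le => //.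
exact: leq_trans m3.
Qed.

Let P1_le i x : D x -> `|P1 i x| <= m%:R * sqnorm x.
Proof.
move=> Dx; apply: (le_trans (harm_grad_bound m i x ab)); rewrite ler_wpM2l//.
by apply: pow_le => //; rewrite -ltnS prednK// ltnW// ltnW.
Qed.

Lemma mode_tame : tame mode mode_grad.
Proof.
split; last first.
  have [C C0 hC] := rad_bound cW; exists C => // x Dx.
  by rewrite /mode normrM ler_pM// ?hC ?P_le.
move=> x wx i; split.
  have := derM (derRad i dW wx) (is_derive_harm m a b i x).
  by move/is_derive_eq; apply; rewrite /mode_grad addrC.
apply: ctD; apply: ctM.
- apply: ctM; last exact: ctDir.
  apply: (@ctRad (fun r => Y r / sigma r)); apply: continuous_divr => // r.
  by rewrite gt_eqF.
- exact: continuous_harm.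
- exact: ctRad.
- exact: continuous_harm_grad.
Qed.

Lemma mode_grad_small i : small (mode_grad i).
Proof.
split; first by move=> x wx; exact: (mode_tame.1 x wx i).2.
have cYs : continuous (fun r => Y r / sigma r).
  by apply: continuous_divr => // r; rewrite gt_eqF.
have [C C0 hC] := rad_bound cW; have [C' C'0 hC'] := rad_bound cYs.
exists (C' + C * m%:R); first by rewrite addr_ge0// mulr_ge0.
move=> x Dx; rewrite mulrDl (le_trans (ler_normD _ _))// lerD//.
  rewrite normrM ler_pM ?P_le// normrM -[C']mulr1.
  by rewrite ler_pM// ?ratio_le1//; exact: hC'.
by rewrite normrM -mulrA ler_pM// ?hC ?P1_le.
Qed.

Lemma mode_flux_tame i : tame (mode_flux i) (mode_dflux i).
Proof.
have csW : continuous (fun r => sigma r * W r).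
  exact: continuous_mul.
split; last first.
  have [C C0 hC] := rad_bound csW; have [C' C'0 hC'] := rad_bound cY.
  exists (C' + C * m%:R); first by rewrite addr_ge0// mulr_ge0.
  move=> x Dx; rewrite mulrDl (le_trans (ler_normD _ _))// lerD//.
    rewrite normrM ler_pM ?P_le// normrM -[C']mulr1.
    by rewrite ler_pM// ?ratio_le1//; exact: hC'.
  by rewrite normrM -mulrA ler_pM// ?P1_le//; exact: hC.
move=> x wx l; have /andP[r0 r1] := r01 wx.
have dsW (r : R) : 0 < r < 1 -> is_derive r 1 (fun r => sigma r * W r) (sigma1 r * W r + Y r).
  move=> hr; have := derM (dsigma hr) (dW hr); move/is_derive_eq; apply.
  by have := sigma_gt0 r; move: (sigma r) => s s0; field; rewrite gt_eqF.
split.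
  have := derD (derM (derM (derRad l dY wx) (derDir i l wx)) (is_derive_harm m a b l x))
    (derM (derRad l dsW wx) (is_derive_harm_grad m a b i l x)).
  move/is_derive_eq; apply; rewrite /mode_dflux/= /dYr.
  move: (_ / enorm x) (_ / enorm x) (_ / enorm x - _) => *; ring.
have cdY : {for x, continuous (fun x : 'rV[R]_p.+2 => dYr (enorm x))}.
  apply: ctM; last exact: ctInv.
  apply: (@ctRad (fun r => - ((2 * m + p.+1)%:R * Y r + (m%:R * sigma1 r + kappa * r * q r) * W r))).
  apply: continuous_opp; apply: continuous_add; first exact: continuous_scale.
  apply: continuous_mul => //; apply: continuous_add; first exact: continuous_scale.
  by apply: continuous_mul => //; apply: continuous_scale => r; exact: cvg_id.
rewrite /mode_dflux/=; apply: ctD; last first.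
  by apply: ctM; [exact: (ctRad csW)|exact: continuous_harm_hess].
apply: ctD; last first.
  apply: ctM; last exact: continuous_harm_grad.
  apply: ctM; last exact: ctDir.
  apply: (@ctRad (fun r => sigma1 r * W r + Y r)).
  by apply: continuous_add => //; exact: continuous_mul.
apply: ctD; last first.
  apply: ctM; last exact: continuous_harm_grad.
  by apply: ctM; [exact: ctRad|exact: ctDir].
apply: ctD; last first.
  apply: ctM; last exact: continuous_harm.
  apply: ctM; first exact: ctRad.
  apply: ctB; first by apply: ctM; [exact: ctC|exact: ctInv].
  apply: ctM; first by apply: ctM; exact: continuous_coord.
  apply: ctV; first by rewrite expf_neq0// gt_eqF.
  by apply: ctX; exact: continuous_enorm.
apply: ctM; last exact: continuous_harm.
apply: ctM; last exact: ctDir.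
by apply: ctM; [exact: cdY|exact: ctDir].
Qed.

(** The divergence of the flux, by the radial equation. *)
Definition mode_div x : R := - (kappa * q (enorm x) * mode x).

Lemma mode_div_small : small mode_div.
Proof.
have ckq : continuous (fun r => - kappa * q r) by exact: continuous_scale.
have [cm [C C0 hC]] := tame_small mode_tame; have [C' C'0 hC'] := rad_bound ckq.
split.
  move=> x wx; apply: (@ct_near _ _ (fun x => - kappa * q (enorm x) * mode x)).
    by apply: (@filterE _ (nbhs x) (nbhs_filter x)) => y; rewrite /mode_div !mulNr.
  by apply: ctM; [exact: (ctRad ckq)|exact: cm].
exists (C' * C); first exact: mulr_ge0.
by move=> x Dx; rewrite /mode_div -!mulNr normrM -mulrA ler_pM// ?hC//; exact: hC'.
Qed.

(** Euler's identity for H and the harmonicity of H reduce the divergence to the radial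
  equation. *)
Lemma mode_divE x : 0 < weight x -> \sum_i mode_dflux i i x = mode_div x.
Proof.
move=> wx; have /andP[r0 r1] := r01 wx; rewrite /mode_dflux/=.
set r := enorm x in r0 r1 *; have rn : r != 0 by rewrite gt_eqF.
have rr : \sum_i x 0 i * x 0 i = r ^+ 2.
  by rewrite /r enorm_sq; apply: eq_bigr => i _; rewrite expr2.
have eul := harm_euler m a b x; have lap := harm_laplace m a b x.
rewrite !big_split/= /mode_div /mode -/r; clearbody r.
have -> : \sum_i dYr r * (x 0 i / r) * (x 0 i / r) * P x = dYr r * P x.
  transitivity (dYr r * P x / r ^+ 2 * \sum_i x 0 i * x 0 i).
    by rewrite mulr_sumr; apply: eq_bigr => i _; move: (dYr r) (P x) (x 0 i) => *; field.
  by rewrite rr; move: (dYr r) (P x) => *; field.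
have -> : \sum_i Y r * ((i == i)%:R / r - x 0 i * x 0 i / r ^+ 3) * P x = Y r * p.+1%:R / r * P x.
  transitivity (Y r * P x / r * (\sum_(i < p.+2) 1) - Y r * P x / r ^+ 3 * \sum_i x 0 i * x 0 i).
    rewrite !mulr_sumr -sumrB; apply: eq_bigr => i _; rewrite eqxx mulr1n.
    by move: (Y r) (P x) (x 0 i) => *; field.
  rewrite rr sumr_const card_ord mulrS; move: (p.+1%:R) (Y r) (P x) => *; field.
  exact: rn.
have -> : \sum_i Y r * (x 0 i / r) * P1 i x = Y r / r * (m%:R * P x).
  by rewrite -eul mulr_sumr; apply: eq_bigr => i _; move: (Y r) (P1 i x) (x 0 i) => *; field.
have -> : \sum_i (sigma1 r * W r + Y r) * (x 0 i / r) * P1 i x =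
    (sigma1 r * W r + Y r) / r * (m%:R * P x).
  by rewrite -eul mulr_sumr; apply: eq_bigr => i _;
    move: (sigma1 r * W r + Y r) (P1 i x) (x 0 i) => *; field.
rewrite -mulr_sumr lap mulr0 addr0 /dYr natrD natrM.
by move: (P x) (Y r) (W r) (sigma1 r) (q r) => *; field.
Qed.

Lemma mode_radial_flux x : \sum_i x 0 i * mode_flux i x =
  (enorm x * Y (enorm x) + m%:R * sigma (enorm x) * W (enorm x)) * P x.
Proof.
rewrite /mode_flux; have eul := harm_euler m a b x.
have xr : \sum_i x 0 i * (x 0 i / enorm x) = enorm x.
  have -> : \sum_i x 0 i * (x 0 i / enorm x) = sqnorm x / enorm x.
    by rewrite /sqnorm mulr_suml; apply: eq_bigr => i _; rewrite expr2 mulrA.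
  rewrite -enorm_sq; have [->|rn] := eqVneq (enorm x) 0; first by rewrite invr0 mulr0.
  by rewrite expr2 mulfK.
transitivity (Y (enorm x) * P x * (\sum_i x 0 i * (x 0 i / enorm x)) +
   sigma (enorm x) * W (enorm x) * \sum_i x 0 i * P1 i x).
  rewrite !mulr_sumr -big_split/=; apply: eq_bigr => i _.
  by move: (x 0 i / enorm x) (Y (enorm x)) (P x) (sigma (enorm x)) (W (enorm x)) (P1 i x) (x 0 i) => *; ring.
by rewrite xr eul; ring.
Qed.

End mode_functions.

(** * Transmission pairs *)
Lemma linear_decay {R : realType} (h h' : R -> R) (C : R) : continuous h ->
  (forall r : R, 0 < r < 1 -> is_derive r 1 h (h' r)) ->
  (forall r, 0 < r < 1 -> `|h' r| <= C) -> h 1 = 0 ->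
  forall r, 0 <= r <= 1 -> `|h r| <= C * (1 - r).
Proof.
move=> ch dh hC h1 r /andP[r0 r1].
have sub (t : R) : r < t < 1 -> 0 < t < 1.
  by move=> /andP[rt ->]; rewrite (le_lt_trans r0 rt).
have cC : continuous (fun t : R => C * t) by apply: continuous_scale => t; exact: cvg_id.
have dC (t : R) : is_derive t 1 (fun t : R => C * t) (C * 1) by apply: derMc; exact: der_id.
have lo : C * r - h r <= C * 1 - h 1.
  apply: (@derive_ge0_le _ (fun t => C * t - h t) (fun t => C * 1 - h' t)) => // [t ht||t ht].
  - by apply: derB => //; exact/dh/sub.
  - by apply: continuous_within => t; exact: ctB (cC t) (ch t).
  - by rewrite mulr1 subr_ge0 (le_trans (ler_norm _))// hC// sub.
have hi : C * r + h r <= C * 1 + h 1.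
  apply: (@derive_ge0_le _ (fun t => C * t + h t) (fun t => C * 1 + h' t)) => // [t ht||t ht].
  - by apply: derD => //; exact/dh/sub.
  - by apply: continuous_within; exact: continuous_add.
  - by rewrite mulr1 -[h' t]opprK subr_ge0 (le_trans (ler_norm _))// normrN hC// sub.
rewrite ler_norml; move: lo hi; rewrite h1 mulrBr !mulr1 subr0 addr0.
by move: (h r) (C * r) => a b lo hi; apply/andP; split; lra.
Qed.

Section extensionality.
Context {R : realType} {N : nat}.
Implicit Types (D : set 'rV[R]_N) (f g : 'rV[R]_N -> R) (F G : 'I_N -> 'rV[R]_N -> R).

Lemma in_L2_ext D f g : {in D, f =1 g} -> in_L2 D f -> in_L2 D g.
Proof.
move=> fg; rewrite /in_L2 (_ : g \_ D = f \_ D)//.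
by apply/funext => x; rewrite /patch; case: ifPn => // /fg ->.
Qed.

Lemma weak_div_ext D F F' f f' : (forall i, {in D, F i =1 F' i}) -> {in D, f =1 f'} ->
  weak_div D F f -> weak_div D F' f'.
Proof.
move=> FF ff [F2 f2 wF]; split => [i||phi h].
- exact: in_L2_ext (FF i) (F2 i).
- exact: in_L2_ext ff f2.
have -> : \int[lebesgue_rV R N]_(x in D) dot F' (partial ^~ phi) x =
    \int[lebesgue_rV R N]_(x in D) dot F (partial ^~ phi) x.
  by apply: eq_Rintegral => x Dx; apply: eq_bigr => i _; rewrite FF.
rewrite wF//; congr (- _).
by apply: eq_Rintegral => x Dx; rewrite ff.
Qed.

Lemma eq_normal_trace_ext D F F' f f' G g : (forall i, {in D, F i =1 F' i}) -> {in D, f =1 f'} ->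
  eq_normal_trace D F f G g -> eq_normal_trace D F' f' G g.
Proof.
move=> FF ff h phi Phi hphi; rewrite -h//; apply: eq_Rintegral => x Dx.
by rewrite ff//; congr (_ + _); apply: eq_bigr => i _; rewrite FF.
Qed.

End extensionality.

Section transmission_pair.
Context {R : realType} {p : nat} (m : nat) (a b : R).
Variables (sigma sigma1 q W Y V Z : R -> R) (kappa : R).
Hypotheses (m3 : (3 <= m)%N) (ab : a ^+ 2 + b ^+ 2 <= 1).
Hypotheses (csigma : continuous sigma) (csigma1 : continuous sigma1) (cq : continuous q).
Hypothesis (sigma_gt0 : forall r, 0 < sigma r).
Hypothesis (dsigma : forall r : R, 0 < r < 1 -> is_derive r 1 sigma (sigma1 r)).
Hypotheses (cW : continuous W) (cY : continuous Y) (cV : continuous V) (cZ : continuous Z).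
Hypothesis (dW : forall r : R, 0 < r < 1 -> is_derive r 1 W (Y r / sigma r)).
Hypothesis (dY : forall r : R, 0 < r < 1 -> is_derive r 1 Y
  (- ((2 * m + p.+1)%:R * Y r + (m%:R * sigma1 r + kappa * r * q r) * W r) / r)).
Hypothesis (dV : forall r : R, 0 < r < 1 -> is_derive r 1 V (Z r / cst 1 r)).
Hypothesis (dZ : forall r : R, 0 < r < 1 -> is_derive r 1 Z
  (- ((2 * m + p.+1)%:R * Z r + (m%:R * cst 0 r + kappa * r * cst 1 r) * V r) / r)).
Hypothesis WV : W 1 = V 1.
Hypothesis YZ : conormal m sigma W Y 1 = conormal m (cst 1) V Z 1.
Local Notation D := (@eball R p.+2 1).
Local Notation u := (@mode R p m a b W).
Local Notation v := (@mode R p m a b V).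

Let c1 : continuous (cst 1 : R -> R). Proof. by move=> x; exact: cvg_cst. Qed.
Let c0 : continuous (cst 0 : R -> R). Proof. by move=> x; exact: cvg_cst. Qed.
Let gt1 (r : R) : 0 < cst 1 r :> R. Proof. exact: ltr01. Qed.
Let d1 (r : R) : 0 < r < 1 -> is_derive r 1 (cst 1 : R -> R) (cst 0 r).
Proof. by move=> _; exact: derC. Qed.

Let pair_decay (h h' : R -> R) : continuous h -> continuous h' ->
  (forall r : R, 0 < r < 1 -> is_derive r 1 h (h' r)) -> h 1 = 0 ->
  exists2 C, 0 <= C & forall x, D x -> `|h (enorm x) * harm m a b x| <= C * weight x.
Proof.
move=> ch ch' dh h1; have [C C0 hC] := compact_bound (@segment_compact R 0 1) ch'.
have dec : forall r, 0 <= r <= 1 -> `|h r| <= C * (1 - r).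
  apply: (linear_decay ch dh) h1 => r /andP[r0 r1].
  by apply: hC; rewrite /= in_itv/= !ltW.
exists C => // x Dx; have r0 := enorm_ge0 x; have r1 : enorm x <= 1 := ltW Dx.
have P_le : `|harm m a b x| <= sqnorm x.
  apply: (le_trans (harm_bound m x ab)); rewrite -enorm_sq -(subnKC (ltnW m3)) exprD.
  by rewrite ler_piMr ?sqr_ge0// exprn_ile1.
rewrite normrM /weight (mulrC (sqnorm x)) mulrA ler_pM//.
apply: (le_trans (dec _ _)); rewrite ?r0//; apply: ler_wpM2l => //.
by rewrite lerB// -enorm_sq expr2 ler_piMl.
Qed.

Lemma is_derive_flux (s s1 g w y : R -> R) (r : R) : (forall r, 0 < s r) ->
  is_derive r 1 s (s1 r) -> is_derive r 1 w (y r / s r) -> is_derive r 1 y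
   (- ((2 * m + p.+1)%:R * y r + (m%:R * s1 r + kappa * r * g r) * w r) / r) -> 0 < r ->
  is_derive r 1 (conormal m s w y) (- ((m + p)%:R * y r + kappa * r * g r * w r)).
Proof.
move=> s0 ds dw dy r0.
have := derD (derM (der_id r) dy) (derM (derMc m%:R ds) dw).
move/is_derive_eq; apply; have s00 : s r != 0 by rewrite gt_eqF.
rewrite (natrD _ (2 * m)%N) (natrD _ m p) natrM -(natr1 p); field.
by rewrite s00 gt_eqF.
Qed.

(** The pair has the same Cauchy data on the sphere, and the weak formulation only
  sees the difference of the traces and of the fluxes, which vanish linearly. *)
Lemma transmission_pair (sigma0 n : R -> R) (k : R) : 0 < k -> kappa = k ^+ 2 ->
  (forall r, 0 <= r <= 1 -> sigma0 r = sigma r) ->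
  (forall r, 0 <= r <= 1 -> n r ^+ 2 = q r) ->
  ~ {ae lebesgue_rV R p.+2, forall x, D x -> v x = 0} ->
  transmission_eigenfunctions D sigma0 n k u v.
Proof.
move=> k0 kE sE nE v0; split => //.
  by move=> uv; apply: v0; apply: filterS uv => x /= h /h[].
exists (mode_grad m a b sigma W Y), (mode_grad m a b (cst 1) V Z) => /=.
have r01 (x : 'rV[R]_p.+2) : D x -> 0 <= enorm x <= 1 by move=> Dx; rewrite enorm_ge0 ltW.
have tu : tame u (mode_grad m a b sigma W Y) by apply: mode_tame.
have tv : tame v (mode_grad m a b (cst 1) V Z) by exact: mode_tame.
have gu i : small (mode_grad m a b sigma W Y i : 'rV[R]_p.+2 -> R) by apply: mode_grad_small.
have gv i : small (mode_grad m a b (cst 1) V Z i : 'rV[R]_p.+2 -> R) by apply: mode_grad_small.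
have fu := mode_flux_tame m3 ab csigma csigma1 cq sigma_gt0 dsigma cW cY dW dY.
have fv := mode_flux_tame m3 ab c1 c0 c1 gt1 d1 cV cZ dV dZ.
have su := @mode_div_small R p _ _ _ _ _ _ _ kappa m3 ab csigma cq sigma_gt0 cW cY dW.
have sv := @mode_div_small R p _ _ _ _ _ _ _ kappa m3 ab c1 c1 gt1 cV cZ dV.
have eF i : {in D, mode_flux m a b sigma W Y i =1
    (fun x => sigma0 (enorm x) * mode_grad m a b sigma W Y i x)}.
  by move=> x /set_mem Dx; rewrite sE ?r01// mode_fluxE.
have ef : {in D, mode_div m a b q W kappa =1 (fun x => - (k ^+ 2 * n (enorm x) ^+ 2 * u x))}.
  by move=> x /set_mem Dx; rewrite nE ?r01// -kE.
have eG i : mode_flux m a b (cst 1) V Z i = mode_grad m a b (cst 1) V Z i :> ('rV[R]_p.+2 -> R).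
  by apply/funext => x; rewrite -mode_fluxE// mul1r.
have eg : mode_div m a b (cst 1) V kappa = (fun x : 'rV[R]_p.+2 => - (k ^+ 2 * v x)).
  by apply/funext => x; rewrite /mode_div /= mulr1 kE.
have eG' : mode_flux m a b (cst 1) V Z = mode_grad m a b (cst 1) V Z :> ('I_p.+2 -> 'rV[R]_p.+2 -> R).
  by apply/funext => i; exact: eG.
split.
- by split; exact: tame_H1.
- apply: weak_div_ext eF ef _; apply: (tame_weak_div fu su) => x wx; exact: mode_divE.
- rewrite -eg -eG'; apply: (tame_weak_div fv sv) => x wx; exact: mode_divE.
- have cY' : continuous (fun r => Y r / sigma r).
    by apply: continuous_divr => // r; rewrite gt_eqF.
  have [C C0 hC] := @pair_decay (fun r => W r - V r) (fun r => Y r / sigma r - Z r / cst 1 r)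
    (continuous_sub cW cV) (continuous_sub cY' (continuous_divr cZ c1 (fun=> oner_neq0 _)))
    (fun r hr => derB (dW hr) (dV hr)) (etrans (congr1 (fun t => t - V 1) WV) (subrr _)).
  apply: (tame_H10 (tame_sub tu tv) _ C0) => [i|x Dx]; first exact: small_sub.
  by rewrite /mode -mulrBl; exact: hC.
- apply: eq_normal_trace_ext eF ef _; rewrite -eg -eG'.
  have cflux (g w y : R -> R) : continuous g -> continuous w -> continuous y ->
      continuous (fun r => - ((m + p)%:R * y r + kappa * r * g r * w r)).
    move=> cg cw cy; apply: continuous_opp; apply: continuous_add; first exact: continuous_scale.
    apply: continuous_mul => //; apply: continuous_mul => //.
    by apply: continuous_scale => r; exact: cvg_id.
  have ccon (s w y : R -> R) : continuous s -> continuous w -> continuous y ->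
      continuous (conormal m s w y).
    move=> cs cw cy; apply: continuous_add.
      by apply: continuous_mul => // r; exact: cvg_id.
    by apply: continuous_mul => //; exact: continuous_scale.
  pose h r := conormal m sigma W Y r - conormal m (cst 1) V Z r.
  have ch : continuous h by exact: continuous_sub (ccon _ _ _ csigma cW cY) (ccon _ _ _ c1 cV cZ).
  have [C C0 hC] := @pair_decay h
    (fun r => - ((m + p)%:R * Y r + kappa * r * q r * W r) - - ((m + p)%:R * Z r + kappa * r * cst 1 r * V r))
    ch (continuous_sub (cflux _ _ _ cq cW cY) (cflux _ _ _ c1 cV cZ))
    (fun r hr => derB (is_derive_flux sigma_gt0 (dsigma hr) (dW hr) (dY hr) (proj1 (andP hr)))
       (is_derive_flux gt1 (d1 hr) (dV hr) (dZ hr) (proj1 (andP hr))))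
    (etrans (congr1 (fun t => t - _) YZ) (subrr _)).
  apply: (tame_normal_trace fu fv su sv _ _ C0) => x hx; [exact: mode_divE|exact: mode_divE|].
  under eq_bigr do rewrite mulrBr.
  rewrite sumrB !mode_radial_flux -mulrBl; exact: hC.
Qed.

End transmission_pair.

(** * Localization near the sphere *)
Section localization.
Context {R : realType} {p : nat}.
Implicit Types (x : 'rV[R]_p.+2) (V : R -> R).
Local Notation mu := (lebesgue_rV R p.+2).
Local Notation B t := (@eball R p.+2 t).

Definition energy (A : set 'rV[R]_p.+2) (f : 'rV[R]_p.+2 -> R) : R :=
  \int[mu]_(x in A) f x ^+ 2.

Lemma continuous_mode m a b V : continuous V ->
  continuous (mode m a b V : 'rV[R]_p.+2 -> R).
Proof.
move=> cV; apply: continuous_mul; last exact: continuous_harm.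
by move=> x; apply: ctComp; [exact: cV|exact: continuous_enorm].
Qed.

Lemma eball_bound (f : 'rV[R]_p.+2 -> R) t : continuous f ->
  exists2 C, 0 <= C & forall x, B t x -> `|f x| <= C.
Proof.
move=> cf; have [C C0 hC] := compact_bound (@compact_box R p.+2 t) cf.
by exists C => // x Bx; apply: hC; exact: eball_sub_box.
Qed.

Lemma eball_integrable (f : 'rV[R]_p.+2 -> R) t : continuous f ->
  mu.-integrable (B t) (EFin \o f).
Proof.
move=> cf; have [C _ hC] := eball_bound t cf.
apply: (@bounded_integrable _ _ _ _ C) => //; [exact: measurable_eball|exact: eball_finite|].
by apply: measurable_funTS; exact: continuous_measurable_rV.
Qed.

Lemma normL2_eball (f : 'rV[R]_p.+2 -> R) t : continuous f ->
  normL2 (B t) f = (Num.sqrt (energy (B t) f))%:E.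
Proof.
move=> cf; have [C _ hC] := eball_bound t cf.
apply: (@normL2E _ _ _ _ C) => //; [exact: measurable_eball|exact: eball_finite|].
by apply: measurable_funTS; exact: continuous_measurable_rV.
Qed.

Lemma continuous_sqr (f : 'rV[R]_p.+2 -> R) : continuous f -> continuous (fun x => f x ^+ 2).
Proof. by move=> cf x; apply: ctX; exact: cf. Qed.

Lemma energy_gt0_neq0 (f : 'rV[R]_p.+2 -> R) t : continuous f -> 0 < energy (B t) f ->
  ~ {ae mu, forall x, B t x -> f x = 0}.
Proof.
move=> cf E0 f0; move: E0; rewrite /energy /Rintegral.
rewrite (@ae_eq_integral _ _ _ mu (B t) (cst 0%E)) ?integral0 ?ltxx//.
- exact: measurable_eball.
- apply/measurable_EFinP; apply: measurable_funTS; apply: continuous_measurable_rV.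
  exact: continuous_sqr.
- by apply: filterS f0 => x /= h /h ->; rewrite expr0n.
Qed.

Section mode_energy.
Variables (m g : nat) (V : R -> R).
Hypotheses (gm : (g <= m)%N) (cV : continuous V).
Hypothesis (V_gt0 : forall r, 0 <= r <= 1 -> 0 < V r).
Hypothesis (V_growth : forall r s, 0 <= r -> r <= s -> s <= 1 ->
  r ^+ (m - g) * V r <= s ^+ (m - g) * V s).

(** V(r) r^m = r^g (r^(m-g) V(r)), and both factors increase with r. *)
Lemma mode_energy_le a b tau t : a ^+ 2 + b ^+ 2 <= 1 -> 0 < tau -> tau <= t -> t <= 1 ->
  energy (B tau) (mode m a b V) <=
  (tau ^+ g * (t ^+ (m - g) * V t)) ^+ 2 * fine (mu (B tau)).
Proof.
move=> ab tau0 taut t1; rewrite -Rintegral_cst; last exact: measurable_eball.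
have cv : continuous (mode m a b V : 'rV[R]_p.+2 -> R) by exact: continuous_mode.
apply: le_Rintegral.
- exact: measurable_eball.
- by apply: eball_integrable; exact: continuous_sqr.
- by apply: (@eball_integrable (fun=> _) tau) => x; exact: ctC.
move=> x Bx; have r0 := enorm_ge0 x; have rtau : enorm x <= tau := ltW Bx.
have rt := le_trans rtau taut; have r1 := le_trans rt t1.
have Vr : 0 < V (enorm x) by rewrite V_gt0// r0.
rewrite -[leLHS]real_normK ?num_real// lerXn2r ?nnegrE//.
  rewrite !mulr_ge0 ?exprn_ge0 ?(ltW tau0) ?(le_trans _ taut) ?(ltW tau0)//.
  by rewrite ltW// V_gt0// t1 andbT (le_trans r0).
rewrite /mode normrM (gtr0_norm Vr).
apply: (@le_trans _ _ (enorm x ^+ g * (enorm x ^+ (m - g) * V (enorm x)))).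
  rewrite mulrA -exprD subnKC// mulrC ler_wpM2r ?(ltW Vr)//.
  exact: harm_bound.
apply: ler_pM; rewrite ?mulr_ge0 ?exprn_ge0 ?(ltW Vr) ?V_growth//.
by rewrite lerXn2r ?nnegrE ?(ltW tau0).
Qed.

(** The sum of the squares for H = Re z^m and H = Im z^m depends on |z| only, and one of the
  two modes carries at least half of the energy. *)
Lemma mode_energy_ge t (S : set 'rV[R]_p.+2) : 0 < t -> t <= 1 -> measurable S ->
  S `<=` B 1 -> (forall x, S x -> t <= x 0 i0) ->
  exists a b, a ^+ 2 + b ^+ 2 <= 1 /\
    (t ^+ m * (t ^+ (m - g) * V t)) ^+ 2 * fine (mu S) <= 2 * energy (B 1) (mode m a b V).
Proof.
move=> t0 t1 mS SB St.
set c := (_ ^+ 2 in X in X * _).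
pose f1 : 'rV[R]_p.+2 -> R := mode m 1 0 V; pose f2 : 'rV[R]_p.+2 -> R := mode m 0 (- 1) V.
have cf1 : continuous f1 by exact: continuous_mode.
have cf2 : continuous f2 by exact: continuous_mode.
have cF : continuous (fun x => f1 x ^+ 2 + f2 x ^+ 2).
  by apply: continuous_add; exact: continuous_sqr.
suff : c * fine (mu S) <= energy (B 1) f1 + energy (B 1) f2.
  have [le12|/ltW le21] := leP (energy (B 1) f1) (energy (B 1) f2) => h.
    exists 0, (- 1); split; first by rewrite sqrrN expr0n expr1n add0r.
    by apply: (le_trans h); rewrite mulr_natl mulr2n lerD2r.
  exists 1, 0; split; first by rewrite expr0n expr1n addr0.
  by apply: (le_trans h); rewrite mulr_natl mulr2n lerD2l.
have mB : measurable (B 1) by exact: measurable_eball.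
have mF A : measurable_fun A (EFin \o (fun x => f1 x ^+ 2 + f2 x ^+ 2)).
  by apply/measurable_EFinP; apply: measurable_funTS; exact: continuous_measurable_rV.
have muS : mu S \is a fin_num.
  rewrite ge0_fin_numE ?measure_ge0//; apply: le_lt_trans (@eball_finite R p.+2 1).
  by apply: le_measure; rewrite ?inE.
rewrite /energy -RintegralD//; last 2 first.
  by apply: eball_integrable; exact: continuous_sqr.
  by apply: eball_integrable; exact: continuous_sqr.
rewrite -lee_fin EFinM fineK// /Rintegral fineK; last first.
  by apply: integrable_fin_num => //; exact: eball_integrable.
rewrite -integral_cst//.
apply: (@le_trans _ _ (\int[mu]_(x in S) (f1 x ^+ 2 + f2 x ^+ 2)%:E)%E); last first.
  apply: ge0_subset_integral => //.
  by move=> x _; rewrite lee_fin addr_ge0// sqr_ge0.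
apply: ge0_le_integral => //.
  by move=> x _; rewrite lee_fin sqr_ge0.
move=> x Sx; rewrite lee_fin /f1 /f2 /mode !exprMn -mulrDr harm_sq expr1n expr0n addr0 mul1r.
have tx := St x Sx; have r1 : enorm x <= 1 := ltW (SB x Sx).
have xr : x 0 i0 <= enorm x by apply: le_trans (coord_le_enorm x i0); exact: ler_norm.
have tr := le_trans tx xr; have r0 := enorm_ge0 x.
have Vr : 0 < V (enorm x) by rewrite V_gt0// r0.
have Vt : 0 < V t by rewrite V_gt0// (ltW t0).
rewrite /c exprMn mulrC; apply: ler_pM; rewrite ?sqr_ge0//.
  rewrite lerXn2r ?nnegrE ?mulr_ge0 ?exprn_ge0 ?(ltW t0) ?(ltW Vr) ?(ltW Vt)//.
  apply: (le_trans (V_growth (ltW t0) tr r1)).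
  by rewrite ler_piMl ?(ltW Vr)// exprn_ile1.
rewrite -exprM mulnC exprM lerXn2r ?nnegrE ?addr_ge0 ?sqr_ge0//.
apply: (@le_trans _ _ (x 0 i0 ^+ 2)); last by rewrite lerDl sqr_ge0.
by rewrite lerXn2r ?nnegrE ?(ltW t0)// (le_trans (ltW t0)).
Qed.

End mode_energy.

Lemma cap_box (t : R) : 0 < t < 1 -> exists S : set 'rV[R]_p.+2,
  [/\ measurable S, S `<=` B 1, forall x, S x -> t <= x 0 i0 & (0 < mu S)%E].
Proof.
move=> /andP[t0 t1]; pose s := (1 + t) / 2; pose del := 1 - s ^+ 2.
have ts : t < s by rewrite /s; lra.
have s1 : s < 1 by rewrite /s; lra.
have s0 : 0 < s by lra.
have del0 : 0 < del by rewrite /del subr_gt0 exprn_ilt1// ltW.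
have del1 : del <= 1 by rewrite /del gerBl sqr_ge0.
pose e := del / p.+2%:R; have e0 : 0 < e by rewrite /e divr_gt0.
pose A (i : 'I_p.+2) : set R := if i == i0 then `[t, s]%classic else `[- e, e]%classic.
have mA i : measurable (A i) by rewrite /A; case: ifP.
exists [set x | forall i, A i (x 0 i)]; split.
- exact: measurable_rV_box.
- move=> x Ax; apply/eball1E; rewrite /sqnorm (bigD1 i0)//=.
  have : x 0 i0 ^+ 2 <= s ^+ 2.
    have := Ax i0; rewrite /A eqxx /= in_itv/= => /andP[h1 h2].
    by rewrite lerXn2r ?nnegrE ?(ltW s0)// (le_trans (ltW t0)).
  have : \sum_(i < p.+2 | i != i0) x 0 i ^+ 2 < del; last by rewrite /del; lra.
  apply: (@le_lt_trans _ _ (\sum_(i < p.+2 | i != i0) e ^+ 2)).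
    apply: ler_sum => i ii; have := Ax i; rewrite /A (negbTE ii) /= in_itv/= => h.
    rewrite -(real_normK (num_real (x 0 i))) lerXn2r ?nnegrE ?(ltW e0)//.
    by rewrite ler_norml.
  rewrite big_const cardC1 card_ord iter_addr addr0 /=.
  rewrite -[X in X < _]mulr_natl (_ : del = p.+2%:R * e); last first.
    by rewrite /e mulrC divfK.
  have e1 : e <= 1.
    by rewrite /e ler_pdivrMr// mul1r (le_trans del1)// ler1n.
  apply: (@le_lt_trans _ _ (p.+1%:R * e)); last by rewrite ltr_pM2r// ltr_nat.
  by rewrite ler_pM2l// expr2 ler_piMl// ltW.
- by move=> x Ax; have := Ax i0; rewrite /A eqxx /= in_itv/= => /andP[].
- rewrite lebesgue_rV_box//; apply: (big_ind (fun z => 0 < z)%E) => [|y z|i _]; [exact: lte01|exact: mule_gt0|].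
  rewrite /A; case: ifP => _; rewrite lebesgue_measure_itv/= lte_fin.
    by rewrite ts -EFinB lte_fin subr_gt0.
  have ee : - e < e by lra.
  by rewrite ee -EFinB lte_fin subr_gt0.
Qed.

(** With T = t^(m-g) V(t), the square of the mode is at most (tau^g T)^2 on the small ball
  and, for one of the two phases, of order (t^(d g) T)^2 on the part x_0 >= t of the unit
  ball. *)
Lemma mode_localization (tau t : R) (d : nat) : 0 < tau -> tau <= t -> t < 1 ->
  exists2 C, 0 <= C & forall (g : nat) (V : R -> R), (g <= d * g)%N ->
    continuous V -> (forall r, 0 <= r <= 1 -> 0 < V r) ->
    (forall r s, 0 <= r -> r <= s -> s <= 1 ->
      r ^+ (d * g - g) * V r <= s ^+ (d * g - g) * V s) ->
    exists a b, [/\ a ^+ 2 + b ^+ 2 <= 1, 0 < energy (B 1) (mode (d * g) a b V) &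
      Num.sqrt (energy (B tau) (mode (d * g) a b V)) <=
      C * (tau / t ^+ d) ^+ g * Num.sqrt (energy (B 1) (mode (d * g) a b V))].
Proof.
move=> tau0 taut t1; have t0 := lt_le_trans tau0 taut.
have [S [mS SB St muS]] := @cap_box t (introT andP (conj t0 t1)).
pose be := fine (mu (B tau)); pose s := fine (mu S).
have be0 : 0 <= be by exact: fine_ge0 (measure_ge0 mu _).
have s0 : 0 < s.
  rewrite fine_gt0// muS/=; apply: le_lt_trans (@eball_finite R p.+2 1).
  by apply: le_measure; rewrite ?inE//; exact: measurable_eball.
exists (Num.sqrt (2 * be / s)); first exact: sqrtr_ge0.
move=> g V gm cV V0 Vg.
have [a [b [ab hge]]] := mode_energy_ge cV V0 Vg t0 (ltW t1) mS SB St.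
have hle := mode_energy_le gm cV V0 Vg ab tau0 taut (ltW t1).
exists a, b; pose E := energy (B 1) (mode (d * g) a b V).
pose Etau := energy (B tau) (mode (d * g) a b V).
pose T := t ^+ (d * g - g) * V t.
have {hge} hE : (t ^+ (d * g) * T) ^+ 2 * s <= 2 * E := hge.
have {hle} hEtau : Etau <= (tau ^+ g * T) ^+ 2 * be := hle.
change ([/\ a ^+ 2 + b ^+ 2 <= 1, 0 < E &
  Num.sqrt Etau <= Num.sqrt (2 * be / s) * (tau / t ^+ d) ^+ g * Num.sqrt E]).
clearbody E Etau; clearbody be s.
have T0 : 0 < T by rewrite mulr_gt0 ?exprn_gt0// V0// !ltW.
have E0 : 0 < E.
  rewrite -(pmulr_rgt0 _ (ltr0n _ 2)) (lt_le_trans _ hE)// mulr_gt0// exprn_gt0//.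
  by rewrite mulr_gt0// exprn_gt0.
split => //; set th := tau / t ^+ d.
have th0 : 0 <= th by rewrite divr_ge0 ?exprn_ge0 ?ltW.
have tauE : tau ^+ g = th ^+ g * t ^+ (d * g).
  by rewrite exprM -exprMn /th divfK// expf_neq0// gt_eqF.
have thg0 : 0 <= th ^+ g by exact: exprn_ge0.
rewrite -[th ^+ g](ger0_norm thg0) -sqrtr_sqr -!sqrtrM ?mulr_ge0 ?sqr_ge0 ?invr_ge0 ?(ltW s0)//.
apply: ler_wsqrtr; apply: (le_trans hEtau); rewrite tauE -mulrA exprMn.
apply: (@le_trans _ _ ((th ^+ g) ^+ 2 * (2 * E / s) * be)).
  apply: ler_wpM2r => //; apply: ler_wpM2l; first exact: sqr_ge0.
  by rewrite ler_pdivlMr.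
rewrite le_eqVlt; apply/orP; left; apply/eqP.
by move: ((th ^+ g) ^+ 2) => x; field; rewrite gt_eqF.
Qed.

End localization.

(** * Extension of the coefficients and conclusion *)
Section radial_extension.
Context {R : realType}.
Implicit Types (f : R -> R) (r : R).

Lemma continuous_clamp_comp f : {within `[0, 1], continuous f} -> continuous (f \o clamp).
Proof.
move=> /subspace_continuousP cf r.
have Ar s : `[(0 : R), 1]%classic (clamp s) by rewrite /= in_itv/= clamp_itv.
apply: (cvg_comp clamp f _ (cf _ (Ar r))) => P /= hP.
apply: (@filterS _ (nbhs r) (nbhs_filter r) _ _ _ (@continuous_clamp R r _ hP)) => s h.
exact: h (Ar s).
Qed.

Lemma has_derivative_on_continuous (A : set R) f f' : has_derivative_on A f f' ->
  {within A, continuous f}.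
Proof.
move=> df; apply/subspace_continuousP => x Ax; apply/cvgrPdist_lt => e e0.
have /cvgrPdist_lt/(_ 1 ltr01) h := df x Ax.
pose L := `|f' x| + 1; have L0 : 0 < L by rewrite /L ltr_wpDl.
have eL : 0 < e / L by rewrite divr_gt0.
have h2 : \forall y \near x, `|x - y| < e / L.
  by apply: (@cvgr_dist_lt _ _ _ (nbhs x) _ id x) => //; exact: cvg_id.
move: h; rewrite !near_withinE => h.
have {}h : \forall y \near x, y != x -> A y -> `|f' x - (f y - f x) / (y - x)| < 1 by exact: h.
apply: (@filterS2 _ (nbhs x) (nbhs_filter x) _ _ _ _ h h2) => y hy hxy Ay.
have [->|yx] := eqVneq y x; first by rewrite subrr normr0.
have {}hy := hy yx Ay.
have yx0 : y - x != 0 by rewrite subr_eq0.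
rewrite distrC -[f y - f x](divfK yx0) normrM (distrC y).
apply: (@le_lt_trans _ _ (L * `|x - y|)).
  apply: ler_wpM2r => //; rewrite /L; move: hy; set q := (_ / _) => hy.
  have -> : q = f' x - (f' x - q) by ring.
  by rewrite (le_trans (ler_normB _ _))// lerD2l ltW.
by rewrite -ltr_pdivlMl// mulrC.
Qed.

(** At interior points the derivative relative to [0, 1] is the usual one. *)
Lemma is_derive_clamp_comp f f' r : has_derivative_on `[0, 1] f f' -> 0 < r < 1 ->
  is_derive r 1 (f \o clamp) ((f' \o clamp) r).
Proof.
move=> df /andP[r0 r1].
have rI : `[(0 : R), 1]%classic r by rewrite /= in_itv/= !ltW.
rewrite /= clamp_id; last by rewrite !ltW.
apply: (@der_near _ _ f); first exact: oner_neq0.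
  have h0 : \forall y \near r, 0 < y by exact: lt_nbhsr.
  have h1 : \forall y \near r, y < 1 by exact: lt_nbhsl.
  near=> y; rewrite /= clamp_id//; apply/andP; split; apply: ltW.
    by near: y.
  by near: y.
have dq := df r rI.
have lim : (fun h => h^-1 *: (f (h *: 1 + r) - f r)) @ 0^' --> f' r.
  apply/cvgrPdist_lt => e e0; move/cvgrPdist_lt : dq => /(_ e e0).
  rewrite !near_withinE => h.
  have {}h : \forall y \near r, y != r -> `[(0 : R), 1]%classic y ->
    `|f' r - (f y - f r) / (y - r)| < e by exact: h.
  have sh : (fun h : R => h *: 1 + r) @ (0 : R) --> r.
    rewrite -[X in _ --> X]add0r -[X in _ --> X + _](scale0r (1 : R^o)).
    by apply: cvgD; [apply: cvgZr_tmp; exact: cvg_id|exact: cvg_cst].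
  have h0 : \forall y \near r, 0 < y by exact: lt_nbhsr.
  have h1 : \forall y \near r, y < 1 by exact: lt_nbhsl.
  have h2 := sh _ h; have h3 := sh _ h0; have h4 := sh _ h1.
  near=> k => k0.
  have H2 : k *: 1 + r != r -> `[(0 : R), 1]%classic (k *: 1 + r) ->
    `|f' r - (f (k *: 1 + r) - f r) / (k *: 1 + r - r)| < e by near: k.
  have H3 : 0 < k *: 1 + r by near: k.
  have H4 : k *: 1 + r < 1 by near: k.
  have E : k *: 1 + r - r = k by rewrite addrK [_ *: _]mulr1.
  move: H2; rewrite E [_^-1 *: _]mulrC; apply.
    by rewrite -subr_eq0 E.
  by rewrite /= in_itv/= !ltW.
apply: DeriveDef; first by apply/cvg_ex; exists (f' r).
exact: cvg_lim lim.
Unshelve. all: by end_near.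
Qed.

Lemma clamp_comp_bound f : continuous (f \o clamp) ->
  exists2 C, 0 <= C & forall r, `|(f \o clamp) r| <= C.
Proof.
move=> cf; have [C C0 hC] := compact_bound (@segment_compact R 0 1) cf.
exists C => // r; rewrite /= -(clamp_id (clamp_itv r)); apply: hC.
by rewrite /= in_itv/= clamp_itv.
Qed.

End radial_extension.

Lemma bernoulli {R : realType} (x : R) n : 0 <= x <= 1 -> 1 - n%:R * x <= (1 - x) ^+ n.
Proof.
move=> /andP[x0 x1]; elim: n => [|n ih]; first by rewrite mul0r subr0.
rewrite exprS; apply: (@le_trans _ _ ((1 - x) * (1 - n%:R * x))); last first.
  by rewrite ler_wpM2l// subr_ge0.
rewrite -natr1 -subr_ge0 (_ : _ - _ = n%:R * x ^+ 2); last by ring.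
by rewrite mulr_ge0// sqr_ge0.
Qed.

Section localized_eigenpairs.
Context {R : realType} {p : nat}.
Variables (n sigma sigma1 : R -> R) (c M1 M2 S C1 tau : R).
Local Notation sigmae := (sigma \o clamp).
Local Notation sigma1e := (sigma1 \o clamp).
Local Notation ne := (n \o clamp).
Hypotheses (c0 : 0 < c) (M11 : 1 < M1) (M12 : M1 < M2).
Hypotheses (csigma : continuous sigmae) (csigma1 : continuous sigma1e) (cn : continuous ne).
Hypothesis sigma_ge : forall r, c <= sigmae r.
Hypothesis sigma_le : forall r, sigmae r <= S.
Hypothesis sigma1_le : forall r, `|sigma1e r| <= C1.
Hypothesis (dsigma : forall r : R, 0 < r < 1 -> is_derive r 1 sigmae (sigma1e r)).
Hypothesis n_sigma : forall r, M1 * sigmae r <= ne r ^+ 2 <= M2 * sigmae r.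
Hypothesis tau01 : 0 < tau < 1.
Local Notation B t := (@eball R p.+2 t).

(** The frequency m = d g with g = j + const makes k at least al j, and the energy ratio
  at most C th^j, with constants that do not depend on j. *)
Lemma localized_eigenpair : exists al C th : R, [/\ 0 < al, 0 <= C, 0 <= th < 1 &
  forall j : nat, exists (u v : 'rV[R]_p.+2 -> R) (k : R),
    [/\ transmission_eigenfunctions (B 1) sigma n k u v, al * j%:R <= k,
        (0 < normL2 (B 1) v)%E &
        0 <= fine (normL2 (B tau) v) / fine (normL2 (B 1) v) <= C * th ^+ j]].
Proof.
have /andP[tau0 tau1] := tau01.
have M20 : 0 < M2 by rewrite (lt_trans _ M12)// (lt_trans ltr01).
set rho := spectral_top M1; have /andP[rho0 rho1] : 0 < rho < 1 := spectral_top_lt1 M11.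
have rho1' : 0 < 1 - rho by rewrite subr_gt0.
(* (m - g)(m + g) >= rho m^2 as soon as m = d g with 1 <= (1 - rho) d^2 *)
have [d [d2 d_rho]] : exists d : nat, (2 <= d)%N /\ 1 <= (1 - rho) * d%:R ^+ 2.
  exists (Num.bound (1 - rho)^-1).+2; split => //.
  set b := Num.bound _.
  have hb : (1 - rho)^-1 < b%:R.
    by apply: archi_boundP; rewrite invr_ge0 ltW.
  have hb2 : (1 - rho)^-1 <= b.+2%:R by apply: (le_trans (ltW hb)); rewrite ler_nat ltnW.
  rewrite -ler_pdivrMl// mulr1 (le_trans hb2)// expr2 ler_peMl// ler1n//.
(* by Bernoulli's inequality, t^d >= (1 + tau) / 2 > tau *)
pose t := 1 - (1 - tau) / (2 * d%:R).
have d0 : 0 < d%:R :> R by rewrite ltr0n (ltn_trans _ d2).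
have x0 : 0 < (1 - tau) / (2 * d%:R) by rewrite divr_gt0 ?subr_gt0// mulr_gt0.
have x1 : (1 - tau) / (2 * d%:R) <= 1 - tau.
  rewrite ler_piMr ?subr_ge0 ?(ltW tau1)// invf_le1 ?mulr_gt0//.
  by rewrite -natrM ler1n muln_gt0/= (ltn_trans _ d2).
have taut : tau <= t by rewrite /t; lra.
have t1 : t < 1 by rewrite /t; lra.
have t0 : 0 < t by exact: lt_le_trans taut.
have td : tau < t ^+ d.
  apply: (@lt_le_trans _ _ (1 - d%:R * ((1 - tau) / (2 * d%:R)))); last first.
    by apply: bernoulli; rewrite ltW//= (le_trans x1)// gerBl ltW.
  have -> : d%:R * ((1 - tau) / (2 * d%:R)) = (1 - tau) / 2 by field; rewrite gt_eqF.
  by lra.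
have td0 : 0 < t ^+ d by rewrite exprn_gt0.
have [C C0 hC] := @mode_localization R p tau t d tau0 taut t1.
set th := tau / t ^+ d in hC.
have th0 : 0 <= th by rewrite divr_ge0 ?ltW.
have th1 : th < 1 by rewrite /th ltr_pdivrMr// mul1r.
pose al := Num.sqrt (2 * M2)^-1.
have al0 : 0 < al by rewrite sqrtr_gt0 invr_gt0 mulr_gt0.
exists al, C, th; split => //; first by rewrite th0.
move=> j; pose F := frequency_bound p c S M1.
pose g := (j + 3 + Num.bound `|F|)%N; pose m := (d * g)%N.
have g3 : (3 <= g)%N by rewrite /g addnAC leq_addl.
have gm : (g < m)%N by rewrite /m -[X in (X < _)%N]mul1n ltn_pmul2r// (leq_trans _ g3).
have m3 : (3 <= m)%N := leq_trans g3 (ltnW gm).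
have m0 : (0 < m)%N := leq_trans (isT : (0 < 3)%N) m3.
have mF : F <= m%:R.
  rewrite (le_trans (ler_norm _))// (le_trans (ltW (archi_boundP (normr_ge0 F))))// ler_nat.
  by rewrite (leq_trans _ (ltnW gm))// /g leq_addl.
have cq : continuous (fun r => ne r ^+ 2) by move=> r; apply: ctX; exact: (@cn r).
have [ka [w [y [v [z [/andP[ka_ge ka_le] odew odev v0 [w10 match1]]]]]]] :=
  @matching_eigenvalue R m p sigmae sigma1e (fun r => ne r ^+ 2) c S M1 M2 C1
    m0 c0 M11 M12 csigma csigma1 cq sigma_ge sigma_le sigma1_le dsigma n_sigma mF.
have mR0 : 0 < m%:R :> R by rewrite ltr0n.
have ka0 : 0 < ka by rewrite (lt_le_trans _ ka_ge)// divr_gt0 ?exprn_gt0// mulr_gt0.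
have [v00 cv cz dv dz] := odev; have [_ cw cy dw dy] := odew.
have g_ka (r : R) : 0 < r < 1 -> ka * cst 1 r <= (m + p + g)%:R * (m - g)%:R.
  move=> _; rewrite /= mulr1 (le_trans ka_le)// natrB ?(ltnW gm)// (natrD _ (m + p)%N) (natrD _ m) -/rho.
  have g0 : 0 <= g%:R :> R by [].
  have mg : g%:R <= m%:R :> R by rewrite ler_nat ltnW.
  have pg : 0 <= p%:R * (m%:R - g%:R) :> R by rewrite mulr_ge0// subr_ge0.
  have : g%:R ^+ 2 <= (1 - rho) * m%:R ^+ 2 :> R.
    by rewrite /m natrM exprMn mulrA -[leLHS]mul1r ler_wpM2r// sqr_ge0.
  have -> : (m%:R + p%:R + g%:R) * (m%:R - g%:R) =
    m%:R ^+ 2 - g%:R ^+ 2 + p%:R * (m%:R - g%:R) :> R by ring.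
  by move: (_ * _) (_ ^+ 2) pg => *; lra.
have one0 (r : R) : 0 < cst 1 r :> R by exact: ltr01.
have c1 : continuous (cst 1 : R -> R) by move=> r; exact: cvg_cst.
have QE (r : R) : 0 < r < 1 -> m%:R * 0 + ka * clamp r * 1 = m%:R * cst 0 r + ka * r * cst 1 r.
  by move=> /andP[r0 r1]; rewrite clamp_id// !ltW.
have dcst (r : R) : 0 < r < 1 -> is_derive r 1 (cst 1 : R -> R) (cst 0 r).
  by move=> _; exact: derC.
have growth := mode_growth m0 c1 one0 dcst QE odev gm erefl g_ka (ltW ka0) (fun=> ler01) v0.
have [a [b [ab E0 hE]]] := hC g v (ltnW gm) cv v0 growth.
have cmode := @continuous_mode R p m a b v cv.
exists (mode m a b (fun r => v 1 / w 1 * w r)), (mode m a b v), (Num.sqrt ka).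
have v10 : v 1 != 0 by rewrite gt_eqF// v0// ler01 lexx.
split.
- apply: (@transmission_pair R p m a b sigmae sigma1e (fun r => ne r ^+ 2) _
    (fun r => v 1 / w 1 * y r) v z ka) => //.
  + by move=> r; rewrite (lt_le_trans c0).
  + exact: continuous_scale.
  + exact: continuous_scale.
  + move=> r /andP[r0 _]; rewrite -mulrA; exact: derMc (dw r r0).
  + move=> r /andP[r0 r1]; have := derMc (v 1 / w 1) (dy r r0).
    move/is_derive_eq; apply; rewrite clamp_id ?ltW// /=.
    by move: (v 1 / w 1) (sigma1 r) (n r ^+ 2) => *; field; rewrite gt_eqF.
  + by move=> r /andP[r0 _]; exact: dv.
  + move=> r /andP[r0 r1]; have := dz r r0; rewrite clamp_id ?ltW//.
  + by rewrite divfK.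
  + move: match1; rewrite /conormal; set s1 := sigmae 1 => match1.
    apply: (mulfI w10); rewrite -match1; field; exact: w10.
  + by rewrite sqrtr_gt0.
  + by rewrite sqr_sqrtr// ltW.
  + by move=> r hr; rewrite /= clamp_id.
  + by move=> r hr; rewrite /= clamp_id.
  + exact: energy_gt0_neq0 cmode E0.
- apply: (@le_trans _ _ (Num.sqrt (m%:R ^+ 2 / (2 * M2)))); last exact: ler_wsqrtr.
  rewrite sqrtrM ?sqr_ge0// sqrtr_sqr ger0_norm// mulrC -/al ler_pM2r// ler_nat.
  by rewrite (leq_trans _ (ltnW gm))// /g -addnA leq_addr.
- by rewrite normL2_eball// lte_fin sqrtr_gt0.
- rewrite !normL2_eball//= divr_ge0 ?sqrtr_ge0//= ler_pdivrMr ?sqrtr_gt0//.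
  apply: (le_trans hE); apply: ler_wpM2r; first exact: sqrtr_ge0.
  apply: ler_wpM2l => //; apply: ler_wiXn2l => //; first exact: ltW.
  by rewrite /g -addnA leq_addr.
Qed.

End localized_eigenpairs.

(* The positivity of the norm of v_m makes the quotient meaningful, as 0 / 0 = 0
   in the library. *)
Theorem theorem2p1 (R : realType) (N : nat) (hN : N = 2%N \/ N = 3%N)
    (n sigma sigma' sigma'' : R -> R)
    (n_cont : {within `[0, 1], continuous n})
    (sigma_deriv : has_derivative_on `[0, 1] sigma sigma')
    (sigma'_deriv : has_derivative_on `[0, 1] sigma' sigma'')
    (sigma''_cont : {within `[0, 1], continuous sigma''})
    (sigma_lower : exists2 c : R, 0 < c & forall r, 0 <= r <= 1 -> c <= sigma r)
    (n1 n2 M1 M2 : R)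
    (n1_gt0 : 0 < n1) (n2_gt0 : 0 < n2) (M1_gt0 : 0 < M1) (M2_gt0 : 0 < M2)
    (A1 : forall r, 0 <= r <= 1 -> [/\ 1 < n1, n1 < n r & n r < n2])
    (A2 : 1 < M1 /\ M1 < M2)
    (A3 : forall r, 0 <= r <= 1 -> sigma' r <= 0)
    (A4 : forall r, 0 <= r <= 1 -> M1 <= n r ^+ 2 / sigma r <= M2)
    (A5 : forall r, 0 <= r <= 1 -> sigma' r ^+ 2 >= 2 * sigma'' r * sigma r)
    (tau : R) (htau : 0 < tau < 1) :
  exists (u v : nat -> 'rV[R]_N -> R) (k : nat -> R),
    [/\ forall m, transmission_eigenfunctions (eball 1) sigma n (k m) (u m) (v m),
        k m @[m --> \oo] --> +oo,
        forall m, (0 < normL2 (eball 1) (v m))%E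
      & fine (normL2 (eball tau) (v m)) / fine (normL2 (eball 1) (v m))
          @[m --> \oo] --> 0].
Proof.
have ccl := @continuous_clamp_comp R.
have cn : continuous (n \o clamp) := ccl _ n_cont.
have cs : continuous (sigma \o clamp) := ccl _ (has_derivative_on_continuous sigma_deriv).
have cs' : continuous (sigma' \o clamp) := ccl _ (has_derivative_on_continuous sigma'_deriv).
have [c c0 sigma_ge] := sigma_lower; have [M11 M12] := A2.
have [S _ hS] := clamp_comp_bound cs; have [C1 _ hC1] := clamp_comp_bound cs'.
have sigma_gt0 r : 0 < sigma (clamp r) by rewrite (lt_le_trans c0)// sigma_ge// clamp_itv.
have n_sigma r : M1 * (sigma \o clamp) r <= (n \o clamp) r ^+ 2 <= M2 * (sigma \o clamp) r.
  by rewrite -ler_pdivlMr//= -[X in _ && X]ler_pdivrMr//; exact: A4 (clamp_itv r).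
have key p : exists (u v : nat -> 'rV[R]_p.+2 -> R) (k : nat -> R),
    [/\ forall m, transmission_eigenfunctions (eball 1) sigma n (k m) (u m) (v m),
        k m @[m --> \oo] --> +oo,
        forall m, (0 < normL2 (eball 1) (v m))%E
      & fine (normL2 (eball tau) (v m)) / fine (normL2 (eball 1) (v m))
          @[m --> \oo] --> 0].
  have [al [C [th [al0 C0 /andP[th0 th1] pair]]]] := @localized_eigenpair R p n sigma sigma'
    c M1 M2 S C1 tau c0 M11 M12 cs cs' cn (fun r => sigma_ge _ (clamp_itv r))
    (fun r => le_trans (ler_norm _) (hS r)) hC1 (fun r => is_derive_clamp_comp sigma_deriv) n_sigma htau.
  have [u {}pair] := choice pair; have [v {}pair] := choice pair; have [k {}pair] := choice pair.
  exists u, v, k; split => [m||m|]; [by case: (pair m)| |by case: (pair m)|].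
    apply/cvgryPge => A; near=> j; have [_ hk _ _] := pair j.
    apply: le_trans hk; rewrite -ler_pdivrMl//; near: j; exact: nbhs_infty_ger.
  apply: (@squeeze_cvgr _ _ _ _ (cst 0) (fun j => C * th ^+ j)).
  - by near=> j; case: (pair j).
  - exact: cvg_cst.
  - by rewrite -(mulr0 C); apply: cvgM; [exact: cvg_cst|apply: cvg_expr; rewrite ger0_norm].
by case: hN => ->; [exact: (key 0%N)|exact: (key 1%N)].
Unshelve. all: by end_near.
Qed.
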